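(* In the setting described in the context, for every $3\le p<\infty$ there is a constant $c_p>0$, depending only on $p$, such that if $\lim_{T\to\infty}\|P_Tg\|_p=0$ for every $g\in L^p(m)$ (strong stability), then for every $f\in L^p(m)$ $$c_p\|f\|_p\le\|H\|_p .$$
   Context: Setting. $E$ is a locally compact separable metric space with Borel $\sigma$-algebra $\mathcal B(E)$, and $m$ is a Radon measure on $E$ with $\operatorname{supp} m=E$. $L^p(m)$ is the real $L^p$-space with norm $\|\cdot\|_p$. Let $d=\{(x,y)\in E\times E: x=y\}$. $(\mathcal E,\mathcal D(\mathcal E))$ is a regular (symmetric) Dirichlet form on $L^2(m)$ which is pure-jump: there is a symmetric jumping measure $J$ on $E\times E\setminus d$ such that $$\mathcal E(u,v)=\tfrac12\iint_{E\times E\setminus d}(u(y)-u(x))(v(y)-v(x))\,J(dx,dy)$$ for all $u,v\in\mathcal D(\mathcal E)$ (taken in quasi-continuous versions). It is assumed that $J$ is given by a kernel: $J(dx,dy)=J(x,dy)\,m(dx)$. $X=(X_t)$ is the associated $m$-symmetric Hunt process, with laws $\mathbb P_x$, expectations $\mathbb E_x$ and cemetery $\Delta$. Its semigroup $P_tg(x)=\mathbb E_x g(X_t)$ (with $g(\Delta)=0$; also used for non-negative measurable $g$, with values in $[0,\infty]$) extends to a semigroup of sub-Markovian contractions on $L^p(m)$, $1\le p\le\infty$, strongly continuous for $1\le p<\infty$ and symmetric on $L^2(m)$. Square function. The carré du champ operator is $\Gamma[u](x)=\tfrac12\int_{E\setminus\{x\}}(u(y)-u(x))^2\,J(x,dy)$.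 For $f\in L^p(m)$, $1<p<\infty$, $$H(x)=\Big(\int_0^\infty P_t\,\Gamma[P_tf](x)\,dt\Big)^{1/2}\in[0,\infty].$$ *)

(* Defs.v *)
From HB Require Import structures.
From mathcomp Require Import all_boot all_order all_algebra.
From mathcomp Require Import all_classical all_reals all_analysis.
From mathcomp Require Import measurable_realfun.
Set Implicit Arguments.
Unset Strict Implicit.
Unset Printing Implicit Defensive.
Import Order.TTheory GRing.Theory Num.Theory.
Import numFieldNormedType.Exports.
Local Open Scope classical_set_scope.
Local Open Scope ring_scope.

(* The library's measurable types are pointed, hence so is the state space. *)
#[short(type="pmetricType")]
HB.structure Definition PointedMetric (K : numDomainType) :=
  { M of Pointed M & Metric K M }.

Notation borel T := (g_sigma_algebraType (@open T)).

Definition separable (T : topologicalType) :=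
  exists2 S : set T, countable S & dense S.

Section state_space.
Context {R : realType} {E : pmetricType R}.
Variable m : {measure set (borel E) -> \bar R}.
Local Open Scope ereal_scope.

Definition radon :=
  (forall K : set E, compact K -> m K < +oo) /\
  (forall A : set (borel E), measurable A ->
    m A = ereal_sup [set m K | K in [set K : set E | compact K /\ K `<=` A]]).

Definition full_support :=
  forall U : set E, open U -> U !=set0 -> 0 < m U.

Definition inner2 (u v : borel E -> R) : R := (\int[m]_x (u x * v x))%R.

Definition Cc (u : E -> R) :=
  continuous u /\ compact (closure [set x | u x != 0%R]).

End state_space.

Section dirichlet_form.
Context {R : realType} {E : pmetricType R}.
Variable m : {measure set (borel E) -> \bar R}.
(* A form on the classes of L^2(m) is presented on representatives: its domain
   and its values are invariant under m-a.e. equality (field [df_ae]). *)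
Variables (D : set (borel E -> R)) (F : (borel E -> R) -> (borel E -> R) -> R).

Definition form1 u v : R := F u v + inner2 m u v.

Record dirichlet_form : Prop := {
  df_L2 : forall u, D u -> u \in Lfun m 2%:E ;
  df_ae : forall u v, D u -> measurable_fun [set: borel E] v ->
    u = v %[ae m] -> D v /\ forall w, D w -> F u w = F v w ;
  df_lin : forall a u v, D u -> D v -> D (fun x => a * u x + v x) ;
  df_zero : D (fun=> 0) ;
  df_dense : forall u, u \in Lfun m 2%:E -> forall e : R, 0 < e ->
    exists2 v, D v & ('N[m]_2%:E[EFin \o (u \- v)%R] < e%:E)%E ;
  df_linear : forall a u v w, D u -> D v -> D w ->
    F (fun x => a * u x + v x) w = a * F u w + F v w ;
  df_sym : forall u v, D u -> D v -> F u v = F v u ;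
  df_ge0 : forall u, D u -> 0 <= F u u ;
  df_closed : forall u_ : nat -> borel E -> R, (forall n, D (u_ n)) ->
    (forall e : R, 0 < e -> exists N, forall i j, (N <= i)%N -> (N <= j)%N ->
       form1 (u_ i \- u_ j) (u_ i \- u_ j) < e) ->
    exists2 u, D u & form1 (u_ n \- u) (u_ n \- u) @[n --> \oo] --> (0 : R) ;
  df_markov : forall u, D u ->
    let v := fun x => Num.min (Num.max (u x) 0) 1 in
    D v /\ F v v <= F u u }.

Record regular_form : Prop := {
  reg_form : forall u, D u -> forall e : R, 0 < e ->
    exists v, [/\ D v, Cc v & form1 (u \- v) (u \- v) < e] ;
  reg_unif : forall u : E -> R, Cc u -> forall e : R, 0 < e ->
    exists v, [/\ D v, Cc v & forall x, `|u x - v x| < e] }.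

(* 1-capacity of an open set *)
Definition capacity (G : set E) : \bar R :=
  ereal_inf [set (form1 u u)%:E | u in
    [set u | D u /\ {ae m, forall x, G x -> 1 <= u x}]].

Definition quasi_continuous (u : E -> R) :=
  forall e : R, 0 < e -> exists G : set E,
    [/\ open G, (capacity G < e%:E)%E & {within ~` G, continuous u}].

(* [J] and [Jk x] stand for measures on E * E minus the diagonal and on
   E \ {x}; only their values there are ever used. *)
Definition offdiag : set (borel E * borel E) := [set z | z.1 != z.2].

Definition jump_symmetric
    (J : {measure set (borel E * borel E) -> \bar R}) :=
  forall A, measurable A -> A `<=` offdiag -> J [set z | A (z.2, z.1)] = J A.

(* J(dx,dy) = J(x,dy) m(dx); the measurability clause, automatic for s-finite
   kernels, is what makes the right-hand side meaningful. *)
Definition jump_kernel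
    (J : {measure set (borel E * borel E) -> \bar R})
    (Jk : R.-ker (borel E) ~> (borel E)) :=
  forall A, measurable A -> A `<=` offdiag ->
    measurable_fun [set: borel E] (fun x => Jk x (xsection A x)) /\
    J A = (\int[m]_x Jk x (xsection A x))%E.

Definition pure_jump (J : {measure set (borel E * borel E) -> \bar R}) :=
  forall u v, D u -> D v -> quasi_continuous u -> quasi_continuous v ->
    (F u v)%:E = (2^-1%:E * \int[J]_(z in offdiag)
      ((u z.2 - u z.1) * (v z.2 - v z.1))%:E)%E.

End dirichlet_form.

Notation state E := (borel (one_point_compactification E)).

Section hunt_process.
Context {R : realType} {E : pmetricType R} {d : measure_display}
  {Omega : measurableType d}.

Definition stopping_time (Ft : R -> set (set Omega)) (tau : Omega -> \bar R) :=
  (forall w, 0 <= tau w)%E /\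
  forall t, 0 <= t -> Ft t [set w | (tau w <= t%:E)%E].

Definition stopped_events (Ft : R -> set (set Omega)) (tau : Omega -> \bar R) :
    set (set Omega) :=
  [set L | measurable L /\
    forall t, 0 <= t -> Ft t (L `&` [set w | (tau w <= t%:E)%E])].

End hunt_process.

(* Hunt process on E with cemetery [None]; [hp_P x] is the law started at x.
   Times are reals, only the nonnegative ones being relevant. *)
Record hunt_process (R : realType) (E : pmetricType R) (d : measure_display)
    (Omega : measurableType d) := {
  hp_P : R.-pker (state E) ~> Omega ;
  hp_X :> R -> Omega -> state E ;
  hp_filtration : R -> set (set Omega) ;
  hp_shift : R -> Omega -> Omega ;
  hp_sigma : forall t, 0 <= t -> sigma_algebra setT (hp_filtration t) ;
  hp_sub : forall t, 0 <= t -> hp_filtration t `<=` measurable ;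
  hp_mono : forall s t, 0 <= s -> s <= t ->
    hp_filtration s `<=` hp_filtration t ;
  hp_right : forall t, 0 <= t ->
    \bigcap_(s in [set s | t < s]) hp_filtration s `<=` hp_filtration t ;
  hp_adapted : forall t (B : set (state E)), 0 <= t -> measurable B ->
    hp_filtration t (hp_X t @^-1` B) ;
  hp_normal : forall x, hp_P x (hp_X 0 @^-1` [set x]) = 1%E ;
  hp_cemetery : forall w s t, 0 <= s -> s <= t ->
    hp_X s w = None -> hp_X t w = None ;
  hp_shiftE : forall s t w, 0 <= s -> 0 <= t ->
    hp_X s (hp_shift t w) = hp_X (t + s) w ;
  hp_rcont : forall w t, 0 <= t ->
    (hp_X s w : one_point_compactification E) @[s --> t^'+] -->
    (hp_X t w : one_point_compactification E) ;
  hp_llim : forall w t, 0 < t -> exists l : one_point_compactification E,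
    (hp_X s w : one_point_compactification E) @[s --> t^'-] --> l ;
  (* P_x(X_(tau+s) \in B | F_tau) = P_(X_tau)(X_s \in B) on {tau < oo}. The
     versions of this and of the next field for an arbitrary initial law mu
     follow by integrating in x, the filtration not being augmented. *)
  hp_strong_markov : forall tau, stopping_time hp_filtration tau ->
    forall x s (B : set (state E)) L, 0 <= s -> measurable B ->
    stopped_events hp_filtration tau L ->
    hp_P x [set w | [/\ L w, (tau w < +oo)%E & B (hp_X (fine (tau w) + s) w)]] =
    (\int[hp_P x]_(w in L `&` [set w | tau w < +oo])
       hp_P (hp_X (fine (tau w)) w) (hp_X s @^-1` B))%E ;
  hp_quasi_left : forall tau_ : nat -> Omega -> \bar R,
    (forall n, stopping_time hp_filtration (tau_ n)) ->
    (forall n w, tau_ n w <= tau_ n.+1 w)%E ->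
    forall x, {ae hp_P x, forall w,
      let tau := ereal_sup (range (tau_ ^~ w)) in (tau < +oo)%E ->
      (hp_X (fine (tau_ n w)) w : one_point_compactification E)
        @[n --> \oo] -->
      (hp_X (fine tau) w : one_point_compactification E)} }.

Section semigroup.
Context {R : realType} {E : pmetricType R} {d : measure_display}
  {Omega : measurableType d}.
Variables (m : {measure set (borel E) -> \bar R}) (X : hunt_process E Omega).

Definition semigroup (t : R) (g : borel E -> \bar R) (x : borel E) : \bar R :=
  (\int[hp_P X (Some x)]_w oapp g 0 (X t w))%E.

(* For f in L^p(m), E_x |f(X_t)| is finite for m-a.e. x; the value of [fine] at
   the other points is irrelevant. *)
Definition Rsemigroup (t : R) (f : borel E -> R) (x : borel E) : R :=
  fine (semigroup t (EFin \o f) x).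

Definition symmetric_process :=
  forall t (g h : borel E -> \bar R), 0 <= t ->
    measurable_fun [set: borel E] g -> measurable_fun [set: borel E] h ->
    (forall x, 0 <= g x)%E -> (forall x, 0 <= h x)%E ->
    (\int[m]_x (semigroup t g x * h x) = \int[m]_x (g x * semigroup t h x))%E.

(* The Dirichlet form of X is read off its L^2(m)-semigroup:
   E(u,v) = lim_(t -> 0) t^-1 (u - P_t u, v), with as domain the u in L^2(m)
   for which t^-1 (u - P_t u, u) has a finite limit. *)
Definition associated (D : set (borel E -> R))
    (F : (borel E -> R) -> (borel E -> R) -> R) :=
  let Ft t u v := t^-1 * inner2 m (u \- Rsemigroup t u) v in
  (forall u, D u <-> u \in Lfun m 2%:E /\
     exists l : R, Ft t u u @[t --> 0^'+] --> l) /\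
  (forall u v, D u -> D v -> Ft t u v @[t --> 0^'+] --> F u v).

Definition strongly_stable (p : R) :=
  forall g, g \in Lfun m p%:E ->
    'N[m]_p%:E[EFin \o Rsemigroup t g]%E @[t --> +oo] --> 0%E.

Variable Jk : R.-ker (borel E) ~> (borel E).

Definition carre_du_champ (u : borel E -> R) (x : borel E) : \bar R :=
  (2^-1%:E * \int[Jk x]_(y in ~` [set x]) ((u y - u x) ^+ 2)%:E)%E.

Definition square_function (f : borel E -> R) (x : borel E) : \bar R :=
  ((\int[lebesgue_measure]_(t in `[0%R, +oo[)
      semigroup t (carre_du_champ (Rsemigroup t f)) x) `^ 2^-1)%E.

End semigroup.

(* Main.v *)
(* Write p = 2q, u_t = P_t f and v_t = sgn(u_t)|u_t|^q, so that ||u_t||_p^p is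
   the squared L^2-norm of v_t. For a random variable U of mean a, the Bregman
   divergence E|U|^p - |a|^p is comparable to the variance of sgn(U)|U|^q;
   integrated over the starting point, this sandwiches the decay of ||u_t||_p^p
   over a time step s between constant multiples of <v_t - P_2s v_t, v_t>. A
   nonincreasing function has finite lower difference quotients at almost every
   t, where v_t therefore lies in the domain of the form, and the quotients are
   bounded by a multiple of E(v_t, v_t), hence by a multiple of the integral of
   |u_t|^(p-2) Gamma[u_t]. Integrating in t, from time 0 (L^2-continuity of the
   semigroup) to infinity (strong stability), bounds ||f||_p^p. Finally
   |u_t|^(p-2) <= P_t|f|^(p-2) by Jensen's inequality, as p >= 3, so that by
   symmetry the bound becomes the integral of |f|^(p-2) H^2, and Young's
   inequality concludes.

   The jump representation of E(v, v) is only needed for continuous v: Fatou's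
   lemma along continuous approximations turns it into an upper bound for every
   v of the domain, so quasi-continuous versions play no role. *)
Require Import Defs.
From HB Require Import structures.
From mathcomp Require Import all_boot all_order all_algebra.
From mathcomp Require Import all_classical all_reals all_analysis.
From mathcomp Require Import measurable_realfun.
From mathcomp Require Import ring lra.
Import Order.TTheory GRing.Theory Num.Theory.
Import numFieldNormedType.Exports.
Local Open Scope classical_set_scope.
Local Open Scope ring_scope.
Set Implicit Arguments.
Unset Strict Implicit.
Unset Printing Implicit Defensive.

(** * Pointwise inequalities for powers and signed powers *)

Section power_inequalities.
Context {R : realType}.
Implicit Types a b q : R.

(** The form is known only through its semigroup, so membership in its domain is read off the defect
    k(s) = <w - P_s w, w>. The function t -> <P_t w, w> is midpoint convex, hence k((n+1)s) <= (n+1)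
    k(s), and the quotients k(s)/s converge to their supremum as soon as they are bounded. This
    turns a bound on the difference quotients of the norm, along infinitely many small steps only,
    into membership of v_t in the domain. The second obstacle is measurability in (t, x). For P_t
    f(x) it comes from right continuity of the paths tested on a countable base. For Gamma[P_t f]
    the inner integral is cut down to a set that carries J and is a countable union of cells of
    finite kernel mass; the cut can only decrease Gamma, and H stands on the larger side of the
    inequality. Killing is absorbed by letting functions vanish at the cemetery, which makes P_t
    f(x) an expectation under a probability. *)

Definition signed_powR q a : R := Num.sg a * `|a| `^ q.

(** Remainder at b of the first-order expansion of |.|^(2q) at a. When a is the mean of U, averaging
    over b = U kills the linear term and leaves E|U|^(2q) - |a|^(2q). *)
Definition bregman_powR q a b : R :=
  `|b| `^ (2 * q) - `|a| `^ (2 * q) -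
  2 * q * signed_powR (2 * q - 1) a * (b - a).

(** Young's inequality for b and a^(q-1) with the conjugate exponents q and q/(q-1). *)
Lemma powR_tangent q a b : 1 < q -> 0 <= a -> 0 <= b ->
  a `^ q + q * a `^ (q - 1) * (b - a) <= b `^ q.
Proof.
move=> q1 a0 b0.
have q0 : 0 < q by lra.
have q10 : q - 1 != 0 by rewrite gt_eqF// subr_gt0.
have q'0 : 0 < q / (q - 1) by rewrite divr_gt0// subr_gt0.
have qq' : q^-1 + (q / (q - 1))^-1 = 1 by field; rewrite q10 gt_eqF.
have := conjugate_powR b0 (powR_ge0 a (q - 1)) q0 q'0 qq'.
rewrite -powRrM (_ : (q - 1) * (q / (q - 1)) = q); last by field.
move=> young.
have aq : a * a `^ (q - 1) = a `^ q by rewrite mulr_powRB1.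
rewrite mulrBr -!mulrA [_ * a]mulrC aq.
have {young} := ler_wpM2l (ltW q0) young.
rewrite (_ : q * (_ + _) = b `^ q + (q - 1) * a `^ q); last first.
  by field; rewrite q10 gt_eqF.
rewrite (mulrC b). lra.
Qed.

Lemma signed_powRN q a : signed_powR q (- a) = - signed_powR q a.
Proof. by rewrite /signed_powR sgrN normrN mulNr. Qed.

Lemma signed_powR_ge0E q a : 0 < q -> 0 <= a -> signed_powR q a = a `^ q.
Proof.
move=> q0; rewrite le_eqVlt => /predU1P[<-|a0]; rewrite /signed_powR.
  by rewrite sgr0 mul0r powR0// gt_eqF.
by rewrite gtr0_sg// mul1r gtr0_norm.
Qed.

Lemma bregman_powRN q a b : bregman_powR q (- a) (- b) = bregman_powR q a b.
Proof. by rewrite /bregman_powR !normrN signed_powRN; ring. Qed.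

(* With [x' = x `^ (q - 1)], every power of [x] below is a monomial in [x] and
   [x'], which makes the remaining inequalities polynomial. *)
Let powRE q a : 1 < q -> 0 <= a ->
  [/\ 0 <= a `^ (q - 1), a `^ q = a * a `^ (q - 1),
      a `^ (2 * q) = (a * a `^ (q - 1)) ^+ 2,
      a `^ (2 * q - 1) = a * (a `^ (q - 1)) ^+ 2 &
      a `^ (2 * q - 2) = (a `^ (q - 1)) ^+ 2].
Proof.
move=> q1 a0; have q0 : 0 < q by lra.
have aq : a `^ q = a * a `^ (q - 1) by rewrite mulr_powRB1.
have a2 : a `^ (2 * q - 2) = (a `^ (q - 1)) ^+ 2.
  by rewrite -powR_mulrn ?powR_ge0// -powRrM; congr (_ `^ _); ring.
split => //; first exact: powR_ge0.
- by rewrite mulrC powRrM -aq powR_mulrn ?powR_ge0.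
- rewrite -a2 -[in RHS](_ : 2 * q - 1 - 1 = 2 * q - 2); last by ring.
  by rewrite mulr_powRB1//; lra.
Qed.

Let powR_mono q a b : 1 < q -> 0 <= a -> a <= b -> a `^ (q - 1) <= b `^ (q - 1).
Proof.
move=> q1 a0 ab; apply: ge0_ler_powR => //; first by lra.
by rewrite nnegrE (le_trans a0).
Qed.

(** Let A, B be the signed powers and a >= 0. If b >= 0, the tangent to x^q at a gives the lower
    bound even with constant 1, and the tangent at b gives the upper one up to the term 2qA(b^(q-1)
    - a^(q-1))(b - a). If b < 0, the divergence is at least A^2 + B^2, whence the factor 1/2. *)
Lemma bregman_powR_bounds q a b : 1 < q ->
  2^-1 * (signed_powR q b - signed_powR q a) ^+ 2 <= bregman_powR q a b <=
  4 * q * (signed_powR q b - signed_powR q a) ^+ 2.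
Proof.
move=> q1.
wlog a0 : a b / 0 <= a.
  move=> ih; have [/ih//|a0] := leP 0 a.
  have := ih (- a) (- b); rewrite bregman_powRN !signed_powRN -opprD.
  by rewrite sqrrN; apply; lra.
have q0 : 0 < q by lra.
have q20 : 0 < 2 * q - 1 by lra.
have [a'0 aq a2q a2q1 _] := powRE q1 a0.
rewrite /bregman_powR (ger0_norm a0) !(signed_powR_ge0E _ a0)// a2q a2q1 aq.
have [b0|b0] := leP 0 b.
  have [b'0 bq b2q _ _] := powRE q1 b0.
  rewrite (ger0_norm b0) (signed_powR_ge0E _ b0)// b2q bq.
  have := powR_tangent q1 a0 b0; have := powR_tangent q1 b0 a0.
  rewrite aq bq.
  (* Regrouped as a(b' - a') times a'(b - a): by monotonicity each factor is at most |b b' - a a'|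
     in absolute value. *)
  have : a * a `^ (q - 1) * ((b `^ (q - 1) - a `^ (q - 1)) * (b - a)) <=
    (b * b `^ (q - 1) - a * a `^ (q - 1)) ^+ 2.
    have [ab|ba] := leP a b.
      have := powR_mono q1 a0 ab.
      move: (a `^ _) (b `^ _) a'0 b'0 => a' b' a'0 b'0 ab'.
      rewrite [leLHS](_ : _ = (a * (b' - a')) * (a' * (b - a))); last by ring.
      rewrite expr2; apply: ler_pM; try (by rewrite mulr_ge0// subr_ge0).
        by have := ler_wpM2r b'0 ab; lra.
      by have := ler_wpM2l b0 ab'; lra.
    have := powR_mono q1 b0 (ltW ba).
    move: (a `^ _) (b `^ _) a'0 b'0 => a' b' a'0 b'0 ab'.
    rewrite [leLHS](_ : _ = (a * (a' - b')) * (a' * (a - b))); last by ring.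
    rewrite -sqrrN opprB expr2.
    apply: ler_pM; try (by rewrite mulr_ge0// subr_ge0// ltW).
      by have := ler_wpM2r b'0 (ltW ba); lra.
    by have := ler_wpM2l b0 ab'; lra.
  move: (a `^ _) (b `^ _) a'0 b'0 => a' b' a'0 b'0 H1 H2 H3.
  have A0 : 0 <= a * a' by rewrite mulr_ge0.
  have S0 := sqr_ge0 (b * b' - a * a').
  have H2' := ler_wpM2l A0 H2; have H3' := ler_wpM2l A0 H3.
  have H1' := ler_wpM2l (ltW q0) H1.
  have qS : (b * b' - a * a') ^+ 2 <= q * (b * b' - a * a') ^+ 2.
    by rewrite ler_peMl// ltW.
  apply/andP; split; nra.
have {b b0} [c c0 ->] : exists2 c, 0 <= c & b = - c.
  by exists (- b); [lra|rewrite opprK].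
have [c'0 cq c2q _ _] := powRE q1 c0.
rewrite normrN (ger0_norm c0) signed_powRN (signed_powR_ge0E _ c0)// c2q cq.
(* Controls the cross term of the divergence, according to which of a and c is larger. *)
have : a `^ (q - 1) * c <= a * a `^ (q - 1) + c * c `^ (q - 1).
  have [ca|ac] := leP c a.
    by rewrite mulrC ler_wpDr ?ler_wpM2r// mulr_ge0.
  rewrite ler_wpDl ?mulr_ge0// mulrC ler_wpM2l//.
  by apply: powR_mono => //; exact: ltW.
move: (c `^ _) c'0 (a `^ _) a'0 {cq c2q aq a2q a2q1} => c' c'0 a' a'0 H.
have A0 : 0 <= a * a' by rewrite mulr_ge0.
have C0 : 0 <= c * c' by rewrite mulr_ge0.
have qA : 0 <= q * (a * a') by rewrite mulr_ge0// ltW.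
have H' := ler_wpM2l qA H.
have H0 : 0 <= q * (a * a') * (a' * c).
  by rewrite mulr_ge0// mulr_ge0.
have AC : 0 <= (a * a') * (c * c') by rewrite mulr_ge0.
have A2 := sqr_ge0 (a * a').
have C2 := sqr_ge0 (c * c').
have q10 : 0 <= q - 1 by lra.
have Q1 := mulr_ge0 q10 A2.
have Q2 := mulr_ge0 q10 C2.
have Q3 := mulr_ge0 q10 AC.
have S := sqr_ge0 (a * a' - c * c').
by apply/andP; split; nra.
Qed.

(** A mean value bound with the derivative q|x|^(q-1) taken at the endpoint of larger modulus,
    realised by the tangent inequality there. For opposite signs a^q + c^q <= (a + c) max(a^(q-1),
    c^(q-1)), and q^2 >= 1. *)
Lemma signed_powR_sub_sqr q a b : 1 < q ->
  (signed_powR q b - signed_powR q a) ^+ 2 <=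
  q ^+ 2 * ((b - a) ^+ 2 * (`|a| `^ (2 * q - 2) + `|b| `^ (2 * q - 2))).
Proof.
move=> q1; have q0 : 0 < q by lra.
have qq : 1 <= q ^+ 2 by rewrite expr2; nra.
wlog a0 : a b / 0 <= a.
  move=> ih; have [/ih//|a0] := leP 0 a.
  have /ih -/(_ (- b)) : 0 <= - a by lra.
  rewrite !signed_powRN !normrN.
  by rewrite -[X in X <= _]sqrrN -[(- b - _) ^+ 2]sqrrN !opprD !opprK.
have [a'0 aq _ _ a2] := powRE q1 a0.
rewrite (ger0_norm a0) (signed_powR_ge0E _ a0)// a2 aq.
have [b0|b0] := leP 0 b.
  have [b'0 bq _ _ b2] := powRE q1 b0.
  rewrite (ger0_norm b0) (signed_powR_ge0E _ b0)// b2 bq.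
  have := powR_tangent q1 a0 b0; have := powR_tangent q1 b0 a0.
  rewrite aq bq.
  have [ab|ba] := leP a b.
    move=> H _; have /(_ _ _) := @lerXn2r _ 2
      (b * b `^ (q - 1) - a * a `^ (q - 1))
      (q * b `^ (q - 1) * (b - a)).
    rewrite !nnegrE => /(_ _ _ _)/le_trans; apply.
    - by rewrite subr_ge0 ler_pM// powR_mono.
    - by rewrite !mulr_ge0// ?subr_ge0// ltW.
    - by lra.
    rewrite !exprMn -mulrA ler_wpM2l ?sqr_ge0// mulrC ler_wpM2l ?sqr_ge0//.
    by rewrite lerDr sqr_ge0.
  move=> _ H; have /(_ _ _) := @lerXn2r _ 2
    (a * a `^ (q - 1) - b * b `^ (q - 1))
      (q * a `^ (q - 1) * (a - b)).
  rewrite !nnegrE => /(_ _ _ _) H'.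
  rewrite -sqrrN opprB (le_trans (H' _ _ _))//.
  - by rewrite subr_ge0 ler_pM// ?powR_mono// ltW.
  - by rewrite !mulr_ge0// ?subr_ge0// ltW.
  - by lra.
  rewrite !exprMn -mulrA ler_wpM2l ?sqr_ge0// mulrC -(sqrrN (b - a)) opprB.
  by rewrite ler_wpM2l ?sqr_ge0// lerDl sqr_ge0.
have {b b0} [c c0 ->] : exists2 c, 0 <= c & b = - c.
  by exists (- b); [lra|rewrite opprK].
have [c'0 cq _ _ c2] := powRE q1 c0.
rewrite normrN (ger0_norm c0) signed_powRN (signed_powR_ge0E _ c0)// c2 cq.
have Hm := powR_mono q1.
have Hac : a <= c -> a `^ (q - 1) <= c `^ (q - 1) by exact: Hm.
have Hca : c <= a -> c `^ (q - 1) <= a `^ (q - 1) by exact: Hm.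
move: (c `^ _) c'0 (a `^ _) a'0 Hac Hca {cq c2 a2 aq} => c' c'0 a' a'0 Hac Hca.
rewrite -sqrrN opprD !opprK -[(- c - a) ^+ 2]sqrrN opprD !opprK
  (addrC (c * c')).
have P : 0 <= (c + a) ^+ 2 * (a' ^+ 2 + c' ^+ 2).
  by rewrite mulr_ge0 ?sqr_ge0// addr_ge0 ?sqr_ge0.
apply: (@le_trans _ _ ((c + a) ^+ 2 * (a' ^+ 2 + c' ^+ 2))); last first.
  by rewrite ler_peMl.
have X1 : 0 <= c * c' by rewrite mulr_ge0.
have X2 : 0 <= a * a' by rewrite mulr_ge0.
have [ac|ca] := leP a c.
  apply: (@le_trans _ _ (((c + a) * c') ^+ 2)).
    rewrite lerXn2r ?nnegrE ?addr_ge0 ?mulr_ge0 ?addr_ge0//.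
    by rewrite mulrDl addrC lerD2l ler_wpM2l// Hac.
  by rewrite exprMn ler_wpM2l ?sqr_ge0// lerDr sqr_ge0.
apply: (@le_trans _ _ (((c + a) * a') ^+ 2)).
  rewrite lerXn2r ?nnegrE ?addr_ge0 ?mulr_ge0 ?addr_ge0//.
  by rewrite mulrDl addrC lerD2r ler_wpM2l// Hca// ltW.
by rewrite exprMn ler_wpM2l ?sqr_ge0// lerDl sqr_ge0.
Qed.

End power_inequalities.

(** * Integrals and L^p membership through powers *)

Section integral_complements.
Context d (T : measurableType d) (R : realType).
Variable mu : {measure set T -> \bar R}.

Import HBNNSimple.

(* The integral of a nonnegative function, measurable or not, is a supremum over
   simple functions. *)
Lemma ge0_le_integral_nomeas (D : set T) (f g : T -> \bar R) :
  (forall x, D x -> 0 <= f x)%E -> (forall x, D x -> f x <= g x)%E ->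
  (\int[mu]_(x in D) f x <= \int[mu]_(x in D) g x)%E.
Proof.
move=> f0 fg; have g0 x : D x -> (0 <= g x)%E.
  by move=> Dx; exact: le_trans (f0 _ Dx) (fg _ Dx).
rewrite !ge0_integralE//; apply: le_ereal_sup => _ [h /= hf <-];
  exists h => //=.
move=> x; apply: le_trans (hf x) _; rewrite /patch; case: ifPn => //.
by move/set_mem; exact: fg.
Qed.

Lemma ge0_integrableP (f : T -> R) : measurable_fun setT f ->
  (forall x, 0 <= f x) ->
  mu.-integrable setT (EFin \o f) <-> (\int[mu]_x (f x)%:E < +oo)%E.
Proof.
move=> mf f0; split.
  case/integrableP => _; under eq_integral do rewrite gee0_abs ?lee_fin//.
  by [].
move=> foo; apply/integrableP; split; first exact/measurable_EFinP.
by under eq_integral do rewrite gee0_abs ?lee_fin//.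
Qed.

Lemma ge0_integralE_Rintegral (f : T -> R) :
  mu.-integrable setT (EFin \o f) ->
  (\int[mu]_x (f x)%:E)%E = (\int[mu]_x f x)%:E.
Proof. by move=> intf; rewrite fineK//; exact: integrable_fin_num. Qed.

Lemma integrable_EFinD (f g : T -> R) : mu.-integrable setT (EFin \o f) ->
  mu.-integrable setT (EFin \o g) ->
  mu.-integrable setT (EFin \o (fun x => f x + g x)).
Proof. by move=> intf intg; have := integrableD measurableT intf intg. Qed.

Lemma integrable_EFinB (f g : T -> R) : mu.-integrable setT (EFin \o f) ->
  mu.-integrable setT (EFin \o g) ->
  mu.-integrable setT (EFin \o (fun x => f x - g x)).
Proof. by move=> intf intg; have := integrableB measurableT intf intg. Qed.

Lemma integrable_EFinZ (a : R) (f : T -> R) :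
  mu.-integrable setT (EFin \o f) ->
  mu.-integrable setT (EFin \o (fun x => a * f x)).
Proof. by move=> intf; have := integrableZl measurableT a intf. Qed.

Lemma LfunP_powR (f : T -> R) (r : R) : 0 < r ->
  f \in Lfun mu r%:E <-> measurable_fun setT f /\
    (\int[mu]_x (`|f x| `^ r)%:E < +oo)%E.
Proof.
move=> r0; have /= E := powR_Lnorm mu (EFin \o f) (lt0r_neq0 r0).
rewrite inE; split.
  case/andP => /[!inE]/= mf lf; split => //.
  by rewrite -E poweR_lty.
move=> [mf lf]; apply/andP; rewrite !inE/=; split => //.
rewrite /finite_norm (@lty_poweRy _ _ r) ?gt_eqF//.
by rewrite E.
Qed.

Lemma normr_powR2 (a : R) : `|a| `^ 2 = a ^+ 2.
Proof. by rewrite powR_mulrn// real_normK ?num_real. Qed.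

Lemma Lfun2P (f : T -> R) : f \in Lfun mu 2%:E <->
  measurable_fun setT f /\ (\int[mu]_x (f x ^+ 2)%:E < +oo)%E.
Proof.
by rewrite LfunP_powR//; under eq_integral do rewrite normr_powR2.
Qed.

Lemma measurable_signed_powR (q : R) :
  measurable_fun setT (signed_powR q : R -> R).
Proof.
rewrite (_ : signed_powR q =
  fun a => if 0 <= a then if a == 0 then 0 else `|a| `^ q else - (`|a| `^ q)).
  have mp : measurable_fun setT (fun a : R => `|a| `^ q).
    by apply: (@measurableT_comp _ _ _ _ _ _ (fun a => a `^ q)) => //.
  apply: measurable_fun_ifT => //; last exact: measurable_funN.
    exact: measurable_fun_ler.
  apply: measurable_fun_ifT => //.
  exact: measurable_fun_eqr.
apply/funext => a; rewrite /signed_powR; case: sgrP => a0.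
- by rewrite mul0r.
- by rewrite mul1r.
- by rewrite mulN1r.
Qed.

End integral_complements.

(** * Jensen's inequality and the variance comparison under one probability *)

Section probability_inequalities.
Context d (T : measurableType d) (R : realType).
Variable P : probability T R.
Implicit Types U : T -> R.

Let powR_le1D (a r s : R) : 0 <= a -> 0 <= s <= r -> a `^ s <= 1 + a `^ r.
Proof.
move=> a0 /andP[s0 sr]; have [a1|a1] := leP 1 a.
  by rewrite ler_wpDl// ler_powR.
apply: (@le_trans _ _ 1); last by rewrite lerDl powR_ge0.
have -> : (1 : R) = 1 `^ s by rewrite powR1.
by apply: ge0_ler_powR => //; rewrite ?nnegrE// ltW.
Qed.

Let mpow U (r : R) : measurable_fun setT U ->
  measurable_fun setT (fun w => `|U w| `^ r).
Proof.
move=> mU; apply: (@measurableT_comp _ _ _ _ _ _ (fun a : R => a `^ r)) => //.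
exact: measurableT_comp.
Qed.

Lemma probability_integrable_cst (a : R) :
  P.-integrable setT (EFin \o (fun=> a)).
Proof. exact: finite_measure_integrable_cst. Qed.

Lemma probability_Rintegral_cst (a : R) : \int[P]_w a = a.
Proof. rewrite Rintegral_cst// -[RHS]mulr1; congr (_ * _).
exact: (congr1 fine (@probability_setT _ _ _ P)). Qed.

Lemma probability_integrable_powR U (r s : R) : measurable_fun setT U ->
  0 <= s <= r -> (\int[P]_w (`|U w| `^ r)%:E < +oo)%E ->
  P.-integrable setT (EFin \o (fun w => `|U w| `^ s)).
Proof.
move=> mU sr /ge0_integrableP intr.
apply: (@le_integrable _ _ _ _ _ _ _
  (EFin \o (fun w => 1 + `|U w| `^ r))) => //.
- by apply/measurable_EFinP; exact: mpow.
- move=> w _; rewrite lee_fin (ger0_norm (powR_ge0 _ _)).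
  by rewrite [leRHS]ger0_norm ?addr_ge0 ?powR_ge0// powR_le1D.
- apply: integrable_EFinD; first exact: probability_integrable_cst.
  by apply: intr; [exact: mpow|move=> x; exact: powR_ge0].
Qed.

Lemma probability_integrable_norm U (r : R) : measurable_fun setT U ->
  1 <= r -> (\int[P]_w (`|U w| `^ r)%:E < +oo)%E ->
  P.-integrable setT (EFin \o U).
Proof.
move=> mU r1 /(@probability_integrable_powR U r 1 mU).
rewrite ler01 r1 => /(_ isT) int1.
apply: le_integrable int1 => //; first exact/measurable_EFinP.
by move=> w _; rewrite /= lee_fin powRr1// normr_id.
Qed.

(** Average the tangent to x^r at the mean a of |U|: its linear part has mean zero. An infinite
    right-hand side is set aside first, and so is r = 1, where the tangent inequality does not
    apply. *)
Lemma jensen_powR U (r : R) : measurable_fun setT U -> 1 <= r ->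
  ((`|\int[P]_w U w| `^ r)%:E <= \int[P]_w (`|U w| `^ r)%:E)%E.
Proof.
move=> mU r1.
have [roo|] := ltP (\int[P]_w (`|U w| `^ r)%:E)%E +oo%E; last first.
  by rewrite leye_eq => /eqP ->; rewrite leey.
have intU := probability_integrable_norm mU r1 roo.
have intn : P.-integrable setT (EFin \o (fun w => `|U w|)).
  exact: integrable_norm.
have intr : P.-integrable setT (EFin \o (fun w => `|U w| `^ r)).
  by apply: probability_integrable_powR roo => //; lra.
rewrite ge0_integralE_Rintegral// lee_fin.
have le1 : `|\int[P]_w U w| <= \int[P]_w `|U w| by exact: le_normr_Rintegral.
have a0 : 0 <= \int[P]_w `|U w| by exact: Rintegral_ge0.
apply: (@le_trans _ _ ((\int[P]_w `|U w|) `^ r)).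
  by apply: ge0_ler_powR; rewrite ?nnegrE//; lra.
have [r2|r2] := eqVneq r 1.
  rewrite r2 powRr1//; under [leRHS]eq_Rintegral do rewrite powRr1//.
  by [].
have {r1 r2} r1 : 1 < r by rewrite lt_neqAle eq_sym r2.
set a := \int[P]_w `|U w| in a0 *.
have intt : P.-integrable setT
    (EFin \o (fun w => a `^ r + r * a `^ (r - 1) * (`|U w| - a))).
  apply: integrable_EFinD; first exact: probability_integrable_cst.
  apply: integrable_EFinZ; apply: integrable_EFinB => //.
  exact: probability_integrable_cst.
have := le_Rintegral measurableT intt intr.
move=> /(_ (fun w _ => powR_tangent r1 a0 (normr_ge0 _))).
apply: le_trans; rewrite RintegralD//; last 2 first.
- exact: probability_integrable_cst.
- apply: integrable_EFinZ; apply: integrable_EFinB => //.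
  exact: probability_integrable_cst.
rewrite RintegralZl//; last first.
  apply: integrable_EFinB => //.
  exact: probability_integrable_cst.
rewrite RintegralB//; last exact: probability_integrable_cst.
by rewrite !probability_Rintegral_cst -/a subrr mulr0 addr0.
Qed.

(* Both bounds compare the Bregman divergence of [|.|^2q] at a suitable base
   point with a square: the base point is the mean of [U] for the lower bound,
   and the point whose signed power is the mean of [V] for the upper one. *)
Lemma powR_variance_bounds U (q : R) : measurable_fun setT U -> 1 < q ->
  (\int[P]_w (`|U w| `^ (2 * q))%:E < +oo)%E ->
  2^-1 * (\int[P]_w (`|U w| `^ (2 * q)) -
          (\int[P]_w signed_powR q (U w)) ^+ 2) <=
  \int[P]_w (`|U w| `^ (2 * q)) - `|\int[P]_w U w| `^ (2 * q) <=
  4 * q * (\int[P]_w (`|U w| `^ (2 * q)) -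
           (\int[P]_w signed_powR q (U w)) ^+ 2).
Proof.
move=> mU q1 qoo.
set S := \int[P]_w (`|U w| `^ (2 * q)); pose V w := signed_powR q (U w).
rewrite (_ : \int[P]_w signed_powR q (U w) = \int[P]_w V w)//.
have q0 : 0 < q by lra.
have mV : measurable_fun setT V.
  exact: measurableT_comp (@measurable_signed_powR _ _) mU.
have normV w : `|V w| = `|U w| `^ q.
  rewrite /V /signed_powR normrM normr_sg; have [->|U0] := eqVneq (U w) 0.
    by rewrite normr0 mul0r powR0// gt_eqF.
  by rewrite mul1r ger0_norm// powR_ge0.
have V2 w : V w ^+ 2 = `|U w| `^ (2 * q).
  by rewrite -real_normK ?num_real// normV -powR_mulrn ?powR_ge0//
    -powRrM mulrC.
have intU : P.-integrable setT (EFin \o U).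
  by apply: probability_integrable_norm qoo => //; lra.
have intS : P.-integrable setT (EFin \o (fun w => `|U w| `^ (2 * q))).
  by apply: probability_integrable_powR qoo => //; lra.
have intV : P.-integrable setT (EFin \o V).
  have : P.-integrable setT (EFin \o (fun w => `|U w| `^ q)).
    by apply: probability_integrable_powR qoo => //; lra.
  apply: le_integrable => //; first exact/measurable_EFinP.
  by move=> w _ /=; rewrite lee_fin normV [leRHS]ger0_norm// powR_ge0.
set e := \int[P]_w U w; set v := \int[P]_w V w.
have intc a := probability_integrable_cst a.
pose intB := @integrable_EFinB _ _ _ P.
pose intD := @integrable_EFinD _ _ _ P.
pose intZ := @integrable_EFinZ _ _ _ P.
have breg_int a :
    P.-integrable setT (EFin \o (fun w => bregman_powR q a (U w))).
  rewrite /bregman_powR; apply: (intB); first exact: intB.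
  by apply: intZ; exact: intB.
have breg a : \int[P]_w bregman_powR q a (U w) =
    S - `|a| `^ (2 * q) - 2 * q * signed_powR (2 * q - 1) a * (e - a).
  rewrite RintegralB//; [|exact: intB|by apply: intZ; exact: intB].
  rewrite RintegralB// RintegralZl//; last exact: intB.
  by rewrite RintegralB// !probability_Rintegral_cst.
have sq_int c : P.-integrable setT (EFin \o (fun w => (V w - c) ^+ 2)).
  rewrite (_ : (fun w => _) =
    fun w => (`|U w| `^ (2 * q) - 2 * c * V w) + c ^+ 2).
    by apply: (intD); [apply: intB => //; exact: intZ|].
  by apply/funext => w; rewrite -V2; ring.
have sqE c : \int[P]_w ((V w - c) ^+ 2) = S - 2 * c * v + c ^+ 2.
  transitivity (\int[P]_w ((`|U w| `^ (2 * q) - 2 * c * V w) + c ^+ 2)).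
    by apply: eq_Rintegral => w _; rewrite -V2; ring.
  rewrite RintegralD//; last by apply: intB => //; exact: intZ.
  rewrite RintegralB//; last exact: intZ.
  by rewrite RintegralZl// probability_Rintegral_cst.
apply/andP; split.
  have : \int[P]_w (2^-1 * (V w - signed_powR q e) ^+ 2) <=
      \int[P]_w bregman_powR q e (U w).
    apply: le_Rintegral => //; first exact: intZ.
    by move=> w _; case/andP: (bregman_powR_bounds e (U w) q1).
  rewrite breg subrr mulr0 subr0; apply: le_trans.
  (* The second moment of [V] about any point is at least its variance. *)
  rewrite RintegralZl// sqE; have := sqr_ge0 (signed_powR q e - v); lra.
have [a av] : exists a, signed_powR q a = v.
  exists (signed_powR q^-1 v); rewrite /signed_powR normrM.
  have [->|v0] := eqVneq v 0; first by rewrite sgr0 !mul0r sgr0 mul0r.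
  have vp : 0 < `|v| `^ q^-1 by rewrite powR_gt0// normr_gt0.
  rewrite sgrM sgr_id (gtr0_sg vp) mulr1 normr_sg v0 mul1r (gtr0_norm vp).
  by rewrite -powRrM mulVf ?gt_eqF// powRr1// -numEsg.
have : \int[P]_w bregman_powR q a (U w) <=
    \int[P]_w (4 * q * (V w - v) ^+ 2).
  apply: le_Rintegral => //; first exact: intZ.
  by move=> w _; rewrite -av; case/andP: (bregman_powR_bounds a (U w) q1).
rewrite breg RintegralZl// sqE.
(* The averaged divergence at [a] exceeds S - |e|^(2q) by exactly this term, which can therefore be
   dropped. *)
have : 0 <= bregman_powR q a e.
  case/andP: (bregman_powR_bounds a e q1) => + _; apply: le_trans.
  by rewrite mulr_ge0// sqr_ge0.
rewrite /bregman_powR (_ : S - 2 * v * v + v ^+ 2 = S - v ^+ 2); last by ring.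
lra.
Qed.

End probability_inequalities.

(** * A countable base of relatively compact open sets *)

Section good_base.
Context {R : realType} {E : pmetricType R}.

Definition precompact_base (B : nat -> set E) :=
  [/\ forall n, open (B n), forall n, compact (closure (B n)) &
      forall (U : set E) x, open U -> U x ->
        exists n, B n x /\ closure (B n) `<=` U].

Lemma closure_metric_ball (x : E) (e : R) :
  closure (ball x e) `<=` [set y | mdist x y <= e].
Proof.
move=> y cly /=; apply/ler_addgt0Pl => r r0.
have [z []] := cly (ball y r) (nbhsx_ballx _ _ r0).
rewrite !ballEmdist /= => xz yz.
rewrite (le_trans (metric_triangle _ z _))// addrC lerD// ltW//.
by rewrite metric_sym.
Qed.

(** Balls of radius 1/(n+1) around a dense sequence, numbered through [pickle]; a code without such
    a ball, or with a ball that is not relatively compact, stands for the empty set. This base makes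
    path events, the off-diagonal set and sigma-finiteness countable matters. *)
Lemma precompact_baseP : locally_compact [set: E] -> separable E ->
  exists B, precompact_base B.
Proof.
move=> lcE [S cS dS].
have [f Sf] : exists f : nat -> E, S `<=` range f.
  have [->|[f]] := pfcard_geP cS; first by exists (fun=> point).
  by exists f => s /(@surj _ _ _ _ f)[n _ <-]; exists n.
pose b (kn : nat * nat) : set E := ball (f kn.1) (kn.2.+1%:R^-1 : R).
pose B (l : nat) : set E := if unpickle l is Some kn then
  if `[< compact (closure (b kn)) >] then b kn else set0 else set0.
have ob kn : open (b kn).
  rewrite /b openE => y /=; rewrite /interior ballEmdist /= => yb.
  pose r := kn.2.+1%:R^-1 - mdist (f kn.1) y.
  have r0 : 0 < r by rewrite subr_gt0.
  apply: filterS (nbhsx_ballx y r r0) => z; rewrite !ballEmdist /= => yz.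
  by rewrite (le_lt_trans (metric_triangle _ y _))// -ltrBrDl.
exists B; split.
- move=> l; rewrite /B; case: unpickle => [kn|]; last exact: open0.
  by case: ifPn => _; [exact: ob|exact: open0].
- move=> l; rewrite /B; case: unpickle => [kn|].
    by case: asboolP => // _; rewrite closure0; exact: compact0.
  by rewrite closure0; exact: compact0.
- move=> U x oU Ux.
  have [K] := lcE x I; rewrite withinET => Kx [cK clK].
  have : nbhs x (U `&` K) by apply: filterI => //; exact: open_nbhs_nbhs.
  rewrite nbhs_ballP => -[r /= r0 rUK].
  (* Below r/2, so that the closed ball around a dense point this close to [x] stays within r of
     [x]. *)
  have [n nr] : exists n, (n.+1%:R^-1 : R) < r / 2.
    have r20 : 0 < r / 2 by rewrite divr_gt0.
    have [n _ nr] := near_infty_natSinv_lt (PosNum r20).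
    by exists n; apply: (nr n) => /=.
  have n0 : 0 < (n.+1%:R^-1 : R) by rewrite invr_gt0.
  have [s [xs Ss]] : ball x (n.+1%:R^-1 : R) `&` S !=set0.
    apply: dS; last first.
      rewrite openE => y /=; rewrite /interior ballEmdist /= => yb.
      pose r' := n.+1%:R^-1 - mdist x y.
      have r'0 : 0 < r' by rewrite subr_gt0.
      apply: filterS (nbhsx_ballx y r' r'0) => z; rewrite !ballEmdist /= => yz.
      by rewrite (le_lt_trans (metric_triangle _ y _))// -ltrBrDl.
    by exists x; exact: ballxx.
  have [k _ ks] := Sf _ Ss.
  have clb : closure (b (k, n)) `<=` U `&` K.
    move=> y /closure_metric_ball /=; rewrite ks => sy; apply: rUK.
    rewrite ballEmdist /=; move: xs; rewrite ballEmdist /= => xs.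
    rewrite (le_lt_trans (metric_triangle _ s _))// (splitr r).
    by rewrite ltrD// ?(lt_trans xs)// (le_lt_trans sy).
  have cb : compact (closure (b (k, n))).
    by apply: (subclosed_compact _ cK); [exact: closed_closure|move=> y /clb[]].
  exists (pickle (k, n)); rewrite /B pickleK asboolT//; split.
    by rewrite /b /= ks; apply: ball_sym.
  by move=> y /clb[].
Qed.

End good_base.

(** * Borel sets of the state space with its cemetery *)

Section borel_state.
Context {R : realType} {E : pmetricType R}.
Local Notation opc := (one_point_compactification E).

Lemma open_measurable_borel (T : ptopologicalType) (U : set T) :
  open U -> measurable (U : set (borel T)).
Proof. by move=> oU; exact: sub_sigma_algebra. Qed.

Lemma borel_sigma_ind (T : ptopologicalType) (G : set (set T)) :
  sigma_algebra setT G -> (forall U, open U -> G U) ->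
  forall A : set (borel T), measurable A -> G A.
Proof. by move=> sG oG A mA; apply: mA; split => //; exact: oG. Qed.

Lemma continuous_measurable_borel (T T' : ptopologicalType) (f : T -> T') :
  continuous f -> measurable_fun setT (f : borel T -> borel T').
Proof.
move=> cf.
apply: (@measurability _ _ (borel T) (borel T') setT f (@open T')) => //.
move=> _ [U oU <-].
rewrite setTI; apply: open_measurable_borel; move/continuousP: cf; exact.
Qed.

Lemma measurable_Some : measurable_fun setT (Some : borel E -> state E).
Proof.
have := @one_point_compactification_some_continuous E.
exact: continuous_measurable_borel.
Qed.

Lemma measurable_image_Some (A : set (borel E)) : measurable A ->
  measurable (Some @` A : set (state E)).
Proof.
move: A; apply: borel_sigma_ind => [|U oU].
- split.
  + by rewrite image_set0.
  + move=> A mA; rewrite (_ : Some @` _ = Some @` setT `\` Some @` A).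
      apply: measurableD => //.
      apply: (@open_measurable_borel (one_point_compactification E)).
      exact/one_point_compactification_open_some/openT.
    apply/seteqP; split => [_ [x [_ Ax] <-]|_ [[x _ <-] Ax]].
      by split; [exists x|case=> y Ay [yx]; apply: Ax; rewrite -yx].
    by exists x => //; split => // Ax'; apply: Ax; exists x.
  + by move=> F mF; rewrite image_bigcup; exact: bigcupT_measurable.
- apply: (@open_measurable_borel (one_point_compactification E)).
  exact: one_point_compactification_open_some.
Qed.

Lemma measurable_None : measurable ([set None] : set (state E)).
Proof.
rewrite (_ : [set None] = ~` (Some @` setT)).
  by apply: measurableC; exact: (measurable_image_Some measurableT).
apply/seteqP; split => [_ -> [//]|[x|//]].
by case; exists x.
Qed.

(** The cemetery goes to the arbitrary [point]; functions composed with this map are cut off outside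
    [alive], which erases the choice. *)
Definition retract (s : state E) : borel E := odflt point s.

Lemma measurable_retract : measurable_fun setT retract.
Proof.
move=> _ A mA; rewrite setTI.
have [Ap|Ap] := pselect (A point).
  rewrite (_ : _ @^-1` _ = Some @` A `|` [set None]).
    by apply: measurableU;
      [exact: measurable_image_Some|exact: measurable_None].
  apply/seteqP; split => [[x Ax|_]|s [[x Ax <-]|->]]//=; last by right.
  by left; exists x.
rewrite (_ : _ @^-1` _ = Some @` A); first exact: measurable_image_Some.
apply/seteqP; split => [[x Ax|/Ap]|s [x Ax <-]]//=.
by exists x.
Qed.

Definition alive : set (state E) := Some @` setT.

Lemma measurable_alive : measurable alive.
Proof. exact: (measurable_image_Some measurableT). Qed.

End borel_state.

(** * Kernel integrals depending on a parameter *)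

Section kernel_parameter.
Context d0 d1 d2 (Z : measurableType d0) (X : measurableType d1)
  (Y : measurableType d2) (R : realType).
Variables (l : R.-ker X ~> Y) (phi : Z -> X).
Hypothesis mphi : measurable_fun setT phi.

Definition reindex_kernel (_ : measurable_fun setT phi) (z : Z) :
  {measure set Y -> \bar R} := l (phi z).

Let measurable_reindex U : measurable U ->
  measurable_fun setT (reindex_kernel mphi ^~ U).
Proof.
by move=> mU; exact: measurableT_comp (measurable_kernel l U mU) mphi.
Qed.

HB.instance Definition _ :=
  isKernel.Build _ _ _ _ R (reindex_kernel mphi) measurable_reindex.

Import HBNNSimple.

(** The parameter enters both the law and the integrand, and the bound on the mass may vary with
    it. *)
Lemma measurable_integral_kernel_param (k : Z * Y -> \bar R) :
  (forall x, l x setT < +oo)%E -> (forall zy, 0 <= k zy)%E ->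
  measurable_fun setT k ->
  measurable_fun setT (fun z => \int[l (phi z)]_y k (z, y))%E.
Proof.
move=> lfin k0 mk.
apply: (measurable_fun_xsection_integral k (reindex_kernel mphi)
  (nnsfun_approx measurableT mk)).
- by move=> a b ab; exact/nd_nnsfun_approx.
- by move=> z; exact/cvg_nnsfun_approx.
move=> n r; set A := _ @^-1` _.
have mA : measurable A by exact: measurable_funPTI.
have [|_] := @measurable_prod_subset_xsection_kernel _ _ Z Y R
  (reindex_kernel mphi : R.-ker Z ~> Y) setT measurableT _ A mA.
  move=> z; have lz : l (phi z) setT \is a fin_num by rewrite ge0_fin_numE.
  exists (fine (l (phi z) setT) + 1) => U mU.
  rewrite /mrestr setIT EFinD fineK//.
  by rewrite (@le_lt_trans _ _ (l (phi z) setT))// ?le_measure ?inE// lteDl.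
by rewrite /mrestr; under eq_fun do rewrite setIT.
Qed.

End kernel_parameter.

(** * Joint measurability in time and path *)

Section process_measurability.
Context {R : realType} {E : pmetricType R} {d : measure_display}
  {Omega : measurableType d}.
Variables (X : hunt_process E Omega) (B : nat -> set E).
Hypothesis HB : precompact_base B.

(** Negative times are folded onto 0, so that measurability can be stated on the whole product. *)
Definition path_map (z : R * Omega) : state E := X (Num.max z.1 0) z.2.

Let preimage_hp (t : R) (A : set (state E)) : 0 <= t -> measurable A ->
  measurable (X t @^-1` A).
Proof.
by move=> t0 mA; have := @hp_sub _ _ _ _ X t t0 _ (hp_adapted X t0 mA).
Qed.

(* Right continuity along the times (k+1)/(n+1) just above [t]: the limit is in
   [U] iff these values are eventually in some basic set with closure in [U]. *)
Let measurable_path_map_open (U : set E) : open U ->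
  measurable [set z | (Some @` U) (path_map z)].
Proof.
move=> oU; have [oB cB bB] := HB.
pose A (i n : nat) : set (R * Omega) := \bigcup_k
  ((fun t : R => Num.max t 0 * n.+1%:R) @^-1` `[k%:R, k.+1%:R[ `*`
   X (k.+1%:R / n.+1%:R) @^-1` (Some @` B i)).
have mA i n : measurable (A i n).
  apply: bigcupT_measurable => k; apply: measurableX; last first.
    apply: preimage_hp; first by rewrite divr_ge0.
    apply: (@measurable_image_Some R E); apply: (@open_measurable_borel E).
    exact: oB.
  rewrite -[X in measurable X]setTI.
  have mf : measurable_fun setT (fun t : R => Num.max t 0 * n.+1%:R).
    by apply: measurable_funM => //; exact: measurable_maxr.
  exact: mf.
rewrite (_ : [set z | _] = \bigcup_(i in [set i | closure (B i) `<=` U])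
    \bigcup_N \bigcap_(n in [set n | (N <= n)%N]) A i n); last first.
  apply/seteqP; split => [[t w]|[t w] [i BU [N _ AN]]].
    rewrite /path_map /=; set s := Num.max t 0.
    have s0 : 0 <= s by rewrite le_max lexx orbT.
    move=> [x Ux xE]; have [i [Bix BU]] := bB U x oU Ux.
    exists i => //.
    have := @hp_rcont _ _ _ _ X w s s0 (Some @` B i).
    rewrite -xE => /(_ _)[].
      apply: one_point_compactification_some_nbhs.
      by apply: open_nbhs_nbhs; split.
    move=> e /= e0 He.
    have [N _ HN] := near_infty_natSinv_lt (PosNum e0).
    exists N => // n /= Nn.
    have n0 : 0 < n.+1%:R :> R by [].
    pose k := Num.truncn (s * n.+1%:R).
    have /andP[k1 k2] : k%:R <= s * n.+1%:R < k.+1%:R.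
      by apply: truncn_itv; rewrite mulr_ge0.
    exists k => //; split => /=; first by rewrite in_itv/= k1 k2.
    have sk : s < k.+1%:R / n.+1%:R by rewrite ltr_pdivlMr.
    apply: He => //=; rewrite distrC gtr0_norm ?subr_gt0//.
    rewrite ltrBlDl ltr_pdivrMr// (@le_lt_trans _ _ (s * n.+1%:R + 1))//.
      by rewrite -natr1 lerD2r.
    rewrite mulrDl ltrD2l -ltr_pdivrMr// mul1r.
    exact: (HN n).
  rewrite /path_map /=; set s := Num.max t 0.
  have s0 : 0 <= s by rewrite le_max lexx orbT.
  have : (Some @` closure (B i)) (X s w).
    apply: contrapT => Xs.
    have : nbhs (X s w : one_point_compactification E)
        (~` (Some @` closure (B i))).
      case XE : (X s w) => [y|].
        apply: (@filterS _ _ _ (Some @` (~` closure (B i)))).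
          by move=> _ [z nz <-] [z' z'B [zz']]; apply: nz; rewrite -zz'.
        apply: one_point_compactification_some_nbhs.
        apply: open_nbhs_nbhs; split; first exact/closed_openC/closed_closure.
        by move=> yB; apply: Xs; rewrite XE; exists y.
      (* By compactness of this closure, its complement is a neighbourhood of the cemetery too. *)
      exists (closure (B i)); first by split => //; exact: closed_closure.
      by move=> _ [[z nz <-] [z' z'B [zz']]|-> [//]]; apply: nz; rewrite -zz'.
    move=> /(@hp_rcont _ _ _ _ X w s s0)[e /= e0 He].
    have [N' _ HN] := near_infty_natSinv_lt (PosNum e0).
    have [|k _ [/=]] := AN (maxn N N'); first by rewrite /= leq_maxl.
    set n := maxn N N'; rewrite in_itv/= -/s => /andP[k1 k2] [y By yE].
    have n0 : 0 < n.+1%:R :> R by [].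
    have sk : s < k.+1%:R / n.+1%:R by rewrite ltr_pdivlMr.
    apply: (He (k.+1%:R / n.+1%:R)) => //=.
      rewrite distrC gtr0_norm ?subr_gt0//.
      rewrite ltrBlDl ltr_pdivrMr// (@le_lt_trans _ _ (s * n.+1%:R + 1))//.
        by rewrite -natr1 lerD2r.
      rewrite mulrDl ltrD2l -ltr_pdivrMr// mul1r.
      by apply: (HN n) => /=; rewrite leq_maxr.
    by rewrite -yE; exists y => //; exact: subset_closure.
  by move=> [y yB yE]; exists y => //; exact: BU.
apply: bigcup_measurable => i _; apply: bigcupT_measurable => N.
by apply: bigcap_measurable => //; exists N => /=.
Qed.

Lemma measurable_path_map_set (A : set (borel E)) : measurable A ->
  measurable [set z | (Some @` A) (path_map z)].
Proof.
move: A; apply: (@borel_sigma_ind E); last exact: measurable_path_map_open.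
split.
- by rewrite image_set0 (_ : [set _ | _] = set0).
- move=> A mA; rewrite (_ : [set z | _] =
    [set z | (Some @` setT) (path_map z)] `\`
    [set z | (Some @` A) (path_map z)]).
    apply: measurableD => //; apply: measurable_path_map_open; exact: openT.
  apply/seteqP; split => [z [x [_ Ax] xz]|z [[x _ xz] Az]].
    by split; [exists x|case=> y Ay; rewrite -xz => -[yx]; apply: Ax;
      rewrite -yx].
  by exists x => //; split => // Ax'; apply: Az; exists x.
- move=> F mF; rewrite (_ : [set z | _] =
    \bigcup_n [set z | (Some @` F n) (path_map z)]);
      first exact: bigcupT_measurable.
  by apply/seteqP; split => z; rewrite image_bigcup.
Qed.

Lemma measurable_path_map_alive : measurable [set z | alive (path_map z)].
Proof. exact: (measurable_path_map_set measurableT). Qed.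

Lemma measurable_retract_path_map : measurable_fun setT (retract \o path_map).
Proof.
move=> _ A mA; rewrite setTI.
have mN : measurable [set z | path_map z = None].
  rewrite (_ : [set z | _] = ~` [set z | alive (path_map z)]).
    by apply: measurableC; exact: measurable_path_map_alive.
  apply/seteqP; split => [z /= -> [//]|z /=].
  by case: (path_map z) => // x []; exists x.
have [Ap|Ap] := pselect (A point).
  rewrite (_ : _ @^-1` _ =
    [set z | (Some @` A) (path_map z)] `|` [set z | path_map z = None]).
    by apply: measurableU => //; exact: measurable_path_map_set.
  apply/seteqP; split => [z|z] /=; rewrite /retract.
    by case: (path_map z) => [x Ax|_]; [left; exists x|right].
  by case => [[x Ax <-]|->].
rewrite (_ : _ @^-1` _ = [set z | (Some @` A) (path_map z)]).
  exact: measurable_path_map_set.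
apply/seteqP; split => [z|z] /=; rewrite /retract.
  by case: (path_map z) => [x Ax|//]; exists x.
by move=> [x Ax <-].
Qed.

Lemma measurable_path_fun (G : R * borel E -> \bar R) : measurable_fun setT G ->
  measurable_fun setT (fun z : R * Omega =>
    oapp (fun y => G (z.1, y)) 0%E (path_map z)).
Proof.
move=> mG.
rewrite (_ : (fun z => _) =
  (fun z : R * Omega => G (z.1, retract (path_map z))) \_
    [set z | alive (path_map z)]).
  apply/(measurable_restrictT _ measurable_path_map_alive).
  apply: measurable_funTS; apply: (measurableT_comp mG).
  apply: measurable_fun_pair => //; exact: measurable_retract_path_map.
apply/funext => z; rewrite /patch.
case: ifPn => [/set_mem /= [x _ <-]//|/negP za].
by case zE : (path_map z) => [x|//]; case: za; rewrite inE /= zE; exists x.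
Qed.

(** The integrand may vary with time, as the carré du champ of P_t f does in the square function. *)
Lemma measurable_semigroup2 (G : R * borel E -> \bar R) :
  measurable_fun setT G -> (forall z, 0 <= G z)%E ->
  measurable_fun setT (fun z : R * borel E =>
    semigroup X (Num.max z.1 0) (fun y => G (z.1, y)) z.2).
Proof.
move=> mG G0.
have mphi : measurable_fun setT (fun z : R * borel E => Some z.2 : state E).
  by apply: (measurableT_comp (@measurable_Some R E)).
apply: (@measurable_integral_kernel_param _ _ _ _ _ _ R (hp_P X)
  (fun z : R * borel E => Some z.2 : state E) mphi
  (fun zw => oapp (fun y => G (zw.1.1, y)) 0%E (path_map (zw.1.1, zw.2)))).
- move=> x; rewrite (_ : hp_P X x setT = 1%E) ?ltry//.
  exact: prob_kernel.
- by move=> [[t x] w] /=; case: (path_map _) => /=.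
- have m2 : measurable_fun setT
      (fun zw : (R * borel E) * Omega => (zw.1.1, zw.2)).
    apply: measurable_fun_pair => //.
    exact: (measurableT_comp measurable_fst measurable_fst).
  exact: (measurableT_comp (measurable_path_fun mG) m2).
Qed.

End process_measurability.

(** * Integration against mixtures of measures *)

Section integral_mixture.
Context d1 d2 (W : measurableType d1) (T : measurableType d2) (R : realType).
Variables (P : {measure set W -> \bar R}) (mu : {measure set T -> \bar R})
  (nu : W -> {measure set T -> \bar R}).
Local Open Scope ereal_scope.
Hypothesis mnu : forall A, measurable A -> measurable_fun setT (nu ^~ A).
Hypothesis muE : forall A, measurable A -> mu A = \int[P]_w nu w A.

Import HBNNSimple.

Let integral_mixture_nnsfun (f : {nnsfun T >-> R}) :
  \int[mu]_z (f z)%:E = \int[P]_w \int[nu w]_z (f z)%:E.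
Proof.
have sE (m : {measure set T -> \bar R}) : \int[m]_z (f z)%:E =
    \sum_(r \in range f) r%:E * m (f @^-1` [set r]).
  by rewrite (integralT_nnsfun m f) sintegralE.
rewrite sE; under [RHS]eq_integral do rewrite sE.
rewrite ge0_integral_fsum//; last 2 first.
- by move=> r; apply: measurable_funeM; apply: mnu; exact: measurable_funPTI.
- move=> r w _; have [r0|r0] := leP 0%R r; first by rewrite mule_ge0// lee_fin.
  by rewrite preimage_nnfun0// measure0 mule0.
apply: eq_fsbigr => r _.
have [r0|r0] := leP 0%R r; last first.
  rewrite preimage_nnfun0// measure0 mule0 integral0_eq// => w _.
  by rewrite measure0 mule0.
have mfr : measurable (f @^-1` [set r]) by exact: measurable_funPTI.
by rewrite muE// ge0_integralZl//; exact: mnu.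
Qed.

Lemma integral_mixture (f : T -> \bar R) : (forall z, 0 <= f z) ->
  measurable_fun setT f ->
  \int[mu]_z f z = \int[P]_w \int[nu w]_z f z.
Proof.
move=> f0 mf.
pose f_ := nnsfun_approx measurableT mf.
have cvgf (m : {measure set T -> \bar R}) :
    \int[m]_z f z = limn (fun n => \int[m]_z (f_ n z)%:E).
  rewrite -monotone_convergence//; last 3 first.
  - by move=> n; exact/measurable_EFinP.
  - by move=> n z _; rewrite lee_fin.
  - by move=> z _ a b ab; rewrite lee_fin; exact/lefP/nd_nnsfun_approx.
  by apply: eq_integral => z _; apply/esym/cvg_lim => //=;
    exact: cvg_nnsfun_approx.
rewrite cvgf; under eq_fun do rewrite integral_mixture_nnsfun.
rewrite -monotone_convergence//; last 3 first.
- move=> n; apply: measurable_fun_integral_kernel => //.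
    by move=> z; rewrite lee_fin.
  exact/measurable_EFinP.
- by move=> n y _; apply: integral_ge0 => // z _; rewrite lee_fin.
- move=> y _ a b ab; apply: ge0_le_integral => //.
  + by move=> z _; rewrite lee_fin.
  + exact/measurable_EFinP.
  + exact/measurable_EFinP.
  + by move=> z _; rewrite lee_fin; exact/lefP/nd_nnsfun_approx.
by apply: eq_integral => w _; rewrite cvgf.
Qed.

End integral_mixture.

Section integral_pushforward_mixture.
Context d0 d1 d2 d3 (V : measurableType d0) (W : measurableType d1)
  (W' : measurableType d3) (T : measurableType d2) (R : realType).
Variables (Q : {measure set V -> \bar R}) (P : {measure set W -> \bar R})
  (nu : W -> {measure set W' -> \bar R}) (f : V -> T) (h : W -> W' -> T).
Local Open Scope ereal_scope.
Hypothesis mf : measurable_fun setT f.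
Hypothesis mh : forall w, measurable_fun setT (h w).
Hypothesis mnu : forall A, measurable A ->
  measurable_fun setT (fun w => nu w (h w @^-1` A)).
Hypothesis muE : forall A, measurable A ->
  Q (f @^-1` A) = \int[P]_w nu w (h w @^-1` A).

(** Serves twice: for the Markov property, with the law restarted at [X t w], and for the
    disintegration of J along its kernel. *)
Lemma integral_pushforward_mixture (g : T -> \bar R) : (forall z, 0 <= g z) ->
  measurable_fun setT g ->
  \int[Q]_v g (f v) = \int[P]_w \int[nu w]_z g (h w z).
Proof.
move=> g0 mg.
have /(_ mf mh) := @integral_mixture _ _ W T R P (pushforward Q f)
  (fun w => pushforward (nu w) (h w)) mnu muE g g0 mg.
rewrite ge0_integral_pushforward// preimage_setT => ->.
by apply: eq_integral => w _; rewrite ge0_integral_pushforward// preimage_setT.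
Qed.

End integral_pushforward_mixture.

(** * The semigroup on nonnegative functions *)

Section semigroup_nonneg.
Context {R : realType} {E : pmetricType R} {d : measure_display}
  {Omega : measurableType d}.
Variables (m : {measure set (borel E) -> \bar R}) (X : hunt_process E Omega)
  (B : nat -> set E).
Hypothesis HB : precompact_base B.
Local Open Scope ereal_scope.
Implicit Types (t s : R) (g h : borel E -> \bar R).

(** A copy of [hp_P X x] to which the probability structure is attached. *)
Definition start_law (x : state E) : set Omega -> \bar R := hp_P X x.

HB.instance Definition _ x := Measure.on (start_law x).

Let start_law_setT x : start_law x setT = 1.
Proof. exact: prob_kernel. Qed.

HB.instance Definition _ x :=
  Measure_isProbability.Build _ _ _ (start_law x) (start_law_setT x).

Lemma measurable_hunt t : (0 <= t)%R -> measurable_fun setT (X t).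
Proof.
move=> t0 _ A mA; rewrite setTI.
by have := @hp_sub _ _ _ _ X t t0 _ (hp_adapted X t0 mA).
Qed.

Lemma measurable_oapp g : measurable_fun setT g ->
  measurable_fun setT (oapp g 0 : state E -> \bar R).
Proof.
move=> mg; rewrite (_ : oapp g 0 = (g \o retract) \_ (@alive R E)).
  apply/(measurable_restrictT _ (@measurable_alive R E)).
  by apply: measurable_funTS; apply: (measurableT_comp mg);
    exact: measurable_retract.
apply/funext => -[x|]; rewrite /patch.
  by rewrite mem_set//; exists x.
by case: ifPn => // /set_mem [].
Qed.

Lemma measurable_oapp_hunt t g : (0 <= t)%R -> measurable_fun setT g ->
  measurable_fun setT (fun w => oapp g 0 (X t w)).
Proof.
move=> t0 mg.
exact: (measurableT_comp (measurable_oapp mg) (measurable_hunt t0)).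
Qed.

Lemma semigroup_ge0 t g x : (forall y, 0 <= g y) -> 0 <= semigroup X t g x.
Proof. by move=> g0; apply: integral_ge0 => w _; case: (X t w) => /=. Qed.

Lemma measurable_semigroup t g : (0 <= t)%R -> measurable_fun setT g ->
  (forall y, 0 <= g y) -> measurable_fun setT (semigroup X t g).
Proof.
move=> t0 mg g0.
have mG : measurable_fun setT (fun z : R * borel E => g z.2).
  exact: measurableT_comp.
have := @measurable_semigroup2 _ _ _ _ X B HB _ mG (fun z => g0 z.2).
move=> /(@measurable_fun_pair2 _ _ _ _ _ _ _ t) /=.
by rewrite (max_idPl t0).
Qed.

Lemma semigroup_le t g h x : (0 <= t)%R -> (forall y, 0 <= g y) ->
  (forall y, g y <= h y) -> semigroup X t g x <= semigroup X t h x.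
Proof.
move=> t0 g0 gh; apply: ge0_le_integral_nomeas => w _;
  first by case: (X t w) => /=.
by case: (X t w) => /=.
Qed.

Lemma semigroup_cst1 t x : (0 <= t)%R -> semigroup X t (cst 1) x <= 1.
Proof.
move=> t0.
have P1 : hp_P X (Some x) setT = 1 by exact: prob_kernel.
rewrite -[leRHS]P1 -[leRHS]mul1e -integral_cst//.
apply: ge0_le_integral_nomeas => w _; case: (X t w) => [y|] //=; exact: lee01.
Qed.

(* The process started at the cemetery stays there. *)
Lemma hunt_cemetery t (g : borel E -> \bar R) : (0 <= t)%R ->
  measurable_fun setT g -> \int[hp_P X None]_w oapp g 0 (X t w) = 0.
Proof.
move=> t0 mg.
rewrite (@ae_eq_integral _ _ _ (hp_P X None) setT (cst 0))//.
- exact: integral0.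
- exact: measurable_oapp_hunt.
have mN : measurable (X 0%R @^-1` [set None]).
  rewrite -[X in measurable X]setTI; apply: (measurable_hunt (lexx 0%R)) => //.
  exact: measurable_None.
exists (~` (X 0%R @^-1` [set None])); split; first exact: measurableC.
- transitivity (1 - hp_P X None (X 0%R @^-1` [set None])).
    exact: (probability_setC (start_law None) mN).
  by rewrite hp_normal subee.
- move=> w /= H Xw; apply: H => _.
  by rewrite (@hp_cemetery _ _ _ _ X w 0%R t).
Qed.

(** The strong Markov property at the deterministic time t, on the whole sample space. Paths already
    at the cemetery contribute 0 to both sides. *)
Lemma semigroup_add t s g x : (0 <= t)%R -> (0 <= s)%R ->
  measurable_fun setT g -> (forall y, 0 <= g y) ->
  semigroup X (t + s) g x = semigroup X t (semigroup X s g) x.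
Proof.
move=> t0 s0 mg g0.
have ts0 : (0 <= t + s)%R by rewrite addr_ge0.
have mog := measurable_oapp mg.
have og0 y : 0 <= oapp g 0 y by case: y => /=.
have markov (A : set (state E)) : measurable A ->
    hp_P X (Some x) (X (t + s)%R @^-1` A) =
    \int[hp_P X (Some x)]_w hp_P X (X t w) (X s @^-1` A).
  move=> mA.
  have st : stopping_time (hp_filtration X) (cst t%:E).
    split=> [w|r r0]; first by rewrite lee_fin.
    have [tr|rt] := leP t r.
      rewrite (_ : [set _ | _] = setT); last first.
        by apply/seteqP; split => //= w _ /=; rewrite lee_fin.
      have [F0 FC _] := hp_sigma X r0.
      by rewrite -(setD0 setT); exact: FC.
    rewrite (_ : [set _ | _] = set0); last first.
      by apply/seteqP; split => //= w /=; rewrite lee_fin leNgt rt.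
    by have [] := hp_sigma X r0.
  have LT : stopped_events (hp_filtration X) (cst t%:E) setT.
    split => // r r0; rewrite setTI; by have [_] := st; exact.
  have := @hp_strong_markov _ _ _ _ X _ st (Some x) s A setT s0 mA LT.
  rewrite (_ : [set w | _] = X (t + s)%R @^-1` A); last first.
    apply/seteqP; split => [w [_ _ //]|w Aw]; split => //=.
    by rewrite ltry.
  rewrite (_ : setT `&` _ = setT)//.
  by apply/seteqP; split => // w _; split => //=; rewrite ltry.
rewrite /semigroup.
rewrite (@integral_pushforward_mixture _ _ _ _ _ _ _ (state E) R _
  (hp_P X (Some x)) (fun w => hp_P X (X t w)) (X (t + s)%R) (fun=> X s)
  (measurable_hunt ts0) (fun=> measurable_hunt s0) _ markov _ og0 mog);
    last first.
  move=> A mA; have mXA : measurable (X s @^-1` A).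
    by rewrite -[X in measurable X]setTI; exact: measurable_hunt.
  exact: (measurableT_comp (measurable_kernel (hp_P X) _ mXA)
      (measurable_hunt t0)).
apply: eq_integral => w _; case: (X t w) => [y|] //=.
exact: hunt_cemetery.
Qed.

Hypothesis symX : symmetric_process m X.

(** Symmetry tested against the constant 1, together with P_t 1 <= 1. *)
Lemma semigroup_integral_le t g : (0 <= t)%R -> measurable_fun setT g ->
  (forall y, 0 <= g y) -> \int[m]_x semigroup X t g x <= \int[m]_x g x.
Proof.
move=> t0 mg g0.
have m1 : measurable_fun setT (cst 1 : borel E -> \bar R) by [].
have := @symX t g (cst 1) t0 mg m1 g0 (fun=> lee01).
under eq_integral do rewrite mule1.
move=> ->; apply: ge0_le_integral => //.
- by move=> x _; rewrite mule_ge0// semigroup_ge0.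
- by apply: emeasurable_funM => //; exact: measurable_semigroup.
- by move=> x _; rewrite -[leRHS]mule1 lee_wpmul2l// semigroup_cst1.
Qed.

End semigroup_nonneg.

Section almost_everywhere_monotone.
Context d (T : measurableType d) (R : realType).
Variable mu : {measure set T -> \bar R}.
Implicit Types A B C : T -> Prop.

Lemma ae_imp A C : {ae mu, forall x, A x} -> (forall x, A x -> C x) ->
  {ae mu, forall x, C x}.
Proof. by move=> aeA AC; apply: filterS aeA. Qed.

Lemma ae_and A B : {ae mu, forall x, A x} -> {ae mu, forall x, B x} ->
  {ae mu, forall x, A x /\ B x}.
Proof. by move=> aeA aeB; apply: filterS2 aeA aeB. Qed.

End almost_everywhere_monotone.

(** * L^p membership and the L^2 inner product *)

Section inner_product.
Context d (T : measurableType d) (R : realType).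
Variable mu : {measure set T -> \bar R}.
Implicit Types (f g : T -> R) (p : R).

Lemma Lfun_measurable (p : \bar R) f : f \in Lfun mu p -> measurable_fun setT f.
Proof. by rewrite inE => /andP[/[!inE]]. Qed.

Lemma measurable_norm_powR f p : measurable_fun setT f ->
  measurable_fun setT (fun x => `|f x| `^ p).
Proof.
move=> mf; apply: (@measurableT_comp _ _ _ _ _ _ (fun a : R => a `^ p)) => //.
exact: measurableT_comp.
Qed.

Lemma Lfun_le p f g : 0 < p -> measurable_fun setT g ->
  (forall x, `|g x| <= `|f x|) -> f \in Lfun mu p%:E -> g \in Lfun mu p%:E.
Proof.
move=> p0 mg gf /LfunP_powR -/(_ p0)[mf fp].
apply/(LfunP_powR _ _ p0); split; first exact: mg.
apply: le_lt_trans fp; apply: ge0_le_integral_nomeas => x _.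
  by rewrite lee_fin powR_ge0.
by rewrite lee_fin ge0_ler_powR ?nnegrE// ltW.
Qed.

Lemma LfunB p f g : 1 <= p -> f \in Lfun mu p%:E -> g \in Lfun mu p%:E ->
  (fun x => f x - g x) \in Lfun mu p%:E.
Proof.
move=> p1 fp gp; have p1' : (1 <= p%:E)%E by rewrite lee_fin.
have [_ cD] := @Lfun_addr_closed _ _ _ mu _ p1'.
have cN := @Lfun_oppr_closed _ _ _ mu p%:E.
by have := cD _ _ fp (cN _ gp).
Qed.

Lemma inner2_integrable f g : f \in Lfun mu 2%:E -> g \in Lfun mu 2%:E ->
  mu.-integrable setT (EFin \o (fun x => f x * g x)).
Proof. by move=> f2 g2; apply/Lfun1_integrable; exact: Lfun2_mul_Lfun1. Qed.

(** The integral [inner2], over an arbitrary measure space. *)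
Definition inner_prod f g : R := \int[mu]_x (f x * g x).

Lemma inner_prodC f g : inner_prod f g = inner_prod g f.
Proof. by apply: eq_Rintegral => x _; rewrite mulrC. Qed.

Lemma inner_prodBl f g h : f \in Lfun mu 2%:E -> g \in Lfun mu 2%:E ->
  h \in Lfun mu 2%:E ->
  inner_prod (fun x => f x - g x) h = inner_prod f h - inner_prod g h.
Proof.
move=> f2 g2 h2; rewrite /inner_prod -RintegralB//;
  try exact: inner2_integrable.
by apply: eq_Rintegral => x _; rewrite mulrBl.
Qed.

Lemma inner_prod_ge0 f : 0 <= inner_prod f f.
Proof. by apply: Rintegral_ge0 => x _; rewrite -expr2 sqr_ge0. Qed.

Lemma inner_prod_ae f g h : measurable_fun setT f -> measurable_fun setT g ->
  measurable_fun setT h -> f = g %[ae mu] -> inner_prod f h = inner_prod g h.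
Proof.
move=> mf mg mh fg; rewrite /inner_prod /Rintegral.
rewrite (ae_eq_integral (fun x => (g x * h x)%:E))//.
- by apply/measurable_EFinP; exact: measurable_funM.
- by apply/measurable_EFinP; exact: measurable_funM.
- by apply: (ae_imp fg) => x H _; rewrite H.
Qed.

Lemma inner_prodE f : f \in Lfun mu 2%:E ->
  (\int[mu]_x (f x ^+ 2)%:E)%E = (inner_prod f f)%:E.
Proof.
move=> f2; rewrite /inner_prod -ge0_integralE_Rintegral//.
exact: inner2_integrable.
Qed.

Lemma inner_prodBB f g : f \in Lfun mu 2%:E -> g \in Lfun mu 2%:E ->
  inner_prod (fun x => f x - g x) (fun x => f x - g x) =
  inner_prod f f - 2 * inner_prod f g + inner_prod g g.
Proof.
move=> f2 g2; have fg2 := LfunB (ler1n R 2) f2 g2.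
rewrite (inner_prodBl f2 g2 fg2) (inner_prodC f) (inner_prodC g).
by rewrite (inner_prodBl f2 g2 f2) (inner_prodBl f2 g2 g2) (inner_prodC g f);
  ring.
Qed.

End inner_product.

(** * The semigroup on L^p *)

Section semigroup_real.
Context {R : realType} {E : pmetricType R} {d : measure_display}
  {Omega : measurableType d}.
Variables (m : {measure set (borel E) -> \bar R}) (X : hunt_process E Omega)
  (B : nat -> set E).
Hypothesis HB : precompact_base B.
Hypothesis symX : symmetric_process m X.
Implicit Types (t s p : R) (f g : borel E -> R).
Local Notation Rs := (Rsemigroup X).

Lemma RsemigroupE t f x :
  Rs t f x = \int[start_law X (Some x)]_w (oapp f 0 (X t w)).
Proof. by congr fine; apply: eq_integral => w _; case: (X t w). Qed.

Lemma measurable_Rsemigroup2 f : measurable_fun setT f ->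
  measurable_fun setT (fun z : R * borel E => Rs (Num.max z.1 0) f z.2).
Proof.
move=> mf.
apply: (@measurableT_comp _ _ _ _ _ _ fine); first exact: fine_measurable.
pose fp z : \bar R := ((EFin \o f)^\+ (z : R * borel E).2)%E.
pose fn z : \bar R := ((EFin \o f)^\- (z : R * borel E).2)%E.
have mEf : measurable_fun setT (EFin \o f) by exact/measurable_EFinP.
have mfp : measurable_fun setT fp.
  by apply: (@measurableT_comp _ _ _ _ _ _ ((EFin \o f)^\+)%E) => //;
    exact: measurable_funepos.
have mfn : measurable_fun setT fn.
  by apply: (@measurableT_comp _ _ _ _ _ _ ((EFin \o f)^\-)%E) => //;
    exact: measurable_funeneg.
have := emeasurable_funB
  (@measurable_semigroup2 _ _ _ _ X B HB _ mfp (fun=> funepos_ge0 _ _))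
  (@measurable_semigroup2 _ _ _ _ X B HB _ mfn (fun=> funeneg_ge0 _ _)).
congr (measurable_fun _ _); apply/funext => -[t x] /=.
rewrite /semigroup [RHS]integralE.
congr (_ - _)%E; apply: eq_integral => w _.
- by rewrite [RHS]funeposE; case: (X _ w) => [y|] /=;
    rewrite ?/fp ?funeposE ?maxxx.
- rewrite [RHS]funenegE; case: (X _ w) => [y|] /=; rewrite ?/fn ?funenegE//.
  by rewrite oppr0 maxxx.
Qed.

Lemma measurable_Rsemigroup t f : 0 <= t -> measurable_fun setT f ->
  measurable_fun setT (Rs t f).
Proof.
move=> t0 /measurable_Rsemigroup2/(@measurable_fun_pair2 _ _ _ _ _ _ _ t) /=.
by rewrite (max_idPl t0).
Qed.

Lemma measurable_oapp_hunt_real t f : 0 <= t -> measurable_fun setT f ->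
  measurable_fun setT (fun w => oapp f 0 (X t w)).
Proof.
move=> t0 mf; apply/measurable_EFinP.
have := @measurable_oapp_hunt _ _ _ _ X t (EFin \o f) t0.
move=> /(_ _)/(_ _).
have mEf : measurable_fun setT (EFin \o f) by exact/measurable_EFinP.
move=> /(_ mEf); congr (measurable_fun _ _).
by apply/funext => w /=; case: (X t w).
Qed.

Lemma semigroup_norm_powR t f p x : 0 < p ->
  semigroup X t (fun y => (`|f y| `^ p)%:E) x =
  (\int[start_law X (Some x)]_w (`|oapp f 0 (X t w)| `^ p)%:E)%E.
Proof.
move=> p0; apply: eq_integral => w _; case: (X t w) => [y|] //=.
by rewrite normr0 powR0// gt_eqF.
Qed.

(** Extended by 0 at the cemetery, f is averaged under a probability, so Jensen's inequality holds
    despite killing. *)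
Lemma Rsemigroup_powR_le t f p x : 0 <= t -> 1 <= p -> measurable_fun setT f ->
  ((`|Rs t f x| `^ p)%:E <= semigroup X t (fun y => (`|f y| `^ p)%:E) x)%E.
Proof.
move=> t0 p1 mf; rewrite semigroup_norm_powR; last by lra.
rewrite RsemigroupE; apply: jensen_powR => //.
exact: measurable_oapp_hunt_real.
Qed.

Lemma semigroup_powR_integral_le t f p : 0 <= t -> measurable_fun setT f ->
  (\int[m]_x semigroup X t (fun y => (`|f y| `^ p)%:E) x <=
   \int[m]_x (`|f x| `^ p)%:E)%E.
Proof.
move=> t0 mf; apply: (semigroup_integral_le HB symX t0).
  by apply/measurable_EFinP; exact: measurable_norm_powR.
by move=> y; rewrite lee_fin powR_ge0.
Qed.

Lemma Rsemigroup_integral_le t f p : 0 <= t -> 1 <= p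
    -> measurable_fun setT f ->
  (\int[m]_x (`|Rs t f x| `^ p)%:E <= \int[m]_x (`|f x| `^ p)%:E)%E.
Proof.
move=> t0 p1 mf; apply: le_trans (semigroup_powR_integral_le _ t0 mf).
apply: ge0_le_integral_nomeas => x _; first by rewrite lee_fin powR_ge0.
exact: Rsemigroup_powR_le.
Qed.

Lemma Rsemigroup_Lfun t f p : 0 <= t -> 1 <= p -> f \in Lfun m p%:E ->
  Rs t f \in Lfun m p%:E.
Proof.
move=> t0 p1; have p0 : 0 < p by lra.
move=> /LfunP_powR -/(_ p0)[mf fp]; apply/(LfunP_powR _ _ p0); split.
  exact: measurable_Rsemigroup.
exact: le_lt_trans (Rsemigroup_integral_le t0 p1 mf) fp.
Qed.

Lemma semigroup_powR_ae_fin t f p : 0 <= t -> 0 < p -> f \in Lfun m p%:E ->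
  {ae m, forall x,
    (\int[start_law X (Some x)]_w (`|oapp f 0 (X t w)| `^ p)%:E < +oo)%E}.
Proof.
move=> t0 p0 /LfunP_powR -/(_ p0)[mf fp].
have mfp : measurable_fun setT (fun y => (`|f y| `^ p)%:E : \bar R).
  by apply/measurable_EFinP; exact: measurable_norm_powR.
have fp0 y : (0 <= (`|f y| `^ p)%:E :> \bar R)%E by rewrite lee_fin powR_ge0.
have int : m.-integrable setT (semigroup X t (fun y => (`|f y| `^ p)%:E)).
  apply/integrableP; split; first exact: (measurable_semigroup X HB t0 mfp fp0).
  under eq_integral do rewrite gee0_abs ?semigroup_ge0//.
  exact: le_lt_trans (semigroup_powR_integral_le _ t0 mf) fp.
apply: (ae_imp (integrable_ae measurableT int)) => x /(_ I).
by rewrite semigroup_norm_powR// ge0_fin_numE ?integral_ge0// => w _;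
  rewrite lee_fin powR_ge0.
Qed.

Lemma hunt_ae_integrable t f p : 0 <= t -> 1 <= p -> f \in Lfun m p%:E ->
  {ae m, forall x, (start_law X (Some x)).-integrable setT
    (EFin \o (fun w => oapp f 0 (X t w)))}.
Proof.
move=> t0 p1 fp; have p0 : 0 < p by lra.
apply: (ae_imp (semigroup_powR_ae_fin t0 p0 fp)) => x.
apply: probability_integrable_norm => //;
  apply: measurable_oapp_hunt_real => //.
exact: Lfun_measurable fp.
Qed.

Lemma RsemigroupB t f g p : 0 <= t -> 1 <= p -> f \in Lfun m p%:E ->
  g \in Lfun m p%:E ->
  Rs t (fun x => f x - g x) = (fun x => Rs t f x - Rs t g x) %[ae m].
Proof.
move=> t0 p1 fp gp; have aefg := ae_and
  (hunt_ae_integrable t0 p1 fp) (hunt_ae_integrable t0 p1 gp).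
apply: (ae_imp aefg) => x [intf intg] _.
rewrite !RsemigroupE -RintegralB//.
by apply: eq_Rintegral => w _; case: (X t w) => //=; rewrite subrr.
Qed.

(** The integral of P_t 1_N is at most m(N). This is what makes P_t well defined on m-classes. *)
Lemma semigroup_null t (N : set (borel E)) : 0 <= t -> measurable N ->
  m N = 0%E -> {ae m, forall x, {ae start_law X (Some x), forall w,
    ~ (Some @` N) (X t w)}}.
Proof.
move=> t0 mN N0.
have mI : measurable_fun setT (fun y => (\1_N y)%:E : \bar R).
  by apply/measurable_EFinP; exact: measurable_indic.
have I0 y : (0 <= (\1_N y)%:E :> \bar R)%E by rewrite lee_fin.
have : (\int[m]_x semigroup X t (fun y => (\1_N y)%:E) x = 0)%E.
  apply/eqP; rewrite eq_le integral_ge0 ?andbT; last first.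
    by move=> x _; exact: semigroup_ge0.
  rewrite (le_trans (semigroup_integral_le HB symX t0 mI I0))//.
  by rewrite integral_indic// setIT N0.
have mS := measurable_semigroup X HB t0 mI I0.
under eq_integral => x _ do rewrite -[semigroup _ _ _ _]gee0_abs
    ?semigroup_ge0//.
move/(@ae_eq_integral_abs _ _ _ m setT measurableT _ mS) => aeS.
apply: (ae_imp aeS) => x /(_ I) /= Sx.
have mO := @measurable_oapp_hunt _ _ _ _ X t _ t0 mI.
have : (\int[start_law X (Some x)]_w
    `|oapp (fun y => (\1_N y)%:E) 0 (X t w)| = 0)%E.
  rewrite -[RHS]Sx; apply: eq_integral => w _; rewrite gee0_abs//.
  by case: (X t w) => /=.
move/(@ae_eq_integral_abs _ _ _ _ setT measurableT _ mO) => aeO.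
apply: (ae_imp aeO) => w /(_ I) + [y Ny yE]; rewrite -yE /= indicE mem_set//.
by move=> /eqP; rewrite eqe oner_eq0.
Qed.

Lemma semigroup_ae t (f g : borel E -> \bar R) : 0 <= t ->
  measurable_fun setT f -> measurable_fun setT g -> f = g %[ae m] ->
  semigroup X t f = semigroup X t g %[ae m].
Proof.
move=> t0 mf mg [N [mN N0 fgN]].
apply: (ae_imp (semigroup_null t0 mN N0)) => x HN _.
apply: (@ae_eq_integral _ _ _ (start_law X (Some x))) => //.
- exact: measurable_oapp_hunt.
- exact: measurable_oapp_hunt.
apply: (ae_imp HN) => w HNw _; case XE : (X t w) => [y|] //=.
apply: contrapT => fgy; apply: HNw; rewrite XE; exists y => //.
by apply: fgN => /(_ I).
Qed.

Lemma Rsemigroup_ae t f g : 0 <= t ->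
  measurable_fun setT f -> measurable_fun setT g -> f = g %[ae m] ->
  Rs t f = Rs t g %[ae m].
Proof.
move=> t0 mf mg fg.
have H : semigroup X t (EFin \o f) = semigroup X t (EFin \o g) %[ae m].
  apply: semigroup_ae => //; [exact/measurable_EFinP|exact/measurable_EFinP|].
  by apply: (ae_imp fg) => x H _ /=; rewrite H.
by apply: (ae_imp H) => x Hx _; rewrite /Rsemigroup Hx.
Qed.

Lemma Rsemigroup_semigroup t f p : 0 <= t -> 1 <= p -> f \in Lfun m p%:E ->
  EFin \o Rs t f = semigroup X t (EFin \o f) %[ae m].
Proof.
move=> t0 p1 fp; apply: (ae_imp (hunt_ae_integrable t0 p1 fp)) => x intf _;
  rewrite /= /Rsemigroup fineK//.
rewrite (_ : semigroup _ _ _ _ =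
  \int[start_law X (Some x)]_w (oapp f 0 (X t w))%:E)%E.
  exact: integrable_fin_num.
by apply: eq_integral => w _; case: (X t w).
Qed.

Let Rsemigroup_add_ge0 t s f p : 0 <= t -> 0 <= s -> 1 <= p ->
  f \in Lfun m p%:E -> (forall x, 0 <= f x) ->
  Rs (t + s) f = Rs t (Rs s f) %[ae m].
Proof.
move=> t0 s0 p1 fp f0; have mf := Lfun_measurable fp.
have mEf : measurable_fun setT (EFin \o f) by exact/measurable_EFinP.
have Ef0 y : (0 <= (EFin \o f) y)%E by rewrite lee_fin.
have mRs := measurable_Rsemigroup s0 mf.
have mER : measurable_fun setT (EFin \o Rs s f) by exact/measurable_EFinP.
have aeE := semigroup_ae t0 mER (measurable_semigroup X HB s0 mEf Ef0)
  (Rsemigroup_semigroup s0 p1 fp).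
apply: (ae_imp aeE) => x H _; rewrite {1}/Rsemigroup semigroup_add//.
by rewrite -H.
Qed.

Lemma Lfun_max p f : 0 < p -> f \in Lfun m p%:E ->
  (fun x => Num.max (f x) 0) \in Lfun m p%:E /\
  (fun x => Num.max (- f x) 0) \in Lfun m p%:E.
Proof.
move=> p0 fp; have mf := Lfun_measurable fp; split; apply: (Lfun_le p0 _ _ fp).
- exact: measurable_maxr.
- by move=> x; rewrite ger0_norm ?le_max ?lexx ?orbT//
    ge_max normr_ge0 ler_norm.
- by apply: measurable_maxr => //; exact: measurable_funN.
- move=> x; rewrite ger0_norm ?le_max ?lexx ?orbT// ge_max normr_ge0.
  by rewrite -normrN ler_norm.
Qed.

Lemma subr_max0 (a : R) : a = Num.max a 0 - Num.max (- a) 0.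
Proof.
have [a0|a0] := leP 0 a.
  by rewrite (max_idPr _) ?subr0// oppr_le0.
by rewrite (max_idPl _) ?oppr_ge0 ?(ltW a0)// opprK add0r.
Qed.

(** For [0, +oo]-valued functions the semigroup law is pointwise. [Rsemigroup] discards infinite
    values through [fine], so the law is recovered almost everywhere, from positive and negative
    parts. *)
Lemma Rsemigroup_add t s f p : 0 <= t -> 0 <= s -> 1 <= p ->
  f \in Lfun m p%:E -> Rs (t + s) f = Rs t (Rs s f) %[ae m].
Proof.
move=> t0 s0 p1 fp; have p0 : 0 < p by lra.
have [f1p f2p] := Lfun_max p0 fp.
set f1 := (fun x => Num.max (f x) 0) in f1p.
set f2 := (fun x => Num.max (- f x) 0) in f2p.
have fE : f = (fun x => f1 x - f2 x) by apply/funext => x; exact: subr_max0.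
have f10 x : 0 <= f1 x by rewrite /f1 le_max lexx orbT.
have f20 x : 0 <= f2 x by rewrite /f2 le_max lexx orbT.
have ts0 : 0 <= t + s by rewrite addr_ge0.
have R1 := Rsemigroup_Lfun s0 p1 f1p; have R2 := Rsemigroup_Lfun s0 p1 f2p.
have H0 := RsemigroupB ts0 p1 f1p f2p.
have H1 := Rsemigroup_add_ge0 t0 s0 p1 f1p f10.
have H2 := Rsemigroup_add_ge0 t0 s0 p1 f2p f20.
have H3 := RsemigroupB t0 p1 R1 R2.
have H4 : Rs t (Rs s f) = Rs t (fun x => Rs s f1 x - Rs s f2 x) %[ae m].
  apply: Rsemigroup_ae => //.
  - exact: measurable_Rsemigroup (Lfun_measurable fp).
  - exact: Lfun_measurable (LfunB p1 R1 R2).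
  - apply: (ae_imp (RsemigroupB s0 p1 f1p f2p)) => x H xT.
    by rewrite [in LHS]fE H.
apply: (ae_imp (ae_and (ae_and (ae_and (ae_and H0 H1) H2) H3) H4)).
by move=> x [[[[h0 h1] h2] h3] h4] _; rewrite [in LHS]fE h0// h1// h2// h4// h3.
Qed.

Let inner_Rsemigroup_sym_ge0 t f g : 0 <= t -> f \in Lfun m 2%:E ->
  g \in Lfun m 2%:E -> (forall x, 0 <= f x) -> (forall x, 0 <= g x) ->
  inner_prod m (Rs t f) g = inner_prod m f (Rs t g).
Proof.
move=> t0 f2 g2 f0 g0.
have mf := Lfun_measurable f2; have mg := Lfun_measurable g2.
have mEf : measurable_fun setT (EFin \o f) by exact/measurable_EFinP.
have mEg : measurable_fun setT (EFin \o g) by exact/measurable_EFinP.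
have Ef0 y : (0 <= (EFin \o f) y)%E by rewrite lee_fin.
have Eg0 y : (0 <= (EFin \o g) y)%E by rewrite lee_fin.
congr fine.
transitivity (\int[m]_x (semigroup X t (EFin \o f) x * (g x)%:E))%E.
  apply: ae_eq_integral => //.
  - apply/measurable_EFinP; apply: measurable_funM => //.
    exact: measurable_Rsemigroup.
  - by apply: emeasurable_funM => //; exact: (measurable_semigroup X HB).
  - apply: (ae_imp (Rsemigroup_semigroup t0 (ler1n R 2) f2)).
    by move=> x /(_ I) /= <- _; rewrite EFinM.
rewrite (symX t0 mEf mEg Ef0 Eg0).
apply: ae_eq_integral => //.
- by apply: emeasurable_funM => //; exact: (measurable_semigroup X HB).
- apply/measurable_EFinP; apply: measurable_funM => //.
  exact: measurable_Rsemigroup.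
- apply: (ae_imp (Rsemigroup_semigroup t0 (ler1n R 2) g2)).
  by move=> x /(_ I) /= <- _; rewrite EFinM.
Qed.

Lemma inner_Rsemigroup_sym t f g : 0 <= t -> f \in Lfun m 2%:E ->
  g \in Lfun m 2%:E ->
  inner_prod m (Rs t f) g = inner_prod m f (Rs t g).
Proof.
move=> t0.
have aux f' g' : f' \in Lfun m 2%:E -> g' \in Lfun m 2%:E ->
    (forall x, 0 <= f' x) ->
    inner_prod m (Rs t f') g' = inner_prod m f' (Rs t g').
  move=> f2 g2 f0; have [g12 g22] := Lfun_max (ltr0Sn R 1) g2.
  set g1 := (fun x => Num.max (g' x) 0) in g12.
  set g2' := (fun x => Num.max (- g' x) 0) in g22.
  have gE : g' = (fun x => g1 x - g2' x) by apply/funext => x; exact: subr_max0.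
  have g10 x : 0 <= g1 x by rewrite /g1 le_max lexx orbT.
  have g20 x : 0 <= g2' x by rewrite /g2' le_max lexx orbT.
  have Rf2 := Rsemigroup_Lfun t0 (ler1n R 2) f2.
  have Rg1 := Rsemigroup_Lfun t0 (ler1n R 2) g12.
  have Rg2 := Rsemigroup_Lfun t0 (ler1n R 2) g22.
  have Rg := Rsemigroup_Lfun t0 (ler1n R 2) g2.
  rewrite {1}gE inner_prodC inner_prodBl// !(inner_prodC m _ (Rs t f')).
  rewrite !inner_Rsemigroup_sym_ge0//.
  rewrite [RHS]inner_prodC (@inner_prod_ae _ _ _ m (Rs t g')
      (fun x => Rs t g1 x - Rs t g2' x) f').
  - by rewrite inner_prodBl// !(inner_prodC m _ f').
  - exact: Lfun_measurable Rg.
  - exact: Lfun_measurable (LfunB (ler1n R 2) Rg1 Rg2).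
  - exact: Lfun_measurable f2.
  - apply: (ae_imp (RsemigroupB t0 (ler1n R 2) g12 g22)) => x H xT.
    by rewrite [in LHS]gE H.
move=> f2 g2; have [f12 f22] := Lfun_max (ltr0Sn R 1) f2.
set f1 := (fun x => Num.max (f x) 0) in f12.
set f2' := (fun x => Num.max (- f x) 0) in f22.
have fE : f = (fun x => f1 x - f2' x) by apply/funext => x; exact: subr_max0.
have f10 x : 0 <= f1 x by rewrite /f1 le_max lexx orbT.
have f20 x : 0 <= f2' x by rewrite /f2' le_max lexx orbT.
have Rf1 := Rsemigroup_Lfun t0 (ler1n R 2) f12.
have Rf2 := Rsemigroup_Lfun t0 (ler1n R 2) f22.
have Rf := Rsemigroup_Lfun t0 (ler1n R 2) f2.
have Rg := Rsemigroup_Lfun t0 (ler1n R 2) g2.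
rewrite (@inner_prod_ae _ _ _ m (Rs t f) (fun x => Rs t f1 x - Rs t f2' x) g).
- rewrite inner_prodBl// !aux//.
  by rewrite [in RHS]fE inner_prodBl.
- exact: Lfun_measurable Rf.
- exact: Lfun_measurable (LfunB (ler1n R 2) Rf1 Rf2).
- exact: Lfun_measurable g2.
- apply: (ae_imp (RsemigroupB t0 (ler1n R 2) f12 f22)) => x H xT.
  by rewrite [in LHS]fE H.
Qed.

End semigroup_real.

(** * Limits of quotients at time zero *)

Section ratio_limit.
Context {R : realType}.

(** The limit is the supremum of k(s)/s. The second hypothesis reads k(s0)/(s0 + s) <= k(s)/s: fix
    s0 nearly attaining the supremum, then take s small compared with s0. *)
Lemma cvg_at_right_ratio (k : R -> R) (M : R) :
  (forall s, 0 < s -> 0 <= k s) ->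
  (forall s s0, 0 < s -> 0 < s0 -> k s0 * s <= (s0 + s) * k s) ->
  (forall s, 0 < s -> k s <= M * s) ->
  exists l : R, s^-1 * k s @[s --> 0^'+] --> l.
Proof.
move=> kge0 krat kM.
pose A := [set s^-1 * k s | s in [set s | 0 < s]].
have A0 : A !=set0 by exists (1^-1 * k 1); exists 1 => //=.
have hA : has_sup A.
  split => //; exists M => _ [s /= s0 <-].
  by rewrite mulrC ler_pdivrMr// kM.
exists (sup A); apply/cvgrPdist_le => e e0.
have e20 : 0 < e / 2 by rewrite divr_gt0.
have [_ [s0 /= s00 <-] As0] := sup_adherent e20 hA.
have k0 := kge0 _ s00.
(* For s below this, k(s0)/(s0 + s) is within e/2 of k(s0)/s0; the summand 1 covers the case k(s0) =
   0. *)
pose dl := e / 2 * s0 ^+ 2 / (k s0 + 1).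
have dl0 : 0 < dl by rewrite /dl divr_gt0 ?mulr_gt0 ?exprn_gt0//; lra.
near=> s.
have s_gt0 : 0 < s by near: s; exact: nbhs_right_gt.
have sdl : s < dl by near: s; exact: nbhs_right_lt.
rewrite ger0_norm; last by rewrite subr_ge0 sup_upper_bound//; exists s.
rewrite lerBlDr -lerBlDl (@le_trans _ _ (s0^-1 * k s0 - e / 2))//.
  rewrite lerBrDl; have : sup A - e / 2 <= s0^-1 * k s0 by rewrite ltW.
  rewrite (splitr e); lra.
have rat := krat _ _ s_gt0 s00.
apply: (@le_trans _ _ (k s0 / (s0 + s))); last first.
  by rewrite ler_pdivrMr ?addr_gt0// -mulrA (mulrC (k s))
    [leRHS]mulrC ler_pdivlMr.
rewrite ler_pdivlMr ?addr_gt0//.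
have : s * (k s0 + 1) <= e / 2 * s0 ^+ 2.
  by rewrite -ler_pdivlMr ?ltW//; lra.
move=> H.
have {}H : s * k s0 / s0 <= e / 2 * s0.
  rewrite ler_pdivrMr// -[_ * s0 * s0]mulrA -expr2; apply: le_trans H.
  by rewrite ler_wpM2l ?lerDl// ltW.
rewrite mulrDr mulrBl -(mulrA s0^-1) (mulrC (k s0) s0) mulKf ?gt_eqF//.
rewrite (mulrBl s) [s0^-1 * _ * s](_ : _ = s * k s0 / s0); last by ring.
have : 0 <= e / 2 * s by rewrite mulr_ge0 ?ltW.
lra.
Unshelve. all: by end_near. Qed.

End ratio_limit.

(** * The approximating forms of the semigroup and the domain *)

Section semigroup_form.
Context {R : realType} {E : pmetricType R} {d : measure_display}
  {Omega : measurableType d}.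
Variables (m : {measure set (borel E) -> \bar R}) (X : hunt_process E Omega)
  (B : nat -> set E).
Hypothesis HB : precompact_base B.
Hypothesis symX : symmetric_process m X.
Implicit Types (t s a b : R) (w z : borel E -> R).
Local Notation Rs := (Rsemigroup X).
Local Notation L2 := (Lfun m 2%:E).
Local Notation "<< u , v >>" := (inner_prod m u v).

(* This is [s] times the approximating form at time [s]. *)
Definition semigroup_defect w s := << fun x => w x - Rs s w x, w >>.
Local Notation k := semigroup_defect.

Let le12 : 1 <= 2 :> R.
Proof. by rewrite ler1n. Qed.

Let Rs2 t w : 0 <= t -> w \in L2 -> Rs t w \in L2.
Proof. by move=> t0; apply: (Rsemigroup_Lfun HB) => //; exact: le12. Qed.

#[local] Opaque inner_prod Rsemigroup.

Let inner_Rs_add a b w : 0 <= a -> 0 <= b -> w \in L2 ->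
  << Rs (a + b) w, w >> = << Rs a w, Rs b w >>.
Proof.
move=> a0 b0 w2; have Ra := Rs2 a0 w2; have Rb := Rs2 b0 w2.
rewrite addrC -(inner_Rsemigroup_sym HB symX b0 Ra w2).
apply: inner_prod_ae.
- by apply: Lfun_measurable (Rs2 _ w2); rewrite addr_ge0.
- exact: Lfun_measurable (Rs2 b0 Ra).
- exact: Lfun_measurable w2.
- exact: (Rsemigroup_add HB symX b0 a0 le12 w2).
Qed.

Let inner_Rs_le t w : 0 <= t -> w \in L2 -> << Rs t w, Rs t w >> <= << w, w >>.
Proof.
move=> t0 w2; rewrite -lee_fin -!inner_prodE//; last exact: Rs2.
have := Rsemigroup_integral_le HB symX t0 le12 (Lfun_measurable w2).
have E2 (f : borel E -> R) :
    (\int[m]_x (`|f x| `^ 2)%:E = \int[m]_x (f x ^+ 2)%:E)%E.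
  by apply: eq_integral => x _; rewrite normr_powR2.
by rewrite !E2.
Qed.

Lemma semigroup_defectE w s : 0 <= s -> w \in L2 ->
  k w s = << w, w >> - << Rs s w, w >>.
Proof. by move=> s0 w2; rewrite /k inner_prodBl//; exact: Rs2. Qed.

(** Origin of the doubled time in the decay estimate: the squared norm lost over a step s is the
    defect at time 2s. *)
Lemma semigroup_defect_half w s : 0 <= s -> w \in L2 ->
  k w (s + s) = << w, w >> - << Rs s w, Rs s w >>.
Proof.
by move=> s0 w2; rewrite semigroup_defectE ?addr_ge0// inner_Rs_add.
Qed.

Lemma semigroup_defect_ge0 w s : 0 <= s -> w \in L2 -> 0 <= k w s.
Proof.
move=> s0 w2; rewrite (splitr s) semigroup_defect_half ?divr_ge0// subr_ge0.
by apply: inner_Rs_le => //; rewrite divr_ge0.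
Qed.

Let inner_sqr_ae (f g : borel E -> R) : f \in L2 -> g \in L2 ->
  f = g %[ae m] -> << f, f >> = << g, g >>.
Proof.
move=> /Lfun_measurable mf /Lfun_measurable mg fg.
rewrite (inner_prod_ae mf mg mf fg) inner_prodC.
by rewrite (inner_prod_ae mf mg mg fg).
Qed.

Let inner_Rs_ge0 w s : 0 <= s -> w \in L2 -> 0 <= << Rs s w, w >>.
Proof.
move=> s0 w2; rewrite (splitr s) inner_Rs_add ?divr_ge0//.
exact: inner_prod_ge0.
Qed.

Lemma semigroup_defect_mono w a b : 0 <= a -> a <= b -> w \in L2 ->
  k w a <= k w b.
Proof.
move=> a0 ab w2; have b0 := le_trans a0 ab.
have a20 : 0 <= a / 2 by rewrite divr_ge0.
have ba0 : 0 <= (b - a) / 2 by rewrite divr_ge0// subr_ge0.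
rewrite !semigroup_defectE// lerD2l lerN2.
rewrite (splitr b) (splitr a) !inner_Rs_add ?divr_ge0//.
apply: le_trans (inner_Rs_le ba0 (Rs2 a20 w2)).
rewrite le_eqVlt; apply/orP; left; apply/eqP.
have bE : b / 2 = (b - a) / 2 + a / 2 by rewrite -mulrDl subrK.
have Rb2 : Rs (b / 2) w \in L2 by apply: Rs2 => //; rewrite divr_ge0.
have RR := Rs2 ba0 (Rs2 a20 w2).
move: Rb2; rewrite bE => Rb2.
apply: inner_sqr_ae Rb2 RR _.
exact: (Rsemigroup_add HB symX ba0 a20 le12 w2).
Qed.

(** The second difference of t -> <P_t w, w> with step b is the squared norm of P_(a/2) w -
    P_(a/2+b) w. *)
Let inner_Rs_convex w a b : 0 <= a -> 0 <= b -> w \in L2 ->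
  << Rs (a + b) w, w >> - << Rs (a + b + b) w, w >> <=
  << Rs a w, w >> - << Rs (a + b) w, w >>.
Proof.
move=> a0 b0 w2; have a20 : 0 <= a / 2 by rewrite divr_ge0.
have ab0 : 0 <= a / 2 + b by rewrite addr_ge0.
have := @inner_prod_ge0 _ _ _ m (fun x => Rs (a / 2) w x - Rs (a / 2 + b) w x).
rewrite inner_prodBB; [|exact: Rs2|exact: Rs2].
rewrite -!inner_Rs_add// -splitr.
rewrite (_ : a / 2 + (a / 2 + b) = a + b); last by rewrite addrA -splitr.
rewrite (_ : a / 2 + b + (a / 2 + b) = a + b + b);
  last by rewrite addrACA -splitr addrA.
move: << Rs a w, w >> << Rs (a + b) w, w >> << Rs (a + b + b) w, w >> => *; lra.
Qed.

Lemma semigroup_defect_double w s : 0 <= s -> w \in L2 ->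
  << fun x => w x - Rs s w x, fun x => w x - Rs s w x >> =
  2 * k w s - k w (s + s).
Proof.
move=> s0 w2; rewrite inner_prodBB//; last exact: Rs2.
rewrite semigroup_defect_half// semigroup_defectE// (inner_prodC m w (Rs s w)).
move: << w, w >> << Rs s w, w >> << Rs s w, Rs s w >> => *; ring.
Qed.

Let natSM n (s : R) : n.+1%:R * s = n%:R * s + s.
Proof. by rewrite -natr1 mulrDl mul1r. Qed.

(** By convexity, the decrements of <P_t w, w> over successive steps of length s never exceed the
    first one, [k w s]. *)
Lemma semigroup_defect_natmul w s n : 0 <= s -> w \in L2 ->
  k w (n.+1%:R * s) <= n.+1%:R * k w s.
Proof.
move=> s0 w2.
have step j : << Rs (j.+1%:R * s) w, w >> - << Rs (j.+2%:R * s) w, w >>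
    <= k w s.
  elim: j => [|j ih].
    have := @inner_prod_ge0 _ _ _ m (fun x => w x - Rs s w x).
    rewrite semigroup_defect_double// mul1r (_ : 2%:R * s = s + s);
      last by ring.
    rewrite (semigroup_defectE s0 w2) (semigroup_defectE (addr_ge0 s0 s0) w2).
    move: << w, w >> << Rs s w, w >> << Rs (s + s) w, w >> => *; lra.
  apply: le_trans ih.
  have js0 : 0 <= j.+1%:R * s by rewrite mulr_ge0.
  have := inner_Rs_convex js0 s0 w2.
  by rewrite -!natSM.
elim: n => [|n ih]; first by rewrite !mul1r.
have ns0 i : 0 <= i.+1%:R * s by rewrite mulr_ge0.
have := step n; move: ih.
rewrite (semigroup_defectE (ns0 n) w2) (semigroup_defectE (ns0 n.+1) w2).
move: (k w s) << w, w >> => ks ww; move: << Rs _ w, w >> << Rs _ w, w >> => x y.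
by rewrite (natSM n.+1); lra.
Qed.

(** Round s0 up to a multiple of s: s0 < (n+1)s <= s0 + s. *)
Lemma semigroup_defect_ratio w s s0 : 0 < s -> 0 <= s0 -> w \in L2 ->
  k w s0 * s <= (s0 + s) * k w s.
Proof.
move=> s_gt0 s00 w2; pose n := Num.truncn (s0 / s).
have /andP[n1 n2] : n%:R <= s0 / s < n.+1%:R.
  by apply: truncn_itv; rewrite divr_ge0// ltW.
have ks := semigroup_defect_ge0 (ltW s_gt0) w2.
apply: (@le_trans _ _ (n.+1%:R * k w s * s)).
  apply: (ler_wpM2r (ltW s_gt0)).
  apply: (le_trans _ (semigroup_defect_natmul n (ltW s_gt0) w2)).
  by apply: semigroup_defect_mono => //; rewrite -ler_pdivrMr// ltW.
rewrite mulrAC ler_wpM2r//.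
by rewrite -natr1 mulrDl mul1r lerD2r -ler_pdivlMr.
Qed.

Lemma semigroup_defect_cvg w (M : R) : w \in L2 ->
  (forall s, 0 < s -> k w s <= M * s) ->
  exists l : R, s^-1 * k w s @[s --> 0^'+] --> l.
Proof.
move=> w2; apply: cvg_at_right_ratio => [s s0|s s0 s_gt0 s0_gt0].
  exact: semigroup_defect_ge0 (ltW s0) w2.
exact: semigroup_defect_ratio s_gt0 (ltW s0_gt0) w2.
Qed.

(** For t = s/(n+1), subadditivity gives k(s)/s <= k(t)/t, and the latter quotients tend to l. *)
Lemma semigroup_defect_le_lim w (l s : R) : w \in L2 -> 0 < s ->
  t^-1 * k w t @[t --> 0^'+] --> l -> k w s <= s * l.
Proof.
move=> w2 s0 cl; rewrite mulrC -ler_pdivrMr//; apply/ler_addgt0Pl => e e0.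
move/cvgrPdist_lt: cl => /(_ e e0)[dl /= dl0 H].
have dls : 0 < dl / s by rewrite divr_gt0.
have [n _ /(_ n (leqnn n)) /= nd] := near_infty_natSinv_lt (PosNum dls).
pose t := n.+1%:R^-1 * s.
have t0 : 0 < t by rewrite mulr_gt0// invr_gt0.
have tdl : t < dl by rewrite -ltr_pdivlMr.
have := H t; rewrite /= sub0r normrN gtr0_norm// => /(_ tdl t0).
rewrite ltr_distlC => /andP[_ Ht].
rewrite addrC; apply: le_trans (ltW Ht).
have := semigroup_defect_natmul n (ltW t0) w2.
rewrite {1}/t mulrA divff ?pnatr_eq0// mul1r => kn.
rewrite ler_pdivrMr// mulrC (le_trans kn)// mulrA ler_wpM2r//.
  exact: semigroup_defect_ge0 (ltW t0) w2.
by rewrite /t invfM invrK mulrCA divff ?gt_eqF// mulr1.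
Qed.

Variables (D : set (borel E -> R))
  (F : (borel E -> R) -> (borel E -> R) -> R).
Hypotheses (dirF : dirichlet_form m D F) (assF : associated m X D F).

Lemma domain_of_defect_bound w (M : R) : w \in L2 ->
  (forall s, 0 < s -> k w s <= M * s) -> D w.
Proof.
move=> w2 kM; apply/assF.1; split => //.
#[local] Transparent inner_prod Rsemigroup.
exact: (semigroup_defect_cvg w2 kM).
Qed.

Lemma semigroup_defect_le_form w s : D w -> 0 < s -> k w s <= s * F w w.
Proof.
move=> Dw s0; apply: semigroup_defect_le_lim => //.
  exact: (df_L2 dirF).
exact: (assF.2 w w Dw Dw).
Qed.

#[local] Opaque inner_prod Rsemigroup.

Lemma dirichlet_dense w (e : R) : w \in L2 -> 0 < e -> exists2 z, D z &
  inner_prod m (fun x => w x - z x) (fun x => w x - z x) <= e.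
Proof.
move=> w2 e0; have se0 : 0 < Num.sqrt e by rewrite sqrtr_gt0.
have [z Dz wz] := df_dense dirF w2 se0; exists z => //.
have z2 := df_L2 dirF Dz; have wz2 := LfunB le12 w2 z2.
rewrite -lee_fin -inner_prodE//.
have two0 : (2 : R) != 0 by rewrite pnatr_eq0.
have := powR_Lnorm m (EFin \o (w \- z)) two0.
rewrite (_ : (\int[m]_x _)%E = (\int[m]_x ((w x - z x) ^+ 2)%:E)%E); last first.
  by apply: eq_integral => x _ /=; rewrite normr_powR2.
move=> <-.
have -> : e%:E = ((Num.sqrt e)%:E `^ 2)%E.
  by rewrite poweR_EFin powR_mulrn ?sqrtr_ge0// sqr_sqrtr// ltW.
apply: gt0_ler_poweR => //; last exact: ltW.
- by rewrite in_itv/= leey Lnorm_ge0.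
- by rewrite in_itv/= leey lee_fin sqrtr_ge0.
Qed.

(** Write w = r + z with z in the domain. Expanding the quadratic form and using <P_s r, r> >= 0 and
    ||z - P_s z||^2 <= 2 k z s gives k w s <= 2 ||r||^2 + 3 k z s. Density makes the first term
    small, and k z s <= s F z z the second. *)
Lemma semigroup_defect_small w (e : R) : w \in L2 -> 0 < e ->
  exists2 s, 0 < s & k w s <= e.
Proof.
move=> w2 e0; have e40 : 0 < e / 4 by rewrite divr_gt0.
have [z Dz rz] := dirichlet_dense w2 e40.
have z2 := df_L2 dirF Dz.
set r := (fun x => w x - z x) in rz.
have r2 : r \in L2 by exact: LfunB le12 w2 z2.
have F0 := df_ge0 dirF Dz.
(* Then k z s <= e/6, and three times this is e/2. *)
pose s := e / (6 * (F z z + 1)).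
have s0 : 0 < s by rewrite divr_gt0// mulr_gt0//; lra.
exists s => //; have s00 := ltW s0.
have kz : 3 * k z s <= e / 2.
  have := semigroup_defect_le_form Dz s0; rewrite /s.
  have : e / (6 * (F z z + 1)) * F z z <= e / 6.
    rewrite -mulrA ler_wpM2l ?(ltW e0)// invfM -mulrA ler_piMr// mulrC.
    by rewrite ler_pdivrMr; lra.
  lra.
have v2 : (fun x => z x - Rs s z x) \in L2 by exact: LfunB le12 z2 (Rs2 s00 z2).
have kr := inner_Rs_ge0 s00 r2.
have vv := semigroup_defect_double s00 z2.
have kzz := semigroup_defect_ge0 (addr_ge0 s00 s00) z2.
have rv := @inner_prod_ge0 _ _ _ m (fun x => r x - (z x - Rs s z x)).
rewrite inner_prodBB// in rv.
have krE : << Rs s r, r >> =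
    << Rs s w, w >> - 2 * << Rs s z, w >> + << Rs s z, z >>.
  have Rw2 := Rs2 s00 w2; have Rz2 := Rs2 s00 z2.
  have RR2 := LfunB le12 Rw2 Rz2.
  rewrite (inner_prod_ae (Lfun_measurable (Rs2 s00 r2)) (Lfun_measurable RR2)
    (Lfun_measurable r2) (RsemigroupB HB symX s00 le12 w2 z2)).
  rewrite inner_prodBl// !(inner_prodC m _ r) !inner_prodBl//.
  rewrite !(inner_prodC m _ (Rs s w)) !(inner_prodC m _ (Rs s z)).
  rewrite (inner_Rsemigroup_sym HB symX s00 w2 z2) (inner_prodC m w); ring.
have rrE : << r, r >> = << w, w >> - 2 * << w, z >> + << z, z >>.
  by rewrite inner_prodBB.
have rvE : << r, fun x => z x - Rs s z x >> =
    << w, z >> - << Rs s z, w >> - << z, z >> + << Rs s z, z >>.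
  rewrite (inner_prodC m r) inner_prodBl//; last exact: Rs2.
  rewrite !(inner_prodC m _ r) !inner_prodBl//; try exact: Rs2.
  by rewrite (inner_prodC m w (Rs s z)) (inner_prodC m z (Rs s z)); ring.
rewrite rvE vv in rv; rewrite krE in kr; rewrite rrE in rz rv.
move: kz rv kzz kr rz.
rewrite (semigroup_defectE s00 w2) (semigroup_defectE s00 z2).
clear -e0; move: (k z (s + s)) << w, w >> << w, z >> << z, z >>.
move: << Rs s w, w >> << Rs s z, w >> << Rs s z, z >> => *; lra.
Qed.

End semigroup_form.

(** * Measures restricted to a set *)

Section restricted_measure.
Context d (T : measurableType d) (R : realType).
Variables (mu : {measure set T -> \bar R}) (D : set T) (mD : measurable D).
Local Open Scope ereal_scope.

Lemma ge0_integral_mrestr (f : T -> \bar R) : measurable_fun setT f ->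
  (forall x, 0 <= f x) -> \int[mrestr mu mD]_x f x = \int[mu]_(x in D) f x.
Proof.
move=> mf f0; rewrite -(setUv D) ge0_integral_setU//; last 3 first.
- exact: measurableC.
- by rewrite setUv.
- by rewrite disj_set2E setICr eqxx.
rewrite [X in _ + X](_ : _ = 0) ?adde0; last first.
  rewrite (eq_measure_integral mzero); first exact: integral_measure_zero.
  move=> A mA AD; have AD0 : A `&` D = set0 by rewrite disjoints_subset.
  by transitivity (mu (A `&` D)) => //; rewrite AD0 measure0.
apply: eq_measure_integral => A mA AD.
by transitivity (mu (A `&` D)) => //; congr (mu _); exact/setIidPl.
Qed.

End restricted_measure.

(** * Compactly supported bumps around a point *)

Section metric_bumps.
Context {R : realType} {E : pmetricType R}.
Variable B : nat -> set E.
Hypothesis HB : precompact_base B.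

Definition bump (x : E) (r : R) (z : E) : R := Num.max (r - mdist x z) 0.

Lemma continuous_mdist (x : E) : continuous (mdist x : E -> R).
Proof.
move=> z; apply/cvgrPdist_lt => e e0; near=> y.
have : ball z e y by near: y; exact: nbhsx_ballx.
rewrite ballEmdist /= => zy; apply: le_lt_trans zy.
have xy := metric_triangle x z y; have xz := metric_triangle x y z.
rewrite (metric_sym y z) in xz.
by rewrite ler_norml; apply/andP; split; lra.
Unshelve. all: by end_near. Qed.

Lemma continuous_bump (x : E) (r : R) : continuous (bump x r).
Proof.
move=> z; apply: (@continuous_max _ _ (fun z => r - mdist x z) (fun=> 0)).
  apply: cvgB; first exact: cvg_cst.
  exact: continuous_mdist.
exact: cvg_cst.
Qed.

Lemma bump_Cc (x : E) : exists2 r0 : R, 0 < r0 &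
  forall r, r <= r0 -> Cc (bump x r).
Proof.
have [oB cB bB] := HB.
have [n [Bx _]] := bB setT x openT I.
have : nbhs x (B n) by exact: open_nbhs_nbhs.
rewrite nbhs_ballP => -[r0 /= r00 rB]; exists r0 => // r rr0; split.
  exact: continuous_bump.
apply: (subclosed_compact _ (cB n)); first exact: closed_closure.
apply: closureS => z /= bz; apply: rB; rewrite ballEmdist /=.
apply: lt_le_trans rr0; rewrite ltNge; apply/negP => rz; move: bz.
by rewrite /bump (max_idPr _) ?eqxx// subr_le0.
Qed.

End metric_bumps.

(** * The jump measure away from the diagonal *)

Section jump_measure.
Context {R : realType} {E : pmetricType R}.
Variable (m : {measure set (borel E) -> \bar R}) (B : nat -> set E).
Hypothesis HB : precompact_base B.
Variables (D : set (borel E -> R)) (F : (borel E -> R) -> (borel E -> R) -> R).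
Hypotheses (dirF : dirichlet_form m D F) (regF : regular_form m D F).
Variables (J : {measure set (borel E * borel E) -> \bar R})
  (Jk : R.-ker (borel E) ~> (borel E)).
Hypotheses (symJ : jump_symmetric J) (kerJ : jump_kernel m J Jk)
  (pureJ : pure_jump m D F J).
Local Open Scope ereal_scope.
Local Notation off := (@offdiag R E).

Lemma form0 : F (fun=> 0%R) (fun=> 0%R) = 0%R.
Proof.
have D0 := df_zero dirF.
have := df_linear dirF 1%R D0 D0 D0.
rewrite (_ : (fun x => _) = (fun=> 0%R)); last first.
  by apply/funext => x; rewrite mul1r addr0.
by rewrite mul1r => /eqP;
  rewrite -[X in X == _]addr0 (inj_eq (addrI _)) => /eqP <-.
Qed.

(** The empty exceptional set has capacity 0, the zero function being admissible for it. *)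
Lemma continuous_quasi_continuous (v : E -> R) : continuous v ->
  quasi_continuous m D F v.
Proof.
move=> cv e e0; exists set0; split; first exact: open0.
  apply: (@le_lt_trans _ _ 0); last by rewrite lte_fin.
  apply: ereal_inf_lbound; exists (fun=> 0%R).
    by split; [exact: (df_zero dirF)|exact/aeW].
  rewrite /form1 form0 /inner2 add0r.
  by under eq_Rintegral do rewrite mulr0; rewrite /Rintegral integral0.
by rewrite setC0; exact: continuous_subspaceT.
Qed.

Definition jump_square (v : borel E -> R) (z : borel E * borel E) : \bar R :=
  ((v z.2 - v z.1) ^+ 2)%:E.

Lemma measurable_jump_square v : measurable_fun setT v ->
  measurable_fun setT (jump_square v).
Proof.
move=> mv; apply/measurable_EFinP; apply: measurable_funX.
by apply: measurable_funB; exact: measurableT_comp.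
Qed.

Lemma jump_square_ge0 v z : 0 <= jump_square v z.
Proof. by rewrite lee_fin sqr_ge0. Qed.

Lemma form_continuousE v : D v -> continuous (v : E -> R) ->
  \int[J]_(z in off) jump_square v z = 2%:E * (F v v)%:E.
Proof.
move=> Dv cv; have qv := continuous_quasi_continuous cv.
rewrite (pureJ Dv Dv qv qv) muleA -EFinM mulfV ?pnatr_eq0// mul1e.
by apply: eq_integral => z _; rewrite /jump_square expr2.
Qed.

Let mB n : measurable (B n : set (borel E)).
Proof.
by have [oB _ _] := HB; apply: (@open_measurable_borel E); exact: oB.
Qed.

Lemma disjoint_sub_offdiag (U V : set (borel E)) : U `&` V = set0 ->
  U `*` V `<=` off.
Proof.
move=> UV [x y] [/= Ux Vy]; apply/eqP => xy.
by have : (U `&` V) x; [split => //; move: xy => /= ->|rewrite UV].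
Qed.

(** Finiteness of J away from the diagonal is extracted from the form. A domain function v uniformly
    close to a bump at x takes values at least r/4 apart near x and near y, and Chebyshev's
    inequality bounds J there through 2 F v v. *)
Lemma jump_finite_cover x y : x != y -> exists i j,
  [/\ B i x, B j y, B i `&` B j = set0 & J (B i `*` B j) < +oo].
Proof.
move=> xy; have [oB cB bB] := HB.
have [r0 r00 Cr] := bump_Cc HB x.
pose r := Num.min r0 (mdist x y).
have r_gt0 : (0 < r)%R by rewrite lt_min r00 mdist_gt0.
have Cb : Cc (bump x r) by apply: Cr; rewrite ge_min lexx.
have r40 : (0 < r / 4)%R by rewrite divr_gt0.
have [v [Dv [cv _] bv]] := reg_unif regF Cb r40.
have bx : bump x r x = r by rewrite /bump mdistxx subr0 (max_idPl _)// ltW.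
have by0 : bump x r y = 0%R.
  by rewrite /bump (max_idPr _)// subr_le0 ge_min lexx orbT.
(* The bump is r at x and 0 at y, so v is above 3r/4 at x and below r/4 at y; the two thresholds
   leave a gap r/4. *)
pose U := v @^-1` [set a | 5 / 8 * r < a]%R.
pose V := v @^-1` [set a | a < 3 / 8 * r]%R.
have oU : open U by move/continuousP: cv; apply; exact: open_gt.
have oV : open V by move/continuousP: cv; apply; exact: open_lt.
have Ux : U x.
  rewrite /U /=; have := bv x; rewrite bx ltr_distl => /andP[_]; lra.
have Vy : V y.
  rewrite /V /=; have := bv y; rewrite by0 ltr_distlC => /andP[_]; lra.
have [i [Bix BU]] := bB U x oU Ux; have [j [Bjy BV]] := bB V y oV Vy.
have {}BU : B i `<=` U by move=> z Bz; apply: BU; exact: subset_closure.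
have {}BV : B j `<=` V by move=> z Bz; apply: BV; exact: subset_closure.
have BB : B i `&` B j = set0.
  rewrite -subset0 => z [/BU /= + /BV /=]; rewrite /U /V /=; lra.
exists i, j; split => //.
have mBB : measurable (B i `*` B j : set (borel E * borel E)) by
    exact: measurableX.
have : ((r / 4) ^+ 2)%:E * J (B i `*` B j) <= 2%:E * (F v v)%:E.
  rewrite -(form_continuousE Dv cv) -integral_cst// integral_mkcond.
  rewrite [leRHS]integral_mkcond; apply: ge0_le_integral_nomeas => z _.
    by rewrite /patch; case: ifPn => // _; rewrite lee_fin sqr_ge0.
  rewrite /patch; case: ifPn => [/set_mem Bz|_]; last first.
    by case: ifPn => // _; exact: jump_square_ge0.
  rewrite mem_set; last exact: (disjoint_sub_offdiag BB).
  case: Bz => /BU Uz /BV Vz; rewrite lee_fin -[leRHS]sqrrN opprB.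
  rewrite lerXn2r ?nnegrE//; first exact: ltW.
    by move: Uz Vz; rewrite /U /V /=; lra.
  by move: Uz Vz; rewrite /U /V /=; lra.
have : 2%:E * (F v v)%:E < +oo by rewrite -EFinM ltry.
move=> /[swap] /le_lt_trans /[apply].
rewrite !ltey; apply: contra => /eqP ->.
by rewrite gt0_muley// lte_fin exprn_gt0.
Qed.

Lemma measurable_offdiag : measurable off.
Proof.
rewrite (_ : off = \bigcup_i \bigcup_j
    (if `[< B i `&` B j = set0 >] then B i `*` B j else set0)).
  apply: bigcupT_measurable => i; apply: bigcupT_measurable => j.
  by case: asboolP => // _; exact: measurableX.
apply/seteqP; split => [[x y] /= xy|z [i _ [j _]]].
  have [i [j [Bx By BB _]]] := jump_finite_cover xy.
  by exists i => //; exists j => //; rewrite asboolT.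
by case: asboolP => // BB; exact: disjoint_sub_offdiag.
Qed.

Lemma jump_swap (h : borel E * borel E -> \bar R) : measurable_fun setT h ->
  (forall z, 0 <= h z) ->
  \int[J]_(z in off) h (z.2, z.1) = \int[J]_(z in off) h z.
Proof.
move=> mh h0; have moff := measurable_offdiag.
pose sw (z : borel E * borel E) := (z.2, z.1).
have msw : measurable_fun setT sw by apply: measurable_fun_pair.
rewrite [RHS](eq_measure_integral (pushforward J sw)); last first.
  by move=> A mA Aoff; rewrite -(symJ mA Aoff).
rewrite (@ge0_integral_pushforward _ _ _ _ R sw msw J off h moff
  (measurable_funTS mh) (fun z _ => h0 z)).
congr (\int[J]_(z in _) _); apply/seteqP.
by split => -[x y]; rewrite /offdiag /sw /= eq_sym.
Qed.

(** The first coordinate follows from the kernel representation, the second from symmetry.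
    Convergence m-a.e. can thus be used in both variables under J. *)
Lemma jump_null (N : set (borel E)) : measurable N -> m N = 0 ->
  J ((N `*` setT) `&` off) = 0 /\ J ((setT `*` N) `&` off) = 0.
Proof.
move=> mN N0; have moff := measurable_offdiag.
have mNT : measurable ((N `*` setT) `&` off).
  by apply: measurableI => //; exact: measurableX.
have H1 : J ((N `*` setT) `&` off) = 0.
  have [mk ->] := kerJ mNT (@subIsetr _ _ _).
  rewrite (@ae_eq_integral _ _ _ m setT (cst 0))//; first exact: integral0.
  exists N; split => // x /= H; apply: contrapT => Nx; apply: H => _.
  rewrite xsectionI notin_xsectionX ?set0I ?measure0//.
  by apply/negP => /set_mem.
split => //; rewrite -[RHS]H1 -(symJ mNT (@subIsetr _ _ _)); congr (J _).
by apply/seteqP; split => -[x y] /= [[? ?] ?]; split => //=;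
  rewrite /offdiag /= eq_sym.
Qed.

End jump_measure.

(** * The jump kernel on a cell of finite mass *)

Section finite_cell.
Context d0 d1 d2 (Z : measurableType d0) (X : measurableType d1)
  (Y : measurableType d2) (R : realType).
Variables (l : X -> {measure set Y -> \bar R}) (phi : Z -> X) (C : set (X * Y)).
Hypotheses (mphi : measurable_fun setT phi) (mC : measurable C).
Local Open Scope ereal_scope.
Hypothesis Cfin : forall x, l x (xsection C x) < +oo.
Hypothesis ml : forall A, measurable A -> A `<=` C ->
  measurable_fun setT (fun x => l x (xsection A x)).

Let cell (x : X) : {measure set Y -> \bar R} :=
  mrestr (l x) (measurable_xsection x mC).

Let measurable_cell U : measurable U -> measurable_fun setT (cell ^~ U).
Proof.
move=> mU; have mUC : measurable ((setT `*` U) `&` C).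
  by apply: measurableI => //; exact: measurableX.
have := ml mUC (@subIsetr _ _ _); congr (measurable_fun _ _).
by apply/funext => x; rewrite xsectionI in_xsectionX// inE.
Qed.

Let cell_mixin := isKernel.Build _ _ _ _ R cell measurable_cell.
Let cell_kernel : R.-ker X ~> Y := HB.pack cell cell_mixin.

Lemma measurable_integral_cell (h : Z * Y -> \bar R) :
  measurable_fun setT h -> (forall zy, 0 <= h zy) ->
  measurable_fun setT (fun z =>
    \int[l (phi z)]_(y in xsection C (phi z)) h (z, y)).
Proof.
move=> mh h0.
have cfin x : cell_kernel x setT < +oo.
  by rewrite (_ : cell_kernel x setT = l x (setT `&` xsection C x))// setTI.
have := @measurable_integral_kernel_param _ _ _ Z X Y R cell_kernel phi mphi h
  cfin h0 mh.
congr (measurable_fun _ _); apply/funext => z.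
apply: ge0_integral_mrestr => //.
exact: (@measurable_fun_pair2 _ _ _ _ _ _ h z mh).
Qed.

End finite_cell.

(** * Disintegration along the jump kernel *)

Section jump_kernel.
Context {R : realType} {E : pmetricType R}.
Variable (m : {measure set (borel E) -> \bar R}) (B : nat -> set E).
Hypothesis HB : precompact_base B.
Variables (D : set (borel E -> R)) (F : (borel E -> R) -> (borel E -> R) -> R).
Hypotheses (dirF : dirichlet_form m D F) (regF : regular_form m D F).
Variables (J : {measure set (borel E * borel E) -> \bar R})
  (Jk : R.-ker (borel E) ~> (borel E)).
Hypotheses (symJ : jump_symmetric J) (kerJ : jump_kernel m J Jk)
  (pureJ : pure_jump m D F J).
Local Open Scope ereal_scope.
Local Notation off := (@offdiag R E).

(* The kernel [Jk] is not assumed s-finite; on each of the following cells it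
   is finite, and together they carry [J]. *)
Definition jump_cell (l : nat) : set (borel E * borel E) :=
  if unpickle l is Some (i, j, n) then
    if `[< B i `&` B j = set0 /\ J (B i `*` B j) < +oo >] then
      (B i `&` [set x | Jk x (B j) <= n%:R%:E]) `*` B j
    else set0
  else set0.

Definition jump_support := \bigcup_l jump_cell l.

Let mB n : measurable (B n : set (borel E)).
Proof.
by have [oB _ _] := HB; apply: (@open_measurable_borel E); exact: oB.
Qed.

Let mJkB n j : measurable [set x | Jk x (B j) <= n%:R%:E].
Proof.
have mk := measurable_kernel Jk (B j : set (borel E)) (mB j).
have := mk measurableT `]-oo, n%:R%:E]%classic (emeasurable_itv _).
by rewrite setTI; congr (measurable _); apply/seteqP.
Qed.

Lemma measurable_jump_cell l : measurable (jump_cell l).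
Proof.
rewrite /jump_cell; case: unpickle => // -[[i j] n].
by case: asboolP => // _; apply: measurableX => //; exact: measurableI.
Qed.

Lemma jump_cell_offdiag l : jump_cell l `<=` off.
Proof.
rewrite /jump_cell; case: unpickle => // -[[i j] n].
case: asboolP => [[BB _] [x y] [/= [Bx _] By]|_ z //].
exact: (disjoint_sub_offdiag BB).
Qed.

Lemma jump_cell_fin l x : Jk x (xsection (jump_cell l) x) < +oo.
Proof.
rewrite /jump_cell; case: unpickle => [[[i j] n]|];
  last by rewrite xsection0 measure0.
case: asboolP => [_|_]; last by rewrite xsection0 measure0.
have [xB|xB] := boolP (x \in B i `&` [set x | Jk x (B j) <= n%:R%:E]).
  rewrite in_xsectionX//; move: xB => /set_mem [_ /= xB].
  by rewrite (le_lt_trans xB)// ltry.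
by rewrite notin_xsectionX// measure0.
Qed.

Lemma measurable_jump_support : measurable jump_support.
Proof. by apply: bigcupT_measurable => l; exact: measurable_jump_cell. Qed.

Lemma jump_support_offdiag : jump_support `<=` off.
Proof. by move=> z [l _ /jump_cell_offdiag]. Qed.

(** When J(B_i x B_j) is finite, [Jk x (B j)] is finite for m-a.e. x in B_i. The exceptional x form
    a null set, which J does not charge; any other x lies in a cell whose n exceeds [Jk x (B j)]. *)
Lemma jump_support_full : J (off `\` jump_support) = 0.
Proof.
have moff := measurable_offdiag HB dirF regF pureJ.
pose N i j : set (borel E) :=
  if `[< B i `&` B j = set0 /\ J (B i `*` B j) < +oo >]
  then B i `&` [set x | Jk x (B j) = +oo] else set0.
have mN i j : measurable (N i j).
  rewrite /N; case: asboolP => // _; apply: measurableI => //.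
  have := measurable_kernel Jk (B j : set (borel E)) (mB j)
    measurableT [set +oo].
  by rewrite setTI; apply; exact: emeasurable_set1.
have N0 i j : m (N i j) = 0.
  rewrite /N; case: asboolP => [[BB Jfin]|_]; last by rewrite measure0.
  have mBB : measurable (B i `*` B j : set (borel E * borel E)) by
      exact: measurableX.
  have [mk JE] := kerJ mBB (disjoint_sub_offdiag BB).
  have int : m.-integrable setT (fun x => Jk x (xsection (B i `*` B j) x)).
    apply/integrableP; split => //; under eq_integral do rewrite gee0_abs//.
    by rewrite -JE.
  have [A [mA A0 HA]] := integrable_ae measurableT int.
  apply: (subset_measure0 _ mA _ A0).
    by have := mN i j; rewrite /N asboolT.
  move=> x [Bx /= Jx]; apply: HA => /= /(_ I).
  by rewrite in_xsectionX ?Jx// inE.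
pose N' := \bigcup_i \bigcup_j N i j.
have mN' : measurable N'.
  by apply: bigcupT_measurable => i; apply: bigcupT_measurable => j.
have N'0 : m N' = 0.
  apply/eqP; rewrite eq_le measure_ge0 andbT.
  apply: le_trans (measure_sigma_subadditive _ _ _ (@subset_refl _ _)) _ => //.
    by move=> i; apply: bigcupT_measurable.
  rewrite eseries0// => i _ _; apply/eqP; rewrite eq_le measure_ge0 andbT.
  apply: le_trans (measure_sigma_subadditive _ _ _ (@subset_refl _ _)) _ => //.
    exact: bigcupT_measurable.
  by rewrite eseries0// => j _ _; exact: N0.
have [J0 _] := jump_null HB dirF regF symJ kerJ pureJ mN' N'0.
apply: (subset_measure0 _ _ _ J0).
- by apply: measurableD => //; exact: measurable_jump_support.
- by apply: measurableI => //; exact: measurableX.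
move=> [x y] /= [xy Wxy]; split => //=; split => //.
have [i [j [Bx By BB Jfin]]] := jump_finite_cover HB dirF regF pureJ xy.
exists i => //; exists j => //; rewrite /N asboolT//; split => //=.
apply: contrapT => /eqP Jy; apply: Wxy.
have /(@fineK _) JK : Jk x (B j) \is a fin_num by rewrite ge0_fin_numE// ltey.
exists (pickle (i, j, (Num.truncn (fine (Jk x (B j)))).+1)) => //.
rewrite /jump_cell pickleK asboolT//; split => //=; split => //=.
rewrite -JK lee_fin ltW//.
by have /andP[] := truncn_itv (fine_ge0 (measure_ge0 (Jk x) (B j))).
Qed.

Lemma jump_disintegration (h : borel E * borel E -> \bar R) :
  measurable_fun setT h -> (forall z, 0 <= h z) ->
  \int[J]_(z in off) h z =
  \int[m]_x \int[Jk x]_(y in xsection jump_support x) h (x, y).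
Proof.
move=> mh h0; have moff := measurable_offdiag HB dirF regF pureJ.
have mW := measurable_jump_support.
have mD : measurable (off `\` jump_support) by exact: measurableD.
rewrite (@ge0_negligible_integral _ _ _ J off _ h mD moff (measurable_funTS mh)
  (fun z _ => h0 z) jump_support_full).
rewrite (_ : off `\` (off `\` jump_support) = jump_support); last first.
  by rewrite setDD; apply/setIidPr; exact: jump_support_offdiag.
rewrite -(ge0_integral_mrestr J mW mh h0).
have msec x : measurable (xsection jump_support x) by
    exact: measurable_xsection.
have mpair (x : borel E) : measurable_fun setT (fun y : borel E => (x, y)).
  exact: measurable_fun_pair.
have preE (A : set (borel E * borel E)) x :
    (fun y => (x, y)) @^-1` A `&` xsection jump_support x =
    xsection (A `&` jump_support) x by rewrite xsectionI (xsectionE A).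
rewrite (@integral_pushforward_mixture _ _ _ _
  (borel E * borel E)%type (borel E)
  (borel E) (borel E * borel E)%type R (mrestr J mW) m
  (fun x => mrestr (Jk x) (msec x)) id
  (fun x y => (x, y)) _ mpair _ _ h h0 mh)//.
- apply: eq_integral => x _; apply: (ge0_integral_mrestr (Jk x) (msec x)) => //.
  exact: (@measurable_fun_pair2 _ _ _ _ _ _ h x mh).
- move=> A mA; have mAW : measurable (A `&` jump_support) by exact: measurableI.
  have [+ _] := kerJ mAW (fun z Hz => jump_support_offdiag Hz.2).
  by congr (measurable_fun _ _); apply/funext => x; rewrite -preE.
- move=> A mA; have mAW : measurable (A `&` jump_support) by exact: measurableI.
  have [_ E2] := kerJ mAW (fun z Hz => jump_support_offdiag Hz.2).
  transitivity (J (A `&` jump_support)) => //; rewrite E2.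
  by apply: eq_integral => x _; rewrite -preE.
Qed.

(** Once [seqDU] has made the cells disjoint, the integral is a countable sum of integrals against
    finite kernels. *)
Lemma measurable_jump_integral d0 (Z : measurableType d0) (phi : Z -> borel E)
    (h : Z * borel E -> \bar R) : measurable_fun setT phi ->
  measurable_fun setT h -> (forall z, 0 <= h z) ->
  measurable_fun setT (fun z =>
    \int[Jk (phi z)]_(y in xsection jump_support (phi z)) h (z, y)).
Proof.
move=> mphi mh h0; pose C := seqDU jump_cell.
have mC l : measurable (C l) by apply: seqDU_measurable => // k;
  exact: measurable_jump_cell.
have Cs l : C l `<=` jump_cell l by exact: subset_seqDU.
rewrite (_ : (fun z => _) = (fun z => \sum_(0 <= l <oo)
    \int[Jk (phi z)]_(y in xsection (C l) (phi z)) h (z, y))).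
  apply: ge0_emeasurable_sum => [l z _ _|l _]; first exact: integral_ge0.
  apply: (measurable_integral_cell mphi (mC l)) => //.
    move=> x; apply: le_lt_trans (jump_cell_fin l x).
    apply: le_measure; rewrite ?inE.
    - exact: (measurable_xsection x (mC l)).
    - exact: (measurable_xsection x (measurable_jump_cell l)).
    - exact: le_xsection.
  move=> A mA AC; apply: (kerJ mA _).1.
  by move=> z /AC /Cs /jump_cell_offdiag.
apply/funext => z.
rewrite (_ : jump_support = \bigcup_l C l);
  last by rewrite /jump_support seqDU_bigcup_eq.
rewrite xsection_bigcup ge0_integral_bigcup//.
- by move=> l; exact: measurable_xsection.
- by apply: measurable_funTS; exact: (@measurable_fun_pair2 _ _ _ _ _ _ h z mh).
- exact/trivIset_xsection/trivIset_seqDU.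
Qed.

End jump_kernel.

(** * Lower limits, and almost everywhere limits from summable squares *)

Section fatou_complements.
Context d (T : measurableType d) (R : realType).
Variable mu : {measure set T -> \bar R}.
Local Open Scope ereal_scope.

Lemma limn_einf_le (u : (\bar R)^nat) C : (\forall n \near \oo, u n <= C) ->
  limn_einf u <= C.
Proof.
move=> [N _ uC]; rewrite limn_einf_lim; apply: lime_le;
  first exact: is_cvg_einfs.
apply: nearW => n; apply: (@le_trans _ _ (u (maxn n N))).
  by apply: ereal_inf_lbound; exists (maxn n N) => //=; rewrite leq_maxl.
by apply: uC; rewrite /= leq_maxr.
Qed.

Lemma summable_ae_cvg0 (f : nat -> T -> R) :
  (forall n, measurable_fun setT (f n)) ->
  \sum_(n <oo) \int[mu]_x (f n x ^+ 2)%:E < +oo ->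
  {ae mu, forall x, f n x @[n --> \oo] --> (0 : R)%R}.
Proof.
move=> mf; have mf2 n : measurable_fun setT (fun x => (f n x ^+ 2)%:E).
  by apply/measurable_EFinP; exact: measurable_funX.
rewrite -integral_nneseries//; last by move=> n x _; rewrite lee_fin sqr_ge0.
move=> foo.
have s0 x : 0 <= \sum_(n <oo) (f n x ^+ 2)%:E.
  by apply: nneseries_ge0 => n _ _; rewrite lee_fin sqr_ge0.
have int : mu.-integrable setT (fun x => \sum_(n <oo) (f n x ^+ 2)%:E).
  apply/integrableP; split.
    by apply: ge0_emeasurable_sum => // n x _ _; rewrite lee_fin sqr_ge0.
  by under eq_integral do rewrite gee0_abs//.
apply: (ae_imp (integrable_ae measurableT int)) => x /(_ I).
rewrite ge0_fin_numE// => xoo.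
have f20 n : 0 <= (f n x ^+ 2)%:E by rewrite lee_fin sqr_ge0.
have tail := nneseries_tail_cvg xoo (fun n _ => f20 n).
have /fine_cvgP[_ c2] : (f n x ^+ 2)%:E @[n --> \oo] --> 0.
  apply: (squeeze_cvge _ (cvg_cst 0) tail); apply: nearW => n.
  rewrite f20/= (nneseries_split n 1)// addn1 big_nat1 leeDl// nneseries_ge0//.
apply/cvgrPdist_lt => e e0.
have e20 : (0 < e ^+ 2)%R by rewrite exprn_gt0.
move/cvgrPdist_lt: c2 => /(_ _ e20); apply: filterS => n /=.
rewrite !sub0r !normrN normrX => H.
by rewrite -(@ltr_pXn2r _ 2)// ?nnegrE ?ltW.
Qed.

End fatou_complements.

(** * The form bounded by the jump energy *)

Section jump_energy.
Context {R : realType} {E : pmetricType R}.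
Variable (m : {measure set (borel E) -> \bar R}) (B : nat -> set E).
Hypothesis HB : precompact_base B.
Variables (D : set (borel E -> R)) (F : (borel E -> R) -> (borel E -> R) -> R).
Hypotheses (dirF : dirichlet_form m D F) (regF : regular_form m D F).
Variables (J : {measure set (borel E * borel E) -> \bar R})
  (Jk : R.-ker (borel E) ~> (borel E)).
Hypotheses (symJ : jump_symmetric J) (kerJ : jump_kernel m J Jk)
  (pureJ : pure_jump m D F J).
Local Notation off := (@offdiag R E).
Local Notation dsq := (@jump_square R E).

Let DB u v : D u -> D v -> D (u \- v).
Proof.
move=> Du Dv; have := df_lin dirF (-1) Dv Du; congr D.
by apply/funext => x /=; rewrite mulN1r addrC.
Qed.

Lemma form_quadratic a u v : D u -> D v ->
  F (fun x => a * u x + v x) (fun x => a * u x + v x) =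
  a ^+ 2 * F u u + 2 * a * F u v + F v v.
Proof.
move=> Du Dv; have Duv := df_lin dirF a Du Dv.
rewrite (df_linear dirF a Du Dv Duv) !(df_sym dirF _ Duv)//.
rewrite (df_linear dirF a Du Dv Du) (df_linear dirF a Du Dv Dv).
by rewrite (df_sym dirF Dv Du); ring.
Qed.

Lemma form_add_le u v : D u -> D v ->
  F (fun x => u x + v x) (fun x => u x + v x) <= 2 * F u u + 2 * F v v.
Proof.
move=> Du Dv.
have := form_quadratic 1 Du Dv; have := form_quadratic (-1) Du Dv.
have := df_ge0 dirF (df_lin dirF (-1) Du Dv) => /[swap] ->.
rewrite (_ : (fun x => 1 * u x + v x) = (fun x => u x + v x)); last first.
  by apply/funext => x; rewrite mul1r.
by move=> + ->; lra.
Qed.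

Lemma form_sub_le u v : D u -> D v ->
  F (u \- v) (u \- v) <= 2 * F u u + 2 * F v v.
Proof.
move=> Du Dv.
have := form_quadratic 1 Dv Du; have := form_quadratic (-1) Dv Du.
have := df_ge0 dirF (df_lin dirF 1 Dv Du) => /[swap].
rewrite (_ : (fun x => -1 * v x + u x) = u \- v); last first.
  by apply/funext => x /=; rewrite mulN1r addrC.
by move=> -> + H; rewrite H; lra.
Qed.

Lemma form_approximation w (e : R) : D w -> 0 < e ->
  exists v, [/\ D v, continuous (v : E -> R), F (w \- v) (w \- v) <= e &
    inner_prod m (w \- v) (w \- v) <= e].
Proof.
move=> Dw e0; have [v [Dv [cv _]]] := reg_form regF Dw e0.
rewrite /form1 => ve; exists v; split => //.
  by apply: le_trans (ltW ve); rewrite lerDl; exact: inner_prod_ge0.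
by apply: le_trans (ltW ve); rewrite lerDr (df_ge0 dirF)//; exact: DB.
Qed.

(** Fatou's lemma applied to the approximants v_n themselves would bound the jump energy by the
    form, the wrong direction. It is applied to v_k - v_n instead, which makes the jump energy of w
    - v_n small. The exact factor 1/2 becomes 2 because (a + b)^2 <= 2a^2 + 2b^2 is used twice. *)
Lemma energy_le w : D w ->
  ((F w w)%:E <= 2%:E * \int[J]_(z in off) dsq w z)%E.
Proof.
move=> Dw; have moff := measurable_offdiag HB dirF regF pureJ.
(* Summable errors, so that the whole sequence of approximants converges a.e. *)
pose e (n : nat) : R := 1 / (2 ^ n.+1)%:R.
have e0 n : 0 < e n by rewrite divr_gt0// ltr0n expn_gt0.
have [v vP] := choice (fun n => form_approximation Dw (e0 n)).
have Dv n : D (v n) by have [] := vP n.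
have cv n : continuous (v n : E -> R) by have [] := vP n.
have Fv n : F (w \- v n) (w \- v n) <= e n by have [] := vP n.
have Nv n : inner_prod m (w \- v n) (w \- v n) <= e n by have [] := vP n.
have mw : measurable_fun setT w := Lfun_measurable (df_L2 dirF Dw).
have mv n : measurable_fun setT (v n) := Lfun_measurable (df_L2 dirF (Dv n)).
have mB (u1 u2 : borel E -> R) : measurable_fun setT u1 ->
    measurable_fun setT u2 -> measurable_fun setT (u1 \- u2).
  by move=> *; exact: measurable_funB.
have [N [mN N0 HN]] : {ae m, forall x, (w x - v n x) @[n --> \oo] --> (0 : R)}.
  apply: (@summable_ae_cvg0 _ _ _ m (fun n => w \- v n)) => [n|];
    first exact: mB.
  apply: (@le_lt_trans _ _ 1%:E); last by rewrite ltry.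
  apply: (le_trans _ (epsilon_trick0 xpredT (@ler01 R))).
  apply: lee_nneseries => [n _ _|n _].
    by apply: integral_ge0 => x _; rewrite lee_fin sqr_ge0.
  by rewrite inner_prodE ?lee_fin//; exact: (df_L2 dirF (DB Dw (Dv n))).
have vcvg x : ~ N x -> v k x @[k --> \oo] --> w x.
  move=> Nx; have H : (w x - v n x) @[n --> \oo] --> (0 : R).
    by apply: contrapT => ?; apply: Nx; exact: HN.
  rewrite (_ : (fun k => v k x) = (fun k => w x - (w x - v k x))); last first.
    by apply/funext => k; rewrite subKr.
  have H2 := cvgB (cvg_cst (w x)) H; rewrite subr0 in H2.
  exact: H2.
have [JN1 JN2] := jump_null HB dirF regF symJ kerJ pureJ mN N0.
pose NN : set (borel E * borel E) :=
  ((N `*` setT) `&` off) `|` ((setT `*` N) `&` off).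
have mN1 : measurable ((N `*` setT) `&` off : set (borel E * borel E)).
  by apply: measurableI => //; exact: measurableX.
have mN2 : measurable ((setT `*` N) `&` off : set (borel E * borel E)).
  by apply: measurableI => //; exact: measurableX.
have mdsq (u : borel E -> R) (S : set _) : measurable_fun setT u ->
  measurable_fun S (dsq u) by move=> mu; apply: measurable_funTS;
    exact: measurable_jump_square.
have dsq0 u z : (0 <= dsq u z)%E by exact: jump_square_ge0.
have aeN : {ae J, forall z, off z -> ~ N z.1 /\ ~ N z.2}.
  exists NN; split; first exact: measurableU.
    by rewrite measureU0.
  move=> [x y] /= /not_implyP[xy /not_andP[/contrapT Nx|/contrapT Ny]].
    by left; split.
  by right; split.
(* The form of (w - v_n) - (w - v_k) is at most 2 e_n + 2 e_k <= 4 e_n, and the jump integral is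
   twice the form. *)
have Wv n : (\int[J]_(z in off) dsq (w \- v n)%R z <= (8 * e n)%:E)%E.
  have step k : (n <= k)%N -> (\int[J]_(z in off) dsq (v k \- v n)%R z <=
      (8 * e n)%:E)%E.
    move=> nk; rewrite (form_continuousE dirF pureJ)//; last 2 first.
    - exact: DB.
    - by move=> x; apply: cvgB; [exact: cv|exact: cv].
    rewrite -EFinM lee_fin.
    have -> : v k \- v n = (w \- v n) \- (w \- v k).
      by apply/funext => x /=; ring.
    have := form_sub_le (DB Dw (Dv n)) (DB Dw (Dv k)).
    have ekn : e k <= e n.
      rewrite /e ler_pM2l// lef_pV2 ?posrE ?ltr0n
          ?expn_gt0// ler_nat leq_exp2l//.
    have := Fv n; have := Fv k; lra.
  apply: (@le_trans _ _
      (\int[J]_(z in off) limn_einf (fun k => dsq (v k \- v n)%R z))%E).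
    apply: ae_ge0_le_integral => //.
    - by apply: mdsq; exact: mB.
    - move=> z _; rewrite limn_einf_lim; apply: lime_ge;
        first exact: is_cvg_einfs.
      by apply: nearW => k; apply: le_ereal_inf_tmp => _ [i _ <-]; exact: dsq0.
    - apply: measurableT_comp => //; apply: measurable_fun_limn_esup => k.
      by apply: measurableT_comp => //; apply: mdsq; exact: mB.
    apply: (ae_imp aeN) => -[x y] H xy; have [/= Nx Ny] := H xy.
    have cx := vcvg _ Nx; have cy := vcvg _ Ny.
    have c : dsq (v k \- v n)%R (x, y) @[k --> \oo] --> dsq (w \- v n)%R (x, y).
      apply: cvg_EFin; first by apply: nearW.
      rewrite /= !expr2; apply: cvgM; apply: cvgB; apply: cvgB => //;
        exact: cvg_cst.
    by have [-> _] := cvg_limn_einf_sup c.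
  apply: (le_trans (fatou _ moff (f := fun k => dsq (v k \- v n)%R) _ _)) => //.
  - by move=> k; apply: mdsq; exact: mB.
  - by apply: limn_einf_le; exists n => // k; exact: step.
have [Ioo|] := ltP (\int[J]_(z in off) dsq w z)%E +oo%E; last first.
  by rewrite leye_eq => /eqP ->; rewrite gt0_muley ?leey// lte_fin.
have I0 : (0 <= \int[J]_(z in off) dsq w z)%E by exact: integral_ge0.
have IE : (\int[J]_(z in off) dsq w z)%E \is a fin_num by rewrite ge0_fin_numE.
rewrite -(fineK IE) -EFinM lee_fin; set I1 := fine _.
(* Of the 18, 2 comes from the form of w - v_n and 16 from its jump energy, at most 8 e_n, counted
   twice. *)
have main n : F w w <= 2 * I1 + 18 * e n.
  have : (2%:E * (F (v n) (v n))%:E <= (2 * I1 + 16 * e n)%:E)%E.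
    rewrite -(form_continuousE dirF pureJ (Dv n) (cv n)).
    apply: (@le_trans _ _ (\int[J]_(z in off)
      (2%:E * dsq w z + 2%:E * dsq (w \- v n)%R z))%E).
      apply: ge0_le_integral => //.
      - exact: mdsq.
      - apply: emeasurable_funD; apply: measurable_funeM; apply: mdsq => //;
          exact: mB.
      - move=> z _; rewrite /jump_square -!EFinM -EFinD lee_fin /=.
        have := sqr_ge0 (2 * (w z.2 - w z.1) - (v n z.2 - v n z.1)); nra.
    rewrite ge0_integralD//; last 4 first.
    - by move=> z _; rewrite mule_ge0.
    - by apply: measurable_funeM; exact: mdsq.
    - by move=> z _; rewrite mule_ge0.
    - by apply: measurable_funeM; apply: mdsq; exact: mB.
    rewrite !ge0_integralZl//; try (by apply: mdsq => //; exact: mB).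
    rewrite -(fineK IE) -/I1 -EFinM (EFinD (2 * I1)); apply: leeD2l.
    have -> : (16 * e n)%:E = (2%:E * (8 * e n)%:E)%E.
      by rewrite -EFinM; congr (_%:E); ring.
    by rewrite lee_pmul2l.
  rewrite -EFinM lee_fin => Fvn.
  have := form_add_le (DB Dw (Dv n)) (Dv n).
  rewrite (_ : (fun x => _) = w); last by apply/funext => x /=; ring.
  have := Fv n; lra.
apply/ler_addgt0Pl => eps eps0; rewrite addrC.
have ep18 : 0 < eps / 18 by rewrite divr_gt0.
have [n _ /(_ n (leqnn n)) /= Hn] := near_infty_natSinv_lt (PosNum ep18).
apply: (le_trans (main n)); rewrite lerD2l -ler_pdivlMl// mulrC.
apply: le_trans (ltW Hn); rewrite /e mul1r lef_pV2 ?posrE ?ltr0n ?expn_gt0//.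
by rewrite ler_nat ltnW// ltn_expl.
Qed.

(* In the notation of the paper the right-hand side is, up to the constant,
   [\int |u|^(2q-2) Gamma[u] dm]. *)
Lemma signed_power_energy_le (q : R) (u : borel E -> R) : 1 < q ->
  measurable_fun setT u -> D (fun x => signed_powR q (u x)) ->
  ((F (fun x => signed_powR q (u x)) (fun x => signed_powR q (u x)))%:E <=
   (4 * q ^+ 2)%:E * \int[m]_x ((`|u x| `^ (2 * q - 2))%:E *
     \int[Jk x]_(y in xsection (jump_support B J Jk) x)
         ((u y - u x) ^+ 2)%:E))%E.
Proof.
move=> q1 mu Dv; have moff := measurable_offdiag HB dirF regF pureJ.
have q0 : 0 <= q ^+ 2 by rewrite sqr_ge0.
pose a (z : borel E * borel E) : \bar R := (`|u z.1| `^ (2 * q - 2))%:E.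
have a0 z : (0 <= a z)%E by rewrite lee_fin powR_ge0.
have ma : measurable_fun setT a.
  apply/measurable_EFinP.
  apply: (@measurableT_comp _ _ _ _ _ _ (fun x => `|u x| `^ (2 * q - 2))) => //.
  exact: measurable_norm_powR.
have ms : measurable_fun setT (dsq u) by exact: measurable_jump_square.
have s0 z : (0 <= dsq u z)%E by exact: jump_square_ge0.
pose h z := (a z * dsq u z)%E.
have mh : measurable_fun setT h by exact: emeasurable_funM.
have h0 z : (0 <= h z)%E by rewrite mule_ge0.
have mh' : measurable_fun setT (fun z : borel E * borel E => h (z.2, z.1)).
  by apply: (measurableT_comp mh); exact: measurable_fun_pair.
apply: (le_trans (energy_le Dv)).
(* The factors come from [energy_le], from the pointwise inequality and from merging the two
   symmetric halves. *)
have -> : (4 * q ^+ 2)%:E = (2%:E * ((q ^+ 2)%:E * 2%:E))%E :> \bar R.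
  by rewrite -!EFinM; congr (_%:E); ring.
rewrite -!muleA lee_pmul2l//.
apply: (@le_trans _ _ (\int[J]_(z in off) ((q ^+ 2)%:E * (h z + h
    (z.2, z.1))))%E).
  apply: ge0_le_integral => //.
  - by move=> z _; exact: jump_square_ge0.
  - apply: measurable_funTS; apply: measurable_jump_square.
    exact: (measurableT_comp (@measurable_signed_powR _ _) mu).
  - by apply: measurable_funTS; apply: measurable_funeM;
      exact: emeasurable_funD.
  move=> z _; rewrite -[leRHS]/((q ^+ 2 *
    (`|u z.1| `^ (2 * q - 2) * (u z.2 - u z.1) ^+ 2 +
     `|u z.2| `^ (2 * q - 2) * (u z.1 - u z.2) ^+ 2))%:E) lee_fin.
  have := signed_powR_sub_sqr (u z.1) (u z.2) q1.
  by rewrite -(sqrrN (u z.1 - u z.2)) opprB -mulrDl [X in _ * X]mulrC.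
rewrite ge0_integralZl//; last 2 first.
- by apply: measurable_funTS; exact: emeasurable_funD.
- by move=> z _; rewrite adde_ge0.
rewrite lee_wpmul2l ?lee_fin// ge0_integralD//; try exact: measurable_funTS.
rewrite (jump_swap HB dirF regF symJ pureJ mh h0).
rewrite (jump_disintegration HB dirF regF symJ kerJ pureJ mh h0).
rewrite [leRHS](_ : _ = 2%:E * \int[m]_x \int[Jk x]_(y in
    xsection (jump_support B J Jk) x) h (x, y))%E; last first.
  congr (_ * _)%E; apply: eq_integral => x _.
  rewrite -ge0_integralZl//.
  - apply: measurable_xsection; exact: (measurable_jump_support HB).
  - apply: measurable_funTS;
      exact: (@measurable_fun_pair2 _ _ _ _ _ _ (dsq u) x ms).
  - by move=> y _; rewrite lee_fin sqr_ge0.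
by rewrite mule_natl mule2n.
Qed.

End jump_energy.

(** * Translation invariance of Lebesgue measure *)

Section lebesgue_shift.
Context {R : realType}.
Local Notation leb := (@lebesgue_measure R).

Lemma measurable_addr (s : R) :
  measurable_fun setT (fun t : measurableTypeR R => t + s : measurableTypeR R).
Proof. by apply: measurable_funD => //; exact: measurable_cst. Qed.

Lemma lebesgue_measure_shift (s : R) (A : set (measurableTypeR R)) :
  measurable A -> leb [set t | A (t + s)] = leb A.
Proof.
move=> mA; apply/esym.
have -> : [set t | A (t + s)] = (fun t => t + s) @^-1` A by [].
pose mu : {measure set (measurableTypeR R) -> \bar R} :=
  pushforward leb (fun t : measurableTypeR R => t + s : measurableTypeR R).
have := @lebesgue_measure_unique R (mu (measurable_addr s)) _ A mA; apply.
move=> _ [[a b]] /= _ <-; rewrite /mu /pushforward.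
have -> : (fun t => t + s) @^-1` `]a, b]%classic = `]a - s, b - s]%classic.
  by apply/seteqP; split => t /=; rewrite !in_itv/= ltrBlDr lerBrDr.
by rewrite !lebesgue_measure_itv/= !lte_fin ltrD2r -!EFinB opprD opprK addrACA
  [_ + s]addrC subrr addr0.
Qed.

Lemma integral_shift (g : R -> \bar R) (a b s : R) : measurable_fun setT g ->
  (forall t, 0 <= g t)%E ->
  (\int[leb]_(t in `]a, b]) g (t + s)%R =
   \int[leb]_(t in `](a + s)%R, (b + s)%R]) g t)%E.
Proof.
move=> mg g0.
pose f (t : measurableTypeR R) : measurableTypeR R := t + s.
pose mu : {measure set (measurableTypeR R) -> \bar R} := pushforward leb f.
rewrite [RHS](eq_measure_integral (mu (measurable_addr s))); last first.
  by move=> A mA _; apply/esym; exact: lebesgue_measure_shift.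
rewrite ge0_integral_pushforward//; last 2 first.
- exact: measurable_addr.
- exact: measurable_funTS.
congr integral; apply/seteqP; split => t /=; rewrite !in_itv/= /f;
  by rewrite ltrD2r lerD2r.
Qed.

End lebesgue_shift.

(** * Difference quotients of nonincreasing functions *)

Section monotone_functions.
Context {R : realType}.
Local Notation leb := (@lebesgue_measure R).
Variable g : R -> R.
Hypotheses (g0 : forall t, 0 <= g t) (gni : nonincreasing_fun g).

Let mg : measurable_fun setT g.
Proof. exact: nonincreasing_measurable. Qed.

Let mEg (A : set R) : measurable_fun A (EFin \o g).
Proof. by apply: measurable_funTS; exact/measurable_EFinP. Qed.

Let lebE (a b : R) : a <= b -> leb `]a, b]%classic = (b - a)%:E.
Proof.
move=> ab; rewrite lebesgue_measure_itv/= lte_fin -EFinB.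
by case: ltgtP ab => // -> _; rewrite subrr.
Qed.

Lemma integral_nonincreasing_bounds a b : a <= b ->
  (((b - a) * g b)%:E <= \int[leb]_(t in `]a, b]) (g t)%:E <=
   ((b - a) * g a)%:E)%E.
Proof.
move=> ab; apply/andP; split.
  rewrite mulrC EFinM -(lebE ab) -integral_cst//.
  apply: ge0_le_integral => //; try by move=> *; rewrite lee_fin.
    exact: mEg.
  by move=> t /=; rewrite in_itv/= => /andP[_ tb]; rewrite lee_fin gni.
rewrite mulrC EFinM -(lebE ab) -integral_cst//.
apply: ge0_le_integral => //; try by move=> *; rewrite lee_fin.
  exact: mEg.
by move=> t /=; rewrite in_itv/= => /andP[/ltW ta _]; rewrite lee_fin gni.
Qed.

Let ge0_fin (x : \bar R) (c : R) : (0 <= x)%E -> (x <= c%:E)%E ->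
  exists2 r : R, x = r%:E & 0 <= r.
Proof. by case: x => [r| |] // r0 _; exists r. Qed.

(** A translation turns the integral into that of g over (a, a+s] minus that over (b, b+s]; the
    proof keeps this as a sum, to avoid subtraction of extended reals. *)
Lemma integral_increment_bounds a b s : 0 <= s -> a + s <= b ->
  ((s * (g (a + s) - g b))%:E <=
   \int[leb]_(t in `]a, b]) (g t - g (t + s))%:E <= (s * g a)%:E)%E.
Proof.
move=> s0 asb.
have aas : a <= a + s by rewrite lerDl.
have bbs : b <= b + s by rewrite lerDl.
have g0E (A : set R) t : A t -> (0 <= (g t)%:E)%E by rewrite lee_fin.
have mgs (A : set R) : measurable_fun A (fun t => (g (t + s))%:E).
  apply: measurable_funTS; apply/measurable_EFinP.
  exact: (measurableT_comp mg (@measurable_addr R s)).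
have incr0 t : (0 <= (g t - g (t + s))%:E)%E.
  by rewrite lee_fin subr_ge0 gni// lerDl.
set X := (\int[leb]_(t in _) _)%E.
have XE : (X + \int[leb]_(t in `](a + s)%R, (b + s)%R]) (g t)%:E =
    \int[leb]_(t in `]a, b]) (g t)%:E)%E.
  rewrite -(@integral_shift _ (EFin \o g))// /X -ge0_integralD//.
  - by apply: eq_integral => t _; rewrite /= -EFinD subrK.
  - apply: measurable_funTS; apply/measurable_EFinP;
      apply: measurable_funB => //.
    exact: (measurableT_comp mg (@measurable_addr R s)).
  - by move=> t _; rewrite lee_fin.
  - exact: mgs.
have splitE x y z : x <= y -> y <= z ->
  (\int[leb]_(t in `]x, z]) (g t)%:E = \int[leb]_(t in `]x, y]) (g t)%:E +
   \int[leb]_(t in `]y, z]) (g t)%:E)%E.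
  move=> xy yz; rewrite -ge0_integral_setU//=.
  - congr integral; apply/seteqP; split => t /=; rewrite !in_itv/=.
      move=> /andP[xt tz]; have [ty|yt] := leP t y.
        by left; apply/andP.
      by right; apply/andP.
    move=> [|]/andP[h1 h2]; apply/andP; split => //; first exact: le_trans yz.
    exact: le_lt_trans h1.
  - exact: mEg.
  - by move=> *; rewrite lee_fin.
  - apply/disj_set2P; rewrite -subset0 => t [] /=;
      rewrite !in_itv/= => /andP[_ ty] /andP[yt _].
    by move: (lt_le_trans yt ty); rewrite ltxx.
move: XE; rewrite (splitE (a + s) b)// (splitE a (a + s))//.
have int0 x y : (0 <= \int[leb]_(t in `]x, y]) (g t)%:E)%E.
  by apply: integral_ge0 => t _; rewrite lee_fin.
have X0 : (0 <= X)%E by apply: integral_ge0.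
have /andP[M1 M2] := integral_nonincreasing_bounds asb.
have /andP[U1 U2] := integral_nonincreasing_bounds aas.
have /andP[V1 V2] := integral_nonincreasing_bounds bbs.
have [r -> _] := ge0_fin (int0 _ _) M2.
have [u uE _] := ge0_fin (int0 _ _) U2; rewrite uE in U1 U2 *.
have [v vE _] := ge0_fin (int0 _ _) V2; rewrite vE in V1 V2 *.
case: X X0 => [x| |] // _ []; rewrite !lee_fin in U1 U2 V1 V2 *.
have := g0 (b + s); nra.
Qed.

(* No differentiation theorem is needed: Fatou's lemma makes the lower
   difference quotients of [g] finite almost everywhere, where [e] bounds all of
   them, and the integrals of the difference quotients telescope. *)
Lemma nonincreasing_le_integral (e : R -> \bar R) (a b : R) :
  measurable_fun setT e -> (forall t, 0 <= e t)%E ->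
  (forall t, 0 <= t ->
    (exists M, forall n0, exists2 n, (n0 <= n)%N &
       g t - g (t + n.+1%:R^-1) <= M * n.+1%:R^-1) ->
    forall s, 0 < s -> ((g t - g (t + s))%:E <= s%:E * e t)%E) ->
  0 < a -> a < b ->
  ((g a - g b)%:E <= \int[leb]_(t in `[0%R, +oo[) e t)%E.
Proof.
(* Starting at a' < a gives g(a' + d n) >= g(a) for small [d n], even where [g] jumps at [a]. *)
move=> me e0 He a_gt0 ab; pose a' := a / 2; pose d (n : nat) : R := n.+1%:R^-1.
have a'0 : 0 <= a' by rewrite /a'; lra.
have a'a : a' < a by rewrite /a'; lra.
have d0 n : 0 < d n by rewrite invr_gt0.
pose h n (t : R) : \bar R := ((d n)^-1 * (g t - g (t + d n)))%:E.
have incr0 n t : 0 <= g t - g (t + d n) by rewrite subr_ge0 gni// lerDl ltW.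
have h0 n t : (0 <= h n t)%E.
  by rewrite lee_fin mulr_ge0// invr_ge0 ltW.
have mincr n : measurable_fun setT (fun t => (g t - g (t + d n))%:E).
  apply/measurable_EFinP; apply: measurable_funB => //.
  exact: (measurableT_comp mg (@measurable_addr R (d n))).
have hE n : h n = fun t => (((d n)^-1)%:E * (g t - g (t + d n))%:E)%E by [].
have mh n : measurable_fun setT (h n) by rewrite hE; exact: measurable_funeM.
have inth n : a' + d n <= b ->
    ((g (a' + d n) - g b)%:E <= \int[leb]_(t in `]a', b]) h n t <= (g a')%:E)%E.
  move=> adb; have /andP[I1 I2] := integral_increment_bounds (ltW (d0 n)) adb.
  rewrite hE ge0_integralZl//; last 3 first.
  - by apply: measurable_funTS; exact: mincr.
  - by move=> t _; rewrite lee_fin.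
  - by rewrite lee_fin invr_ge0 ltW.
  have dE (x : R) : x%:E = (((d n)^-1)%:E * (d n * x)%:E)%E.
    by rewrite -EFinM mulKf ?lt0r_neq0.
  rewrite (dE (g a')) (dE (g (a' + d n) - g b)).
  by rewrite !lee_pmul2l ?lte_fin ?invr_gt0// I1.
have dsmall (r : R) : 0 < r -> \forall n \near \oo, d n < r.
  by move=> r0; exact: (near_infty_natSinv_lt (PosNum r0)).
have lim0 t : (0 <= limn_einf (h ^~ t))%E.
  rewrite limn_einf_lim; apply: lime_ge; first exact: is_cvg_einfs.
  by apply: nearW => k; apply: le_ereal_inf_tmp => _ [i _ <-].
have mlim : measurable_fun setT (fun t => limn_einf (h ^~ t)).
  apply: measurableT_comp => //; apply: measurable_fun_limn_esup => k.
  exact: measurableT_comp.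
have mab : measurable (`]a', b]%classic : set (measurableTypeR R)).
  exact: measurable_itv.
have fin : (\int[leb]_(t in `]a', b]) limn_einf (h ^~ t) < +oo)%E.
  apply: (@le_lt_trans _ _ (g a')%:E); last by rewrite ltry.
  apply: (le_trans (@fatou _ _ R leb _ mab h _ _)) => //.
    by move=> n; apply: measurable_funTS; exact: mh.
  apply: limn_einf_le; have ba' : 0 < b - a' by lra.
  near=> n.
  have dn : d n < b - a' by near: n; exact: dsmall.
  by have /andP[] := inth n ltac:(lra).
have int : leb.-integrable `]a', b]%classic (fun t => limn_einf (h ^~ t)).
  apply/integrableP; split; first by apply: measurable_funTS; exact: mlim.
  by under eq_integral do rewrite gee0_abs//.
have aaa' : 0 < a - a' by lra.
have [n dn] : exists n, d n < a - a'.
  by have [N _ H] := dsmall _ aaa'; exists N; apply: H => /=.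
have /inth/andP[In _] : a' + d n <= b by lra.
apply: (@le_trans _ _ (g (a' + d n) - g b)%:E).
  by rewrite lee_fin lerD2r gni//; lra.
apply: (le_trans In); apply: (@le_trans _ _ (\int[leb]_(t in `]a', b]) e t)%E).
  apply: ae_ge0_le_integral => //.
  - by apply: measurable_funTS; exact: mh.
  - by apply: measurable_funTS; exact: me.
  have tf := integrable_ae mab int.
  apply: (ae_imp tf) => t tfin tab.
  have t0 : 0 <= t.
    by move: tab; rewrite /= in_itv/= => /andP[/ltW H _]; exact: le_trans H.
  move: (tfin tab); rewrite ge0_fin_numE// => tlt.
  have {}tfin := tfin tab.
  suff M : exists M, forall n0, exists2 n, (n0 <= n)%N &
      g t - g (t + d n) <= M * d n.
    rewrite /h mulrC EFinM lee_pdivrMr// muleC; exact: He.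
  (* The finite lower limit plus 1 bounds infinitely many quotients. *)
  exists (fine (limn_einf (h ^~ t)) + 1) => n0; apply: contrapT => H.
  suff : ((fine (limn_einf (h ^~ t)) + 1)%:E <= limn_einf (h ^~ t))%E.
    by rewrite -{2}(fineK tfin) lee_fin gerDl lt_geF.
  rewrite [leRHS]limn_einf_lim; apply: lime_ge; first exact: is_cvg_einfs.
  exists n0 => // k /= n0k; apply: le_ereal_inf_tmp => _ [i /= ki <-].
  rewrite lee_fin leNgt; apply/negP => Hi; apply: H; exists i.
    exact: leq_trans ki.
  rewrite -ler_pdivrMr; last exact: d0.
  by rewrite mulrC ltW.
apply: (@ge0_subset_integral _ _ _ leb) => //.
  by apply: measurable_funTS; exact: me.
move=> t /=; rewrite !in_itv/= => /andP[/ltW H _]; rewrite andbT.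
exact: le_trans H.
Unshelve. all: by end_near. Qed.

End monotone_functions.

(** * Signed powers in L^2 *)

Section signed_power_L2.
Context d (T : measurableType d) (R : realType).
Variable mu : {measure set T -> \bar R}.

Lemma signed_powR0 (q : R) : signed_powR q 0 = 0.
Proof. by rewrite /signed_powR sgr0 mul0r. Qed.

Lemma signed_powR_sqr (q a : R) : 0 < q -> signed_powR q a ^+ 2 = `|a| `^
    (2 * q).
Proof.
move=> q0; have [->|a0] := eqVneq a 0.
  by rewrite signed_powR0 normr0 powR0 ?expr0n// mulf_neq0// gt_eqF.
rewrite /signed_powR exprMn sqr_sg a0 mul1r mulrC powRrM.
by rewrite powR_mulrn// powR_ge0.
Qed.

Lemma signed_powR_Lfun2 (q : R) f : 0 < q -> f \in Lfun mu (2 * q)%:E ->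
  (fun x => signed_powR q (f x)) \in Lfun mu 2%:E.
Proof.
move=> q0 /LfunP_powR[|mf foo]; first by rewrite mulr_gt0.
apply/Lfun2P; split;
  first exact: (measurableT_comp (@measurable_signed_powR _ _) mf).
by under eq_integral do rewrite signed_powR_sqr//.
Qed.

Lemma inner_signed_powR (q : R) f : 0 < q -> f \in Lfun mu (2 * q)%:E ->
  (\int[mu]_x (`|f x| `^ (2 * q))%:E)%E =
  (inner_prod mu (fun x => signed_powR q (f x)) (fun x => signed_powR q
      (f x)))%:E.
Proof.
move=> q0 fp; rewrite -inner_prodE; last exact: signed_powR_Lfun2.
by apply: eq_integral => x _; rewrite signed_powR_sqr.
Qed.

End signed_power_L2.

(** * Decay of the L^p norm over one time step *)

Section norm_decay.
Context {R : realType} {E : pmetricType R} {d : measure_display}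
  {Omega : measurableType d}.
Variables (m : {measure set (borel E) -> \bar R}) (X : hunt_process E Omega)
  (B : nat -> set E).
Hypothesis HB : precompact_base B.
Hypothesis symX : symmetric_process m X.
Local Notation Rs := (Rsemigroup X).
Variable q : R.
Hypothesis q1 : 1 < q.
Local Notation v f := (fun x => signed_powR q (f x)).
Local Notation p := (2 * q).

Let q0 : 0 < q. Proof. exact: lt_trans q1. Qed.
Let p1 : 1 <= p. Proof. by have := q1; lra. Qed.
Let p0 : 0 < p. Proof. by have := q1; lra. Qed.

(** The p-th power of the L^p norm, as a real number. *)
Definition Lp_power (f : borel E -> R) : R := inner_prod m (v f) (v f).
Local Notation N := Lp_power.

Lemma Lp_powerE f : f \in Lfun m p%:E ->
  (\int[m]_x (`|f x| `^ p)%:E)%E = (N f)%:E.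
Proof. exact: inner_signed_powR. Qed.

Lemma Lp_power_ae f g : measurable_fun setT f -> measurable_fun setT g ->
  f = g %[ae m] -> N f = N g.
Proof.
move=> mf mg fg.
have mv (h : borel E -> R) : measurable_fun setT h -> measurable_fun setT (v h).
  by move=> mh; exact: (measurableT_comp (@measurable_signed_powR _ _) mh).
have vfg : v f = v g %[ae m].
  by apply: (ae_imp fg) => x H xT; congr signed_powR; exact: H.
have mvf := mv _ mf; have mvg := mv _ mg.
transitivity (inner_prod m (v g) (v f)).
  exact: (inner_prod_ae mvf mvg mvf vfg).
rewrite (inner_prodC m); exact: (inner_prod_ae mvf mvg mvg vfg).
Qed.

(** The integral a of P_s|f|^p can fall short of N f, since mass may be lost. The variance bounds
    give the estimate with a in place of N f; the loss N f - a is then added with coefficient 1,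
    which lies between 1/2 and 4q. *)
Lemma Lp_power_decay s f : 0 <= s -> f \in Lfun m p%:E ->
  2^-1 * semigroup_defect m X (v f) (s + s) <= N f - N (Rs s f) <=
  4 * q * semigroup_defect m X (v f) (s + s).
Proof.
move=> s0 fp; have vL := signed_powR_Lfun2 q0 fp.
have mf := Lfun_measurable fp.
have RsL := Rsemigroup_Lfun HB symX s0 p1 fp.
have mRf := Lfun_measurable RsL.
have le12 : 1 <= 2 :> R by lra.
have RvL := Rsemigroup_Lfun HB symX s0 le12 vL.
have mRv := Lfun_measurable RvL.
pose h := fun x => `|f x| `^ p; pose A := Rs s h.
have mh : measurable_fun setT h by exact: measurable_norm_powR.
have mA : measurable_fun setT A by exact: (measurable_Rsemigroup X HB s0 mh).
have A0 x : 0 <= A x.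
  rewrite /A RsemigroupE; apply: Rintegral_ge0 => w _.
  by case: (X s w) => //= y; exact: powR_ge0.
have hE x : `|h x| `^ 1 = h x by rewrite powRr1// ger0_norm// powR_ge0.
have intA : (\int[m]_x (A x)%:E <= (N f)%:E)%E.
  rewrite -Lp_powerE//.
  have := Rsemigroup_integral_le HB symX s0 (lexx 1) mh.
  rewrite -(_ : (fun x => (A x)%:E) = (fun x => (`|A x| `^ 1)%:E)); last first.
    by apply/funext => x; rewrite powRr1// ger0_norm.
  move=> H; apply: (le_trans H); apply: ge0_le_integral_nomeas => x _.
    by rewrite lee_fin powR_ge0.
  by rewrite hE.
have [a aE] : exists a, (\int[m]_x (A x)%:E = a%:E)%E.
  have : (0 <= \int[m]_x (A x)%:E)%E.
    by apply: integral_ge0 => x _; rewrite lee_fin.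
  by case: (\int[m]_x _)%E intA => [r| |]// _ _; exists r.
rewrite aE lee_fin in intA.
(* The two variance bounds rearranged without subtraction, so that all integrands are
   nonnegative. *)
have pw : {ae m, forall x,
    2 * `|Rs s f x| `^ p <= A x + Rs s (v f) x ^+ 2 /\
    A x + 4 * q * Rs s (v f) x ^+ 2 <= 4 * q * A x + `|Rs s f x| `^ p}.
  apply: (ae_imp (semigroup_powR_ae_fin HB symX s0 p0 fp)) => x xfin.
  have mU := measurable_oapp_hunt_real X s0 mf.
  have := powR_variance_bounds (P := start_law X (Some x)) mU q1 xfin.
  have -> : \int[start_law X (Some x)]_w (`|oapp f 0 (X s w)| `^ p) = A x.
    rewrite /A RsemigroupE; apply: eq_Rintegral => w _.
    by case: (X s w) => //=; rewrite normr0 powR0// gt_eqF.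
  have -> : \int[start_law X (Some x)]_w signed_powR q (oapp f 0 (X s w)) =
      Rs s (v f) x.
    rewrite RsemigroupE; apply: eq_Rintegral => w _.
    by case: (X s w) => //=; rewrite signed_powR0.
  by rewrite -RsemigroupE => /andP[]; split; lra.
have mb : measurable_fun setT (fun x => `|Rs s f x| `^ p).
  exact: measurable_norm_powR.
have mc : measurable_fun setT (fun x => Rs s (v f) x ^+ 2).
  exact: measurable_funX.
have bE := Lp_powerE RsL; have cE := inner_prodE RvL.
have q40 : 0 <= 4 * q by have := q1; lra.
have mAE : measurable_fun setT (fun x => (A x)%:E) by exact/measurable_EFinP.
have mbE : measurable_fun setT (fun x => (`|Rs s f x| `^ p)%:E).
  exact/measurable_EFinP.
have mcE : measurable_fun setT (fun x => (Rs s (v f) x ^+ 2)%:E).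
  exact/measurable_EFinP.
have A0E x : (0 <= (A x)%:E)%E by rewrite lee_fin.
have b0E x : (0 <= (`|Rs s f x| `^ p)%:E)%E by rewrite lee_fin powR_ge0.
have c0E x : (0 <= (Rs s (v f) x ^+ 2)%:E)%E by rewrite lee_fin sqr_ge0.
have e1 : 2 * N (Rs s f) <= a + inner_prod m (Rs s (v f)) (Rs s (v f)).
  rewrite -lee_fin EFinM (EFinD a) -bE -aE -cE -ge0_integralZl//.
  rewrite -ge0_integralD//; apply: ae_ge0_le_integral => //.
  - exact: measurable_funeM.
  - by move=> x _; rewrite adde_ge0.
  - exact: emeasurable_funD.
  by apply: (ae_imp pw) => x [H _] _; rewrite -EFinM -EFinD lee_fin.
have e2 : a + 4 * q * inner_prod m (Rs s (v f)) (Rs s (v f)) <=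
    4 * q * a + N (Rs s f).
  rewrite -lee_fin (EFinD a) (EFinD (4 * q * a)) (EFinM (4 * q)) (EFinM
      (4 * q)).
  rewrite -bE -aE -cE -!ge0_integralZl//.
  have Z0 (y : \bar R) : (0 <= y)%E -> (0 <= (4 * q)%:E * y)%E.
    by move=> y0; rewrite mule_ge0// lee_fin.
  rewrite -!ge0_integralD//; try by move=> x _; exact: Z0.
  - apply: ae_ge0_le_integral => //.
    + by move=> x _; rewrite adde_ge0// Z0.
    + by apply: emeasurable_funD => //; exact: measurable_funeM.
    + by move=> x _; rewrite adde_ge0// Z0.
    + by apply: emeasurable_funD => //; exact: measurable_funeM.
    by apply: (ae_imp pw) => x [_ H] _; rewrite -!EFinM -!EFinD lee_fin.
  - exact: measurable_funeM.
  - exact: measurable_funeM.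
rewrite (semigroup_defect_half HB symX s0 vL) -/(Lp_power f).
move: e1 e2 intA => {pw}; move: (N (Rs s f)) (N f) (inner_prod _ _ _) => Y Z I.
have := q1; nra.
Qed.

End norm_decay.

(* Tonelli's theorem asks for the sigma-finiteness of [m] as a structure. *)
Section sigma_finite_alias.
Context d (T : measurableType d) (R : realType) (m : {measure set T -> \bar R}).

Definition sigma_finite_alias (_ : sigma_finite setT m) : set T -> \bar R := m.

HB.instance Definition _ h := Measure.on (sigma_finite_alias h).
HB.instance Definition _ h :=
  @Measure_isSigmaFinite.Build _ _ _ (sigma_finite_alias h) h.

End sigma_finite_alias.

Section radon_sigma_finite.
Context {R : realType} {E : pmetricType R}.

Lemma radon_sigma_finite (m : {measure set (borel E) -> \bar R})
    (B : nat -> set E) :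
  precompact_base B -> radon m -> sigma_finite setT m.
Proof.
move=> [oB cB baseB] [mK _]; exists B.
  by apply/seteqP; split => // x _; have [n [Bx _]] := baseB setT x openT I;
    exists n.
move=> n; split; first exact: (@open_measurable_borel E).
apply: le_lt_trans (mK _ (cB n)); apply: le_measure; rewrite ?inE.
- exact: (@open_measurable_borel E).
- rewrite -[closure _]setCK; apply: measurableC;
    apply: (@open_measurable_borel E).
  by apply: closed_openC; exact: closed_closure.
- exact: subset_closure.
Qed.

End radon_sigma_finite.

(* What remains after half of the p-th power of the norm has been absorbed, by
   Young's inequality with weight 1/(2C) where C = 64 q^3. *)
Definition square_constant (R : realType) (q : R) : R :=
  2 * (64 * q ^+ 3) * ((2 * (64 * q ^+ 3))^-1) `^ (1 - q).

(** * The square function estimate for a fixed f *)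

Section square_function_bound.
Context {R : realType} {E : pmetricType R} {d : measure_display}
  {Omega : measurableType d}.
Variables (m : {measure set (borel E) -> \bar R}) (X : hunt_process E Omega)
  (B : nat -> set E).
Hypotheses (HB : precompact_base B) (symX : symmetric_process m X)
  (radm : radon m).
Variables (D : set (borel E -> R)) (F : (borel E -> R) -> (borel E -> R) -> R).
Hypotheses (dirF : dirichlet_form m D F) (regF : regular_form m D F)
  (assF : associated m X D F).
Variables (J : {measure set (borel E * borel E) -> \bar R})
  (Jk : R.-ker (borel E) ~> (borel E)).
Hypotheses (symJ : jump_symmetric J) (kerJ : jump_kernel m J Jk)
  (pureJ : pure_jump m D F J).
Variables (q : R) (f : borel E -> R).
Hypotheses (q1 : 1 < q) (fp : f \in Lfun m (2 * q)%:E).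
Local Notation Rs := (Rsemigroup X).
Local Notation v u := (fun x => signed_powR q (u x)).
Local Notation k := (semigroup_defect m X).
Local Notation N := (Lp_power m q).
Local Notation leb := (@lebesgue_measure R).

Let q0 : 0 < q. Proof. exact: lt_trans q1. Qed.
Let p1 : 1 <= 2 * q. Proof. by have := q1; lra. Qed.
Let mf : measurable_fun setT f := Lfun_measurable fp.

(** Constant for negative times, so that its norm is nonincreasing on the whole line. *)
Definition evolution (t : R) : borel E -> R := Rs (Num.max t 0) f.
Local Notation u := evolution.

Let max0 (t : R) : 0 <= Num.max t 0. Proof. by rewrite le_max lexx orbT. Qed.

Lemma evolution_ge0E t : 0 <= t -> u t = Rs t f.
Proof. by move=> t0; rewrite /evolution max_l. Qed.

Lemma evolution_Lfun t : u t \in Lfun m (2 * q)%:E.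
Proof. exact: (Rsemigroup_Lfun HB symX (max0 t) p1 fp). Qed.

Definition evolution_norm (t : R) : R := N (u t).
Local Notation g := evolution_norm.

Lemma evolution_norm_decay t s : 0 <= t -> 0 <= s ->
  2^-1 * k (v (u t)) (s + s) <= g t - g (t + s) <= 4 * q * k (v (u t)) (s + s).
Proof.
move=> t0 s0; have -> : g (t + s) = N (Rs s (u t)).
  have st := addr_ge0 s0 t0; have uL := Rsemigroup_Lfun HB symX t0 p1 fp.
  rewrite (addrC t s) /evolution_norm (evolution_ge0E st) (evolution_ge0E t0).
  have stL := Rsemigroup_Lfun HB symX st p1 fp.
  have suL := Rsemigroup_Lfun HB symX s0 p1 uL.
  have := Lp_power_ae q (Lfun_measurable stL) (Lfun_measurable suL); apply.
  exact: (Rsemigroup_add HB symX s0 t0 p1 fp).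
exact: (Lp_power_decay HB symX q1 s0 (evolution_Lfun t)).
Qed.

Let vL2 t : v (u t) \in Lfun m 2%:E.
Proof. exact: (signed_powR_Lfun2 q0 (evolution_Lfun t)). Qed.

Lemma evolution_norm_noninc : nonincreasing_fun g.
Proof.
move=> x y xy; pose s := Num.max y 0 - Num.max x 0.
have s0 : 0 <= s by rewrite subr_ge0 ge_max max0 andbT le_max xy.
have gE z : g z = g (Num.max z 0).
  by rewrite /evolution_norm /evolution (max_l (max0 z)).
have /andP[H _] := evolution_norm_decay (max0 x) s0.
rewrite (gE y) (gE x) -subr_ge0.
rewrite (_ : Num.max y 0 = Num.max x 0 + s); last by rewrite /s addrC subrK.
apply: le_trans H; rewrite mulr_ge0// ?invr_ge0//.
by apply: (semigroup_defect_ge0 HB symX _ (vL2 _)); rewrite addr_ge0.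
Qed.

Lemma evolution_norm_ge0 t : 0 <= g t.
Proof. exact: inner_prod_ge0. Qed.

(** The lower decay bound yields k(2r) <= 2Mr for arbitrarily small r = 1/(n+1). One such r < s/2
    and [semigroup_defect_ratio] carry this to time s at the price of doubling the slope, since s +
    2r <= 2s. *)
Lemma evolution_domain t : 0 <= t ->
  (exists M, forall n0, exists2 n, (n0 <= n)%N &
     g t - g (t + n.+1%:R^-1) <= M * n.+1%:R^-1) -> D (v (u t)).
Proof.
move=> t0 [M HM].
apply: (domain_of_defect_bound HB symX assF (vL2 t) (M := 2 * M)) => s s0.
have [n0 _ Hn0] := near_infty_natSinv_lt (PosNum (divr_gt0 s0 (ltr0Sn R 1))).
have [n n0n Hn] := HM n0; have {Hn0} := Hn0 _ n0n; rewrite /= => rs.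
move: Hn rs; set r : R := n.+1%:R^-1 => Hn rs.
have r0 : 0 < r by rewrite invr_gt0.
have /andP[H _] := evolution_norm_decay t0 (ltW r0).
have krr : k (v (u t)) (r + r) <= (2 * M) * r.
  by move: {H Hn}(le_trans H Hn); move: (k _ _) => K; lra.
have r20 : 0 < r + r by rewrite addr_gt0.
have := semigroup_defect_ratio HB symX r20 (ltW s0) (vL2 t).
have := semigroup_defect_ge0 HB symX (ltW r20) (vL2 t).
move: krr {H Hn}; move: (k _ _) (k _ _) => K A AM A0 KA.
have : K * (r + r) <= (s + (r + r)) * (2 * M * r).
  by apply: (le_trans KA); rewrite ler_wpM2l//; lra.
have -> : (s + (r + r)) * (2 * M * r) = ((s + (r + r)) * M) * (r + r) by ring.
rewrite ler_pM2r// => /le_trans; apply.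
have M0 : 0 <= M by rewrite -(pmulr_lge0 _ r0); lra.
have -> : 2 * M * s = (s + s) * M by ring.
by rewrite ler_wpM2r//; lra.
Qed.

(* Half the integral over [jump_support] only: contrary to Gamma[P_t f](x), it
   is jointly measurable in [t] and [x]. *)
Definition truncated_gamma (t : R) (x : borel E) : \bar R :=
  (2^-1%:E * \int[Jk x]_(y in xsection (jump_support B J Jk) x)
     ((u t y - u t x) ^+ 2)%:E)%E.
Local Notation Gam := truncated_gamma.

Lemma truncated_gamma_ge0 t x : (0 <= Gam t x)%E.
Proof.
rewrite mule_ge0 ?lee_fin ?invr_ge0//.
by apply: integral_ge0 => y _; rewrite lee_fin sqr_ge0.
Qed.

Definition energy_density (t : R) : \bar R :=
  (\int[m]_x ((`|u t x| `^ (2 * q - 2))%:E * Gam t x))%E.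

Lemma measurable_evolution2 :
  measurable_fun setT (fun z : R * borel E => u z.1 z.2).
Proof. exact: (measurable_Rsemigroup2 X HB mf). Qed.

Lemma measurable_truncated_gamma2 :
  measurable_fun setT (fun z : R * borel E => Gam z.1 z.2).
Proof.
apply: measurable_funeM.
pose h (z : (R * borel E) * borel E) : \bar R :=
  ((u z.1.1 z.2 - u z.1.1 z.1.2) ^+ 2)%:E.
apply: (measurable_jump_integral HB kerJ (phi := snd) (h := h)) => //.
- apply/measurable_EFinP; apply: measurable_funX; apply: measurable_funB.
    apply: (measurableT_comp measurable_evolution2
      (g := fun z : (R * borel E) * borel E => (z.1.1, z.2))).
    apply: measurable_fun_pair => //.
    exact: (measurableT_comp measurable_fst measurable_fst).
  apply: (measurableT_comp measurable_evolution2
      (g := fun z : (R * borel E) * borel E => z.1)).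
  exact: measurable_fst.
- by move=> z; rewrite lee_fin sqr_ge0.
Qed.

Lemma measurable_truncated_gamma t : measurable_fun setT (Gam t).
Proof.
exact: (@measurable_fun_pair2 _ _ _ _ _ _ (fun z : R * borel E => Gam z.1 z.2) t
  measurable_truncated_gamma2).
Qed.

Lemma evolution_norm_rate t s : 0 <= t -> 0 < s ->
  (exists M, forall n0, exists2 n, (n0 <= n)%N &
     g t - g (t + n.+1%:R^-1) <= M * n.+1%:R^-1) ->
  ((g t - g (t + s))%:E <= s%:E * ((64 * q ^+ 3)%:E * energy_density t))%E.
Proof.
move=> t0 s0 HM; have Dv := evolution_domain t0 HM.
have /andP[_ H] := evolution_norm_decay t0 (ltW s0).
have ss0 : 0 < s + s by rewrite addr_gt0.
have Hk := semigroup_defect_le_form HB symX dirF assF Dv ss0.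
have He := signed_power_energy_le HB dirF regF symJ kerJ pureJ q1
  (Lfun_measurable (evolution_Lfun t)) Dv.
have mGam := measurable_truncated_gamma t.
have Gam0 := truncated_gamma_ge0 t.
have mu := Lfun_measurable (evolution_Lfun t).
have e_ge0 : (0 <= energy_density t)%E.
  by apply: integral_ge0 => x _; rewrite mule_ge0// lee_fin powR_ge0.
have E2 : (\int[m]_x ((`|u t x| `^ (2 * q - 2))%:E *
    \int[Jk x]_(y in xsection (jump_support B J Jk) x)
      ((u t y - u t x) ^+ 2)%:E) = 2%:E * energy_density t)%E.
  rewrite -ge0_integralZl//; last 2 first.
  - apply: emeasurable_funM => //; apply/measurable_EFinP.
    exact: measurable_norm_powR.
  - by move=> x _; rewrite mule_ge0// lee_fin powR_ge0.
  apply: eq_integral => x _; rewrite muleCA; congr (_ * _)%E.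
  by rewrite /truncated_gamma muleA -EFinM divff// mul1e.
rewrite {}E2 in He.
have qs0 : 0 <= 4 * q * (s + s) by rewrite mulr_ge0 ?ltW// mulr_gt0.
have Hg : g t - g (t + s) <= 4 * q * (s + s) * F (v (u t)) (v (u t)).
  by apply: (le_trans H); rewrite -[leRHS]mulrA ler_pM2l// mulr_gt0.
apply: (@le_trans _ _ ((4 * q * (s + s))%:E * (F (v (u t)) (v (u t)))%:E)%E).
  by rewrite -EFinM lee_fin.
apply: (le_trans (lee_wpmul2l _ He)); first by rewrite lee_fin.
rewrite !muleA -!EFinM.
(* 4q comes from the variance bound, s + s from the doubled time, 4q^2 from the energy of a signed
   power, and 2 undoes the half in [truncated_gamma]. *)
rewrite (_ : 4 * q * (s + s) * (4 * q ^+ 2) * 2 = s * (64 * q ^+ 3))//.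
by ring.
Qed.

Lemma measurable_energy_density : measurable_fun setT energy_density.
Proof.
have mSF := radon_sigma_finite HB radm.
pose m' : {sigma_finite_measure set (borel E) -> \bar R} :=
  sigma_finite_alias mSF.
pose h (z : R * borel E) : \bar R :=
  ((`|u z.1 z.2| `^ (2 * q - 2))%:E * Gam z.1 z.2)%E.
have mh : measurable_fun setT h.
  apply: emeasurable_funM; last exact: measurable_truncated_gamma2.
  apply/measurable_EFinP; exact: (measurable_norm_powR _ measurable_evolution2).
have h0 z : (0 <= h z)%E.
  by rewrite mule_ge0// ?truncated_gamma_ge0// lee_fin powR_ge0.
exact: (measurable_fun_fubini_tonelli_F (m2 := m') h mh h0).
Qed.

Local Notation S t := (semigroup X (Num.max t 0) (Gam t)).

Lemma measurable_semigroup_gamma2 :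
  measurable_fun setT (fun z : R * borel E => S z.1 z.2).
Proof.
apply: (measurable_semigroup2 X HB (G := fun z => Gam z.1 z.2)).
  exact: measurable_truncated_gamma2.
by move=> z; exact: truncated_gamma_ge0.
Qed.

Lemma semigroup_gamma_ge0 t x : (0 <= S t x)%E.
Proof. by apply: semigroup_ge0 => y; exact: truncated_gamma_ge0. Qed.

(* The pointwise Jensen inequality [|P_t f|^(p-2) <= P_t |f|^(p-2)] used here is
   what forces [p >= 3]. *)
Lemma energy_integral_le : 1 <= 2 * q - 2 ->
  (\int[leb]_(t in `[0%R, +oo[) energy_density t <=
   \int[m]_x ((`|f x| `^ (2 * q - 2))%:E *
     \int[leb]_(t in `[0%R, +oo[) S t x))%E.
Proof.
move=> q32; pose a x : \bar R := (`|f x| `^ (2 * q - 2))%:E.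
have a0 x : (0 <= a x)%E by rewrite lee_fin powR_ge0.
have ma : measurable_fun setT a.
  by apply/measurable_EFinP; exact: measurable_norm_powR.
apply: (@le_trans _ _
    (\int[leb]_(t in `[0%R, +oo[) \int[m]_x (a x * S t x))%E).
  apply: ge0_le_integral_nomeas => [t _|t /=].
    by apply: integral_ge0 => x _; rewrite mule_ge0// ?truncated_gamma_ge0//
      lee_fin powR_ge0.
  rewrite in_itv/= andbT => t0; rewrite (max_l t0).
  rewrite -(symX t0 ma (measurable_truncated_gamma t) a0
      (truncated_gamma_ge0 t)).
  apply: ge0_le_integral_nomeas => x _.
    by rewrite mule_ge0// ?truncated_gamma_ge0// lee_fin powR_ge0.
  apply: lee_wpmul2r; first exact: truncated_gamma_ge0.
  by rewrite evolution_ge0E//; exact: (Rsemigroup_powR_le X x t0 q32 mf).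
pose I : set R := `[0%R, +oo[%classic.
have mI : measurable (I : set (measurableTypeR R)) by exact: measurable_itv.
(* The half-line becomes an indicator, Tonelli's theorem being applied on the whole product. *)
pose c (t : R) : \bar R := (\1_I t)%:E.
have c0 t : (0 <= c t)%E by rewrite lee_fin.
have mc : measurable_fun setT c by apply/measurable_EFinP.
have aS0 t x : (0 <= a x * S t x)%E by rewrite mule_ge0// semigroup_gamma_ge0.
pose h (z : R * borel E) : \bar R := (c z.1 * (a z.2 * S z.1 z.2))%E.
have h0 z : (0 <= h z)%E by rewrite mule_ge0.
have mh : measurable_fun setT h.
  apply: emeasurable_funM; first exact: (measurableT_comp mc measurable_fst).
  apply: emeasurable_funM; first exact: (measurableT_comp ma measurable_snd).
  exact: measurable_semigroup_gamma2.
have indE (phi : R -> \bar R) :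
    (\int[leb]_(t in I) phi t = \int[leb]_t (c t * phi t))%E.
  rewrite integral_mkcond; apply: eq_integral => t _; rewrite patchE /c indicE.
  by case: ifPn => _; rewrite ?mul1e ?mul0e.
have mS2 x : measurable_fun setT (fun t : R => S t x).
  exact: (@measurable_fun_pair1 _ _ _ _ _ _ _ x measurable_semigroup_gamma2).
have mSF := radon_sigma_finite HB radm.
pose m' : {sigma_finite_measure set (borel E) -> \bar R} :=
  sigma_finite_alias mSF.
have fub := fubini_tonelli (m1 := leb) (m2 := m') h mh h0.
have -> : (\int[leb]_(t in `[0%R, +oo[) \int[m]_x (a x * S t x) =
    \int[leb]_t \int[m]_x h (t, x))%E.
  rewrite indE; apply: eq_integral => t _; rewrite -ge0_integralZl//.
  apply: emeasurable_funM => //.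
  exact: (@measurable_fun_pair2 _ _ _ _ _ _ _ t measurable_semigroup_gamma2).
rewrite [leLHS]fub; apply: ge0_le_integral_nomeas => x _.
  by apply: integral_ge0 => t _.
have -> : (\int[leb]_t h (t, x) = \int[leb]_(t in I) (a x * S t x))%E.
  by rewrite indE.
rewrite ge0_integralZl//; last by move=> t _; exact: semigroup_gamma_ge0.
by apply: measurable_funTS; exact: mS2.
Qed.

Let sub_integral d1 (T : measurableType d1) (mu : {measure set T -> \bar R})
    (A C : set T) (h : T -> \bar R) : A `<=` C -> (forall x, 0 <= h x)%E ->
  (\int[mu]_(x in A) h x <= \int[mu]_(x in C) h x)%E.
Proof.
move=> AC h0; rewrite integral_mkcond [leRHS]integral_mkcond.
apply: ge0_le_integral_nomeas => x _; rewrite !patchE; first by case: ifP.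
case: ifPn => [/set_mem/AC/mem_set ->//|_]; by case: ifP.
Qed.

(** The truncation decreases the carré du champ, which is the harmless direction: H stands on the
    larger side. *)
Lemma truncated_gamma_le t x : 0 <= t ->
  (Gam t x <= carre_du_champ Jk (Rs t f) x)%E.
Proof.
move=> t0; apply: lee_wpmul2l; first by rewrite lee_fin invr_ge0.
rewrite evolution_ge0E//; apply: sub_integral => [y|y].
  rewrite /xsection /= => /set_mem /(@jump_support_offdiag _ _ B J Jk
      (x, y)) /=.
  by rewrite /offdiag /= eq_sym => /eqP.
by rewrite lee_fin sqr_ge0.
Qed.

Definition gamma_integral (x : borel E) : \bar R :=
  (\int[leb]_(t in `[0%R, +oo[) S t x)%E.
Local Notation G := gamma_integral.

Lemma gamma_integral_ge0 x : (0 <= G x)%E.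
Proof. by apply: integral_ge0 => t _; exact: semigroup_gamma_ge0. Qed.

Lemma measurable_gamma_integral : measurable_fun setT G.
Proof.
pose I : set R := `[0%R, +oo[%classic.
have mI : measurable (I : set (measurableTypeR R)) by exact: measurable_itv.
pose h (z : R * borel E) : \bar R := ((\1_I z.1)%:E * S z.1 z.2)%E.
have h0 z : (0 <= h z)%E by rewrite mule_ge0 ?lee_fin// semigroup_gamma_ge0.
have mh : measurable_fun setT h.
  apply: emeasurable_funM; last exact: measurable_semigroup_gamma2.
  by apply/measurable_EFinP; exact: (measurableT_comp _ measurable_fst).
have := measurable_fun_fubini_tonelli_G (m1 := leb) h mh h0;
  congr measurable_fun.
apply/funext => x; rewrite /fubini_G /gamma_integral [RHS]integral_mkcond.
apply: eq_integral => t _; rewrite patchE /h /= indicE.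
by case: ifPn => _; rewrite ?mul1e ?mul0e.
Qed.

Lemma gamma_integral_le x :
  (G x `^ q <= `|square_function X Jk f x| `^ (2 * q))%E.
Proof.
have q20 : 0 <= q by rewrite ltW.
rewrite /square_function gee0_abs; last exact: poweR_ge0.
rewrite -poweRrM mulrA mulVf// mul1r.
have GI : (G x <= \int[leb]_(t in `[0%R, +oo[)
    semigroup X t (carre_du_champ Jk (Rs t f)) x)%E.
  apply: ge0_le_integral_nomeas => [t _|t /=]; first exact: semigroup_gamma_ge0.
  rewrite in_itv/= andbT => t0; rewrite (max_l t0).
  apply: (semigroup_le X x t0) => y; first exact: truncated_gamma_ge0.
  exact: truncated_gamma_le.
move: (gamma_integral_ge0 x) GI; move: (G x) (integral _ _ _) => a b a0 ab.
have b0 := le_trans a0 ab.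
by apply: gt0_ler_poweR => //; rewrite in_itv/= leey andbT.
Qed.

(** A dichotomy: if z <= l a^2, the first term alone dominates; otherwise a^2 < z/l, and the second
    term, which equals z (z/l)^(q-1), dominates. The value z = +oo is allowed because H may be
    infinite. *)
Lemma young_powR (a l : R) (z : \bar R) : 0 <= a -> 0 < l -> (0 <= z)%E ->
  ((a `^ (2 * q - 2))%:E * z <=
   l%:E * (a `^ (2 * q))%:E + (l `^ (1 - q))%:E * z `^ q)%E.
Proof.
move=> a0 l0; have q01 : 0 < q - 1 by rewrite subr_gt0.
have lq : 0 < l `^ (1 - q) by rewrite powR_gt0.
case: z => [z| |]// z0; last first.
  rewrite [X in (_ <= _ + X)%E](_ : _ = +oo%E).
    by rewrite -EFinM addey// leey.
  by rewrite poweRyr ?gt_eqF// gt0_muley// lte_fin.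
rewrite lee_fin in z0; rewrite poweR_EFin -!EFinM -EFinD lee_fin.
have aE : a `^ (2 * q - 2) = (a ^+ 2) `^ (q - 1).
  by rewrite -powR_mulrn// -powRrM; congr (_ `^ _); ring.
have aE2 : a `^ (2 * q) = a ^+ 2 * (a ^+ 2) `^ (q - 1).
  have [->|an0] := eqVneq a 0.
    by rewrite expr0n mul0r powR0// mulf_neq0// gt_eqF.
  rewrite -{1}(powRr1 (sqr_ge0 a)) -powRD.
    by rewrite -powR_mulrn// -powRrM; congr (_ `^ _); ring.
  by rewrite expf_eq0 (negbTE an0) implybT.
have zE : l `^ (1 - q) * z `^ q = z * (z / l) `^ (q - 1).
  have [->|zn0] := eqVneq z 0.
    by rewrite powR0 ?gt_eqF// mul0r mulr0.
  rewrite powRM// ?invr_ge0 ?ltW// -powR_inv1 ?ltW// -powRrM mulN1r opprB.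
  rewrite mulrA mulrC; congr (_ * _).
  rewrite -{2}(powRr1 z0) -powRD; first by congr (_ `^ _); ring.
  by rewrite zn0 implybT.
rewrite aE aE2 zE; have [zl|lz] := leP z (l * a ^+ 2).
  rewrite (@le_trans _ _ (l * (a ^+ 2 * (a ^+ 2) `^ (q - 1))))//.
    by rewrite mulrC mulrA ler_wpM2r// powR_ge0.
  by rewrite lerDl mulr_ge0// powR_ge0.
rewrite (@le_trans _ _ (z * (z / l) `^ (q - 1)))//.
  rewrite mulrC ler_wpM2l// ge0_ler_powR// ?nnegrE ?sqr_ge0 ?ltW//.
    by rewrite divr_gt0// (le_lt_trans _ lz)// mulr_ge0 ?sqr_ge0// ltW.
  by rewrite ltr_pdivlMr// mulrC.
by rewrite lerDr !mulr_ge0 ?(ltW l0) ?sqr_ge0 ?powR_ge0.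
Qed.

Lemma evolution_norm_vanish (e s : R) : strongly_stable m X (2 * q) -> 0 < e ->
  exists2 T, s < T & g T <= e.
Proof.
move=> /(_ f fp) stab e0; have p0 : 0 < 2 * q by have := q1; lra.
have r0 : 0 < e `^ (2 * q)^-1 by rewrite powR_gt0.
have : \forall t \near +oo,
    ('N[m]_(2 * q)%:E[EFin \o Rs t f] < (e `^ (2 * q)^-1)%:E)%E.
  apply: (stab [set y | (y < (e `^ (2 * q)^-1)%:E)%E]).
  apply: open_nbhs_nbhs; split; first exact: open_ereal_lt_ereal.
  by rewrite /= lte_fin.
move=> [M [_ HM]]; pose T := Num.max (Num.max M s) 0 + 1.
have mlt (x : R) : x < x + 1 by rewrite ltrDl.
have MT : M < T by rewrite (le_lt_trans _ (mlt _))// !le_max lexx.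
have sT : s < T by rewrite (le_lt_trans _ (mlt _))// !le_max lexx orbT.
have T0 : 0 <= T by rewrite (le_trans _ (ltW (mlt _)))// le_max lexx orbT.
exists T => //; have := HM _ MT.
rewrite /evolution_norm (evolution_ge0E T0).
have RL := Rsemigroup_Lfun HB symX T0 p1 fp.
rewrite -lee_fin -(Lp_powerE q1 RL) => NT.
have -> : (\int[m]_x (`|Rs T f x| `^ (2 * q))%:E =
    'N[m]_(2 * q)%:E[EFin \o Rs T f] `^ (2 * q))%E.
  by rewrite poweR_Lnorm ?gt_eqF//; apply: eq_integral => x _.
have -> : (e%:E = (e `^ (2 * q)^-1)%:E `^ (2 * q))%E.
  by rewrite poweR_EFin -powRrM mulVf ?gt_eqF// powRr1// ltW.
apply: gt0_ler_poweR; rewrite ?in_itv/= ?leey ?andbT ?Lnorm_ge0//; exact: ltW.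
Qed.

(** The rate is used between a small time s and a late time T: the small defect of v at time 0
    bounds N f - g s by e/2, and stability bounds g T by e/2. *)
Lemma Lp_power_le_energy : strongly_stable m X (2 * q) ->
  ((N f)%:E <= (64 * q ^+ 3)%:E *
    \int[leb]_(t in `[0%R, +oo[) energy_density t)%E.
Proof.
move=> stab.
have C0 : 0 <= 64 * q ^+ 3 by rewrite mulr_ge0// exprn_ge0// ltW.
have ed0 t : (0 <= energy_density t)%E.
  apply: integral_ge0 => x _.
  by rewrite mule_ge0// ?truncated_gamma_ge0// lee_fin powR_ge0.
have me := measurable_energy_density.
apply/lee_addgt0Pr => e e0.
have e2 : 0 < e / 2 by rewrite divr_gt0.
have e8q : 0 < e / 2 / (4 * q) by rewrite divr_gt0// mulr_gt0.
have vfL := signed_powR_Lfun2 q0 fp.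
have [s0 s00 Hs0] := semigroup_defect_small HB symX dirF assF vfL e8q.
pose s := s0 / 2; have s_gt0 : 0 < s by rewrite divr_gt0.
have ss : s + s = s0 by rewrite /s -splitr.
have start : N f - g s <= e / 2.
  have /andP[_ H] := Lp_power_decay HB symX q1 (ltW s_gt0) fp.
  rewrite /evolution_norm (evolution_ge0E (ltW s_gt0)); apply: (le_trans H).
  by rewrite ss mulrC -ler_pdivlMr// mulr_gt0.
have [T sT HT] := evolution_norm_vanish s stab e2.
have := @nonincreasing_le_integral _ g evolution_norm_ge0 evolution_norm_noninc
  (fun t => (64 * q ^+ 3)%:E * energy_density t)%E s T.
rewrite ge0_integralZl//; last exact: measurable_funTS.
move=> Hmain; have {Hmain} : ((g s - g T)%:E <= (64 * q ^+ 3)%:E *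
    \int[leb]_(t in `[0%R, +oo[) energy_density t)%E.
  apply: Hmain => //.
  - exact: measurable_funeM.
  - by move=> t; rewrite mule_ge0.
  - by move=> t t0 HM r r0; exact: evolution_norm_rate.
move: start HT; move: (N f) (g s) (g T) => a b c ab cT H.
apply: (@le_trans _ _ ((b - c)%:E + e%:E)%E); last exact: leeD2r.
by rewrite -EFinD lee_fin; lra.
Qed.

(** Half of N f is finally moved to the left, which is legitimate because f in L^p makes N f a real
    number; an infinite right-hand side is disposed of first. *)
Lemma square_function_bound : 1 <= 2 * q - 2 -> strongly_stable m X (2 * q) ->
  (\int[m]_x (`|f x| `^ (2 * q))%:E <= (square_constant q)%:E *
   \int[m]_x (`|square_function X Jk f x| `^ (2 * q)))%E.
Proof.
move=> q32 stab; pose C := 64 * q ^+ 3; pose l := (2 * C)^-1.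
have -> : square_constant q = 2 * C * l `^ (1 - q) by [].
have C0 : 0 < C by rewrite mulr_gt0// exprn_gt0.
have l0 : 0 < l by rewrite invr_gt0 mulr_gt0.
set K := (\int[m]_x (`|square_function X Jk f x| `^ (2 * q)))%E.
have K0 : (0 <= K)%E by apply: integral_ge0 => x _; exact: poweR_ge0.
have lq0 : 0 < l `^ (1 - q) by rewrite powR_gt0.
have mfp : measurable_fun setT (fun x => (`|f x| `^ (2 * q))%:E).
  by apply/measurable_EFinP; exact: measurable_norm_powR.
have mGq : measurable_fun setT (fun x => G x `^ q)%E.
  exact: (measurableT_comp (measurable_poweR _) measurable_gamma_integral).
have fq0 x : (0 <= (`|f x| `^ (2 * q))%:E)%E by rewrite lee_fin powR_ge0.
have Y : (\int[m]_x ((`|f x| `^ (2 * q - 2))%:E * G x) <=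
    l%:E * (N f)%:E + (l `^ (1 - q))%:E * K)%E.
  apply: (@le_trans _ _ (\int[m]_x (l%:E * (`|f x| `^ (2 * q))%:E +
      (l `^ (1 - q))%:E * G x `^ q))%E).
    apply: ge0_le_integral_nomeas => x _.
      by rewrite mule_ge0 ?gamma_integral_ge0// lee_fin powR_ge0.
    by apply: young_powR => //; exact: gamma_integral_ge0.
  rewrite ge0_integralD//; last 4 first.
  - by move=> x _; rewrite mule_ge0// lee_fin ltW.
  - exact: measurable_funeM.
  - by move=> x _; rewrite mule_ge0 ?poweR_ge0// lee_fin ltW.
  - exact: measurable_funeM.
  rewrite !ge0_integralZl//; try by rewrite lee_fin ltW.
    rewrite (Lp_powerE q1 fp); apply: leeD2l; apply: lee_wpmul2l.
      by rewrite lee_fin ltW.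
    apply: ge0_le_integral_nomeas => x _; first exact: poweR_ge0.
    exact: gamma_integral_le.
  by move=> x _; exact: poweR_ge0.
have := le_trans (Lp_power_le_energy stab)
  (lee_wpmul2l (ltW C0 : (0 <= C%:E)%E) (le_trans (energy_integral_le q32) Y)).
rewrite (Lp_powerE q1 fp); case: K K0 {Y} => [z| |]// z0; last first.
  by move=> _; rewrite gt0_muley ?leey// lte_fin !mulr_gt0.
rewrite -(EFinM l) -(EFinM (l `^ _)) -EFinD -!EFinM !lee_fin.
move: (N f) => a H.
have Cl : C * l = 2^-1 by rewrite /l invfM mulrCA divff ?gt_eqF// mulr1.
have {}H : a <= 2^-1 * a + C * (l `^ (1 - q) * z).
  by apply: (le_trans H); rewrite mulrDr (mulrA C l a) Cl.
have -> : 2 * C * l `^ (1 - q) * z = 2 * (C * (l `^ (1 - q) * z)).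
  by rewrite !mulrA.
by move: H; move: (C * (l `^ _ * z)) => w; lra.
Qed.

End square_function_bound.

(** * Positivity of the constant and passage from p-th powers to norms *)

Lemma square_constant_gt0 (R : realType) (q : R) :
  0 < q -> 0 < square_constant q.
Proof.
move=> q0; have C0 : 0 < 2 * (64 * q ^+ 3) by rewrite !mulr_gt0// exprn_gt0.
by rewrite /square_constant mulr_gt0// powR_gt0// invr_gt0.
Qed.

Unset Implicit Arguments.
Set Strict Implicit.
Set Printing Implicit Defensive.

Theorem proposition4p8 (R : realType) (p : R) (hp : 3 <= p) :
  exists2 c : R, 0 < c &
    forall (E : pmetricType R)
      (m : {measure set (borel E) -> \bar R})
      (D : set (borel E -> R)) (F : (borel E -> R) -> (borel E -> R) -> R)
      (J : {measure set (borel E * borel E) -> \bar R})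
      (Jk : R.-ker (borel E) ~> (borel E))
      (d : measure_display) (Omega : measurableType d)
      (X : hunt_process E Omega),
    locally_compact [set: E] -> separable E ->
    radon m -> full_support m ->
    dirichlet_form m D F -> regular_form m D F ->
    jump_symmetric J -> jump_kernel m J Jk -> pure_jump m D F J ->
    symmetric_process m X -> associated m X D F ->
    strongly_stable m X p ->
    forall f : borel E -> R, f \in Lfun m p%:E ->
      (c%:E * 'N[m]_p%:E[EFin \o f] <=
       'N[m]_p%:E[square_function X Jk f])%E.
Proof.
pose q := p / 2; have pE : p = 2 * q by rewrite /q; lra.
have p0 : 0 < p by lra.
have q1 : 1 < q by rewrite /q; lra.
have q32 : 1 <= 2 * q - 2 by rewrite -pE; lra.
have K0 : 0 < square_constant q by apply: square_constant_gt0; lra.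
(* The p-th root of the bound on p-th powers; it is chosen before the space, so it depends on p
   alone. *)
exists ((square_constant q)^-1 `^ p^-1); first by rewrite powR_gt0 ?invr_gt0.
move=> E m D F J Jk d Omega X lc sep rad _ dirF regF symJ kerJ pureJ symX assF.
rewrite {1 2}pE => stab f fp.
have [B HB] := precompact_baseP lc sep.
have := square_function_bound HB symX rad dirF regF assF symJ kerJ pureJ q1 fp
  q32 stab.
rewrite -pE; move: (square_constant q) K0 => K K0 H.
have I0 (h : borel E -> \bar R) : (0 <= \int[m]_x (`|h x| `^ p))%E.
  by apply: integral_ge0 => x _; exact: poweR_ge0.
have Ki0 : (0 <= (K^-1)%:E)%E by rewrite lee_fin invr_ge0 ltW.
rewrite unlock -poweR_EFin -(poweRM _ Ki0 (I0 _)).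
apply: gt0_ler_poweR.
- by rewrite invr_ge0 ltW.
- rewrite in_itv/= leey andbT; exact: (mule_ge0 Ki0 (I0 (EFin \o f))).
- rewrite in_itv/= leey andbT; exact: I0.
apply: (@le_trans _ _ ((K^-1)%:E * (K%:E *
    \int[m]_x (`|square_function X Jk f x| `^ p)))%E).
  exact: (lee_wpmul2l Ki0 H).
by rewrite muleA -EFinM mulVf ?gt_eqF// mul1e.
Qed.
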